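(* Let $X$ be a non-compact, locally compact Hausdorff space whose topology has a countable basis, and let $L:\mathscr{P}^{(2)}\to\mathbb{R}$ be linear and $\mathcal{N}(X)$-positive. Then the following are equivalent: (a) there exists an $\mathcal{N}(X)$-representing measure for $L$ with finite local third moment; (b) there exist $R>0$ and $\Gamma\in\mathcal{C}_0(X)$ with $\Gamma(x)>0$ for all $x\in X$ such that for all $f_0,f_3\in\mathbb{R}$, $f_1\in\mathcal{C}_c(X)$, $f_2\in\mathcal{C}_c(X^2)$ for which the $\Gamma$-restricted cubic polynomial $$q^{\Gamma}_{f_0,f_1,f_2,f_3}(\eta)=f_0+f_1\eta+f_2\eta^{\otimes 2}+f_3\,\Gamma^{\otimes 3}\eta^{\otimes 3}$$ satisfies $q^{\Gamma}_{f_0,f_1,f_2,f_3}(\eta)\ge 0$ for all $\eta\in\mathcal{N}(X)$, one has $$L(f_0+f_1\eta+f_2\eta^{\otimes 2})+f_3R\ \geq\ 0.$$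
   Context: $\mathcal{C}_c(X^n)$ is the space of continuous real-valued compactly supported functions on $X^n$, and $\mathcal{C}_0(X)$ is the space of continuous real-valued functions on $X$ vanishing at infinity. $\mathcal{M}(X)$ is the vector space of all signed Radon measures on $X$, endowed with the vague topology, i.e. the weakest topology such that $\nu\mapsto\int_X f\,d\nu$ is continuous for every $f\in\mathcal{C}_c(X)$. $\mathcal{N}(X)\subseteq\mathcal{M}(X)$ is the (closed) point configuration space: the set of all Radon measures on $X$ taking as values non-negative integers or infinity, i.e. measures $\eta=\sum_{i\in I}\delta_{x_i}$ with $x_i\in X$, $I$ either $\mathbb{N}$ or a finite (possibly empty) subset of $\mathbb{N}$, and, if $I=\mathbb{N}$, $(x_i)_{i\in I}$ without accumulation points in $X$ (so every compact set contains finitely many of the $x_i$, counted with multiplicity). For $n\in\mathbb{N}$ and $\eta\in\mathcal{M}(X)$, $\eta^{\otimes n}(dx_1,\ldots,dx_n)=\eta(dx_1)\cdots\eta(dx_n)$ is the $n$-fold product measure on $X^n$, and for a function $f_n$ on $X^n$ one writes $f_n\eta^{\otimes n}:=\int_{X^n}f_n\,d\eta^{\otimes n}$. For a function $g$ on $X$, $g^{\otimes 3}(x_1,x_2,x_3)=g(x_1)g(x_2)g(x_3)$; thus for $\eta\in\mathcal{N}(X)$, $\Gamma^{\otimes 3}\eta^{\otimes 3}=\left(\int_X\Gamma\,d\eta\right)^3\in[0,\infty]$, with the convention $0\cdot\infty=0$ in the expression $f_3\,\Gamma^{\otimes 3}\eta^{\otimes 3}$ (and the value $\pm\infty$ according to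 the sign of $f_3\neq 0$ when the integral is infinite). $\mathscr{P}^{(2)}$ is the real vector space of all functions on $\mathcal{M}(X)$ of the form $\eta\mapsto f_0+f_1\eta+f_2\eta^{\otimes 2}$ with $f_0\in\mathbb{R}$, $f_1\in\mathcal{C}_c(X)$, $f_2\in\mathcal{C}_c(X^2)$. $L$ is $\mathcal{N}(X)$-positive if $L(b)\ge 0$ for every $b\in\mathscr{P}^{(2)}$ with $b(\eta)\ge 0$ for all $\eta\in\mathcal{N}(X)$. An $\mathcal{N}(X)$-representing measure for $L$ is a non-negative Radon measure $\nu$ on $\mathcal{M}(X)$ supported in $\mathcal{N}(X)$ such that every $b\in\mathscr{P}^{(2)}$ is $\nu$-integrable and $L(b)=\int_{\mathcal{N}(X)}b(\eta)\,\nu(d\eta)$ for all $b\in\mathscr{P}^{(2)}$. Such a $\nu$ has finite local third moment if for every compact $\Lambda\subseteq X$, $\int_{\mathcal{N}(X)}1_\Lambda^{\otimes 3}\eta^{\otimes 3}\,\nu(d\eta)<\infty$, where $1_\Lambda$ is the indicator function of $\Lambda$ (so the integrand is $\eta(\Lambda)^3$). *)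

(* Defs.v *)
From HB Require Import structures.
From mathcomp Require Import all_boot all_order all_algebra.
From mathcomp Require Import all_classical all_reals all_analysis.

Set Implicit Arguments.
Unset Strict Implicit.
Unset Printing Implicit Defensive.

Import Order.TTheory GRing.Theory Num.Theory.
Import numFieldNormedType.Exports.

Local Open Scope classical_set_scope.
Local Open Scope ring_scope.

Notation borel T := (g_sigma_algebraType (@open T)).

Section function_spaces.
Context (R : realType) (Y : topologicalType).

Definition Cc : set (Y -> R) :=
  [set f | continuous f /\ compact (closure [set y | f y != 0])].

Definition C0 : set (Y -> R) :=
  [set f | continuous f /\
    forall e, 0 < e -> exists2 K, compact K & forall y, ~ K y -> `|f y| < e].

End function_spaces.

(* Locally finite and inner regular with respect to compact sets; this is the
   usual notion on any Hausdorff space. *)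
Definition is_radon (R : realType) (T : ptopologicalType)
    (m : {measure set (borel T) -> \bar R}) : Prop :=
  (forall x : T, exists2 U : set T, open_nbhs x U & (m U < +oo)%E) /\
  (forall B : set (borel T), measurable B ->
    m B = ereal_sup [set m K | K in [set K : set T | compact K /\ K `<=` B]]).

Section signed_radon.
Context (X : ptopologicalType) (R : realType).

(* On a non-compact space the value of a signed Radon measure may be the
   undefined "+oo - +oo" on sets that are not relatively compact, so it is not a
   set function on all Borel sets.  It is represented by its Jordan
   decomposition, the unique pair of mutually singular Radon measures of which
   it is the difference. *)
Record signed_radon := SignedRadon {
  pos : {measure set (borel X) -> \bar R} ;
  neg : {measure set (borel X) -> \bar R} ;
  pos_radon : is_radon pos ;
  neg_radon : is_radon neg ;
  pos_neg_singular : exists A : set (borel X),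
    [/\ measurable A, pos A = 0%E & neg (~` A) = 0%E] }.

Lemma mzero_radon : is_radon (@mzero _ (borel X) R).
Proof.
split=> [x|B mB].
  by exists setT; [split=> //; exact: openT | rewrite /mzero ltry].
rewrite /mzero; apply/eqP; rewrite eq_le; apply/andP; split.
  by apply: ereal_sup_ubound; exists set0 => //; split=> //; exact: compact0.
by apply: ge_ereal_sup => _ [K _ <-].
Qed.

Lemma mzero_singular : exists A : set (borel X),
  [/\ measurable A, @mzero _ (borel X) R A = 0%E
    & @mzero _ (borel X) R (~` A) = 0%E].
Proof. by exists set0; split=> //; exact: measurable0. Qed.

HB.instance Definition _ := gen_eqMixin signed_radon.
HB.instance Definition _ := gen_choiceMixin signed_radon.
HB.instance Definition _ := isPointed.Build signed_radon
  (SignedRadon mzero_radon mzero_radon mzero_singular).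

Definition int1 (f : X -> R) (eta : signed_radon) : R :=
  \int[pos eta]_x f x - \int[neg eta]_x f x.

(* The positive and negative parts of the product of [eta] with itself are
   p x p + n x n and p x n + n x p. *)
Definition int2 (f : X * X -> R) (eta : signed_radon) : R :=
  let I (m1 m2 : {measure set (borel X) -> \bar R}) :=
    fine (\int[m1 \x m2]_z (f z)%:E)%E in
  let p := pos eta in let n := neg eta in
  (I p p + I n n) - (I p n + I n p).

Definition tensor3 (g : X -> R) (z : X * X * X) : R :=
  g z.1.1 * g z.1.2 * g z.2.

(* Only used for non-negative [eta], and then extended-real valued. *)
Definition int3 (f : X * X * X -> R) (eta : signed_radon) : \bar R :=
  (\int[(pos eta \x pos eta) \x pos eta]_z (f z)%:E)%E.

Definition vague_topology := sup_topology
  (fun f : {f : X -> R | Cc f} =>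
     Topological.class (initial_topology (int1 (sval f)))).

HB.instance Definition _ := Topological.copy signed_radon vague_topology.

(* [N(X)]: the non-negative elements with values in {0, 1, 2, ...; +oo} *)
Definition point_configurations : set signed_radon :=
  [set eta | forall B : set (borel X), measurable B ->
    neg eta B = 0%E /\
    ((exists k : nat, pos eta B = k%:R%:E) \/ pos eta B = +oo%E)].

Definition quadratic (f0 : R) (f1 : X -> R) (f2 : X * X -> R)
    (eta : signed_radon) : R :=
  f0 + int1 f1 eta + int2 f2 eta.

Definition P2 : set (signed_radon -> R) :=
  [set b | exists f0 f1 f2, [/\ Cc f1, Cc f2 & b = quadratic f0 f1 f2]].

(* In \bar R, 0 * +oo = 0. *)
Definition restricted_cubic (Gamma : X -> R) (f0 : R) (f1 : X -> R)
    (f2 : X * X -> R) (f3 : R) (eta : signed_radon) : \bar R :=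
  ((quadratic f0 f1 f2 eta)%:E + f3%:E * int3 (tensor3 Gamma) eta)%E.

(* A functional on P2 is a function on all of [signed_radon -> R] of which only
   the values on P2 matter. *)
Definition linear_on_P2 (L : (signed_radon -> R) -> R) : Prop :=
  forall (a : R) (b c : signed_radon -> R), P2 b -> P2 c ->
    L (fun eta => a * b eta + c eta) = a * L b + L c.

Definition N_positive (L : (signed_radon -> R) -> R) : Prop :=
  forall b, P2 b -> (forall eta, point_configurations eta -> 0 <= b eta) ->
    0 <= L b.

Definition representing (L : (signed_radon -> R) -> R)
    (nu : {measure set (borel signed_radon) -> \bar R}) : Prop :=
  [/\ is_radon nu, nu (~` point_configurations) = 0%E &
      forall b, P2 b ->
        nu.-integrable setT (EFin \o b) /\
        ((L b)%:E = \int[nu]_(eta in point_configurations) (b eta)%:E)%E].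

Definition finite_local_third_moment
    (nu : {measure set (borel signed_radon) -> \bar R}) : Prop :=
  forall K : set X, compact K ->
    (\int[nu]_(eta in point_configurations) int3 (tensor3 \1_K) eta < +oo)%E.

End signed_radon.

(* Main.v *)
Require Import Defs.
From HB Require Import structures.
From mathcomp Require Import all_boot all_order all_algebra.
From mathcomp Require Import all_classical all_reals all_analysis.
From mathcomp Require Import ring lra measurable_realfun.
Set Implicit Arguments.
Unset Strict Implicit.
Unset Printing Implicit Defensive.
Import Order.TTheory GRing.Theory Num.Theory.
Import numFieldNormedType.Exports.
Local Open Scope classical_set_scope.
Local Open Scope ring_scope.


(* From (b) to (a): call the integral h of Gamma the height of a configuration,
   finite on a subset D of N(X).  By (b), every f of at most cubic growth in h on D
   has the well-defined sublinear majorant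
   p(f) = inf {L(q) + c r | q in P2, c >= 0, f <= q + c h^3 on D}, and by Hahn-Banach
   there is a linear l <= p; it is monotone, agrees with L on P2, and l(h^3) <= r.
   As l is only finitely additive, it is realized on the real line: countably many
   decisions (bounds on h, positions of the points of the configuration, listed in
   slots) split D in a binary tree, hence an interval of length l(1) into nested
   intervals of length the l-mass of the branches.  Along almost every branch the
   heights are bounded (this is where l(h^3) < oo enters), so that the slots converge
   in the one-point compactification of X, and the limit configuration is an almost
   everywhere continuous function T of the branch.  The image of Lebesgue measure
   under T is Radon; it integrates quadratic polynomials to l because these are
   O(h^2), so that their l-mass above height n is O(1/n).

   From (a) to (b): take Gamma = sum_k 2^-(k+1) psi_k, where the psi_k are compactly
   supported, cover X, and satisfy int (psi_k eta)^3 dnu <= 1.  By Jensen's inequality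
   int (Gamma eta)^3 dnu <= 1, and integrating a nonnegative cubic polynomial gives
   (b) with r = 1, provided f3 >= 0; the latter is seen on multiples of a Dirac mass. *)

(** * Geometrically weighted sums and bump functions *)

(** Two obstacles shape the proof: a functional from Hahn-Banach carries no continuity, and mass may
    escape to infinite height or to infinity in X. Escape in X is controlled since Gamma is positive
    and vanishes at infinity: the sets where Gamma >= 1/j are compact, exhaust X, and hold at most j
    n points of a configuration of height at most n. With the points listed in the order of these
    sets, the number of slots that can meet a given compact set depends on n alone. So slotwise
    limits stay locally finite, and integrals of compactly supported functions are finite sums over
    a fixed range of slots. The height itself may drop in the limit, hence only compactly supported
    functionals are followed there. Comparing functions on D alone loses nothing: where h is
    infinite, c h^3 with c > 0 makes the cubic polynomial +oo. The passage through an interval takes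
    both countable additivity and inner regularity from Lebesgue measure, on a target space that is
    not locally compact. *)

Section geometric_sums.
Context (R : realType) (T : topologicalType) (u : nat -> T -> R).
Hypothesis u0 : forall n x, 0 <= u n x.
Hypothesis u1 : forall n x, u n x <= 2^-1 ^+ n.+1.

Let usum x := [series u k x]_k : R^nat.

Definition geosum (x : T) : R := limn (usum x).

Let half_sum m n : \sum_(m <= k < m + n) (2^-1 : R) ^+ k.+1
  = 2^-1 ^+ m - 2^-1 ^+ (m + n).
Proof.
elim: n => [|n IH]; first by rewrite addn0 big_geq// subrr.
rewrite addnS big_nat_recr ?leq_addr//= IH [in RHS]exprS.
by rewrite exprS; lra.
Qed.

Let usum_nd x : nondecreasing_seq (usum x).
Proof. by apply: nondecreasing_series => n _ _; exact: u0. Qed.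

Let usum_tail x m n : usum x (m + n)%N - usum x m <= 2^-1 ^+ m.
Proof.
rewrite /usum /series/= (big_cat_nat (n := m)) ?leq_addr//= addrAC subrr add0r.
apply: (@le_trans _ _ (\sum_(m <= k < m + n) (2^-1 : R) ^+ k.+1)).
  by apply: ler_sum => i _; exact: u1.
by rewrite half_sum gerBl exprn_ge0// invr_ge0.
Qed.

Let usum_cvg x : cvgn (usum x).
Proof.
apply: nondecreasing_is_cvgn => //; exists 1 => _ [n _ <-].
have := usum_tail x 0 n; rewrite add0n expr0 => h.
by apply: le_trans h; rewrite /usum /series/= [X in _ - X]big_geq// subr0.
Qed.

Lemma geosum_ge x n : \sum_(k < n) u k x <= geosum x.
Proof.
rewrite -(big_mkord xpredT (u^~ x)).
rewrite -[leLHS]/(usum x n).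
rewrite /geosum; apply: nondecreasing_cvgn_le; first exact: usum_nd.
exact: usum_cvg.
Qed.

(** The tail after [n] terms is at most [2^-1 ^+ n] uniformly in [x]. This gives continuity of the
    sum and, later, the vanishing at infinity of the weight built from it. *)
Lemma geosum_le x n : geosum x <= \sum_(k < n) u k x + 2^-1 ^+ n.
Proof.
rewrite -(big_mkord xpredT (u^~ x)) -lerBlDl.
rewrite lerBlDl; apply: limr_le; first exact: usum_cvg.
exists n => // m /= nm; rewrite -lerBlDl -(subnKC nm).
exact: usum_tail.
Qed.

Lemma geosum_ge0 x : 0 <= geosum x.
Proof. by have := geosum_ge x 0; rewrite big_ord0. Qed.

Lemma geosum_le1 x : geosum x <= 1.
Proof. by have := geosum_le x 0; rewrite big_ord0 add0r expr0. Qed.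

Lemma geosum_gt0 x n : 0 < u n x -> 0 < geosum x.
Proof.
move=> un; apply: lt_le_trans (geosum_ge x n.+1).
by rewrite big_ord_recr/= ltr_wpDl// sumr_ge0.
Qed.

Lemma geosum_eq0 x : (forall n, u n x = 0) -> geosum x = 0.
Proof.
move=> h; rewrite /geosum (_ : usum x = cst 0) ?lim_cst//.
by apply/funext => n; rewrite /usum /series/= big1.
Qed.

Lemma geosum_cvg x : \sum_(k < n) u k x @[n --> \oo] --> geosum x.
Proof.
rewrite (_ : (fun n => _) = usum x); first exact: usum_cvg.
by apply/funext => n; rewrite /usum /series/= big_mkord.
Qed.

Lemma half_pow_lt (e : R) : 0 < e -> exists n, 2^-1 ^+ n < e.
Proof.
move=> e0; have /cvgrPdist_lt/(_ e e0) : (2^-1 : R) ^+ n @[n --> \oo] --> 0.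
  by apply: cvg_expr; rewrite ger0_norm ?invr_ge0// invf_lt1 ?ltr1n.
case=> n _ /(_ n)/=; rewrite leqnn sub0r normrN ger0_norm ?exprn_ge0 ?invr_ge0//.
by move=> /(_ erefl) h; exists n.
Qed.

Lemma geosum_continuous : (forall n, continuous (u n)) -> continuous geosum.
Proof.
move=> cu x; apply/cvgrPdist_lt => e e0.
have [n hn] : exists n, (2^-1 : R) ^+ n < e / 2 by apply: half_pow_lt; rewrite divr_gt0.
have : {for x, continuous (fun y => \sum_(k < n) u k y)}.
  have -> : (fun y => \sum_(k < n) u k y) = \sum_(k < n) u k.
    by apply/funext => y; rewrite fct_sumE.
  elim/big_ind: _ => [|f g cf cg|i _]; first exact: cvg_cst.
    exact: cvgD.
  exact: cu.
move=> /cvgrPdist_lt/(_ (e / 2)); rewrite divr_gt0// => /(_ isT).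
apply: filterS => y; rewrite !ltr_norml => /andP[h1 h2].
have := geosum_le x n; have := geosum_ge x n.
have := geosum_le y n; have := geosum_ge y n => *.
by apply/andP; split; lra.
Qed.

End geometric_sums.

(** * Continuous functions with compact support *)

Section compact_support.
Context (R : realType) (Y : topologicalType).
Hypothesis hY : hausdorff_space Y.
Implicit Types f g : Y -> R.

(** Compact sets are closed in a Hausdorff space, so any compact set off which [f] vanishes contains
    the closed support. Exhibiting such a set is easier than handling the closure. *)
Lemma CcP f : Cc f <->
  continuous f /\ exists2 K, compact K & forall y, ~ K y -> f y = 0.
Proof.
split=> [[cf cK]|[cf [K cK fK]]].
  split=> //; exists (closure [set y | f y != 0]) => // y ny.
  by apply/eqP; apply: contra_notT ny => fy; exact: subset_closure.
split=> //; apply: (subclosed_compact _ cK); first exact: closed_closure.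
have /closure_id -> : closed K by exact: compact_closed.
apply: closureS => y /= fy; apply: contrapT => /fK fy0.
by rewrite fy0 eqxx in fy.
Qed.

Lemma Cc0 : Cc (fun _ : Y => 0 : R).
Proof.
apply/CcP; split; first by move=> ?; exact: cvg_cst.
by exists set0 => //; exact: compact0.
Qed.

Lemma CcZD a f g : Cc f -> Cc g -> Cc (fun x => a * f x + g x).
Proof.
move=> /CcP[cf [K cK fK]] /CcP[cg [K' cK' gK']]; apply/CcP; split.
  move=> x; apply: cvgD; last exact: cg.
  by apply: cvgM; [exact: cvg_cst|exact: cf].
exists (K `|` K'); first exact: compactU.
by move=> y /not_orP[/fK -> /gK' ->]; rewrite mulr0 addr0.
Qed.

Lemma CcM f g : continuous f -> Cc g -> Cc (fun x => f x * g x).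
Proof.
move=> cf /CcP[cg [K cK gK]]; apply/CcP; split.
  by move=> x; apply: cvgM; [exact: cf|exact: cg].
by exists K => // y /gK ->; rewrite mulr0.
Qed.

Lemma CcD f g : Cc f -> Cc g -> Cc (fun x => f x + g x).
Proof.
move=> cf cg; have := CcZD 1 cf cg.
by under eq_fun do rewrite mul1r.
Qed.

Lemma CcZ a f : Cc f -> Cc (fun x => a * f x).
Proof. by move=> cf; apply: CcM => // ?; exact: cvg_cst. Qed.

Lemma Cc_sum (I : eqType) (s : seq I) (F : I -> Y -> R) :
  (forall i, i \in s -> Cc (F i)) -> Cc (fun x => \sum_(i <- s) F i x).
Proof.
elim: s => [|i s IH] cF.
  by under eq_fun do rewrite big_nil; exact: Cc0.
under eq_fun do rewrite big_cons.
apply: CcD; first by apply: cF; rewrite mem_head.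
by apply: IH => j js; apply: cF; rewrite in_cons js orbT.
Qed.

Lemma Cc_bounded f : Cc f -> exists2 C, 0 <= C & forall x, `|f x| <= C.
Proof.
move=> /CcP[cf [K cK fK]].
have : compact ((fun x => `|f x|) @` K).
  apply: continuous_compact => //; apply: continuous_subspaceT => x.
  by apply: continuous_comp; [exact: cf|exact: norm_continuous].
move=> /compact_bounded[M [_ /(_ (`|M| + 1))]].
rewrite ltr_pwDr ?ler_norm// => /(_ isT) bM.
exists (`|M| + 1); first by rewrite addr_ge0.
move=> x; have [Kx|/fK ->] := pselect (K x); last by rewrite normr0 addr_ge0.
by apply: le_trans (bM `|f x| _); rewrite ?normr_id//; exists x.
Qed.

End compact_support.

Lemma compact_cover_seq (X : ptopologicalType) (I : choiceType) (K : set X)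
    (D : set I) (f : I -> set X) :
  compact K -> (forall i, D i -> open (f i)) ->
  (forall x, K x -> exists2 i, D i & f i x) ->
  exists2 s : seq I, (forall i, i \in s -> D i) &
    forall x, K x -> exists2 i, i \in s & f i x.
Proof.
rewrite compact_cover => /(_ I D f) + fo Kf => /(_ fo)[].
  by move=> x /Kf[i Di fix_]; exists i.
move=> D' D'D KD'; exists (finmap.enum_fset D') => [i /D'D|x /KD'[i iD' fix_]].
  by rewrite inE.
by exists i.
Qed.

Section bump_functions.
Context (R : realType) (X : ptopologicalType).
Hypothesis X_locally_compact : locally_compact [set: X].
Hypothesis X_hausdorff : hausdorff_space X.

Lemma locally_compact_nbhs (x : X) : exists2 K, nbhs x K & compact K.
Proof.
have := @X_locally_compact x I.
by rewrite withinET => -[K xK [cK _]]; exists K.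
Qed.

(** Complete regularity separates [x] from the complement of [U] intersected with the interior of a
    compact neighbourhood; the latter makes the support compact. The separating function is 0 at
    [x], hence the flip [1 - f]. *)
Lemma bump_point (x : X) (U : set X) : open U -> U x ->
  exists f : X -> R, [/\ Cc f, forall y, 0 <= f y <= 1, f x = 1 &
    forall y, ~ U y -> f y = 0].
Proof.
move=> oU Ux; have [K xK cK] := locally_compact_nbhs x.
have cr := @locally_compact_completely_regular X R X_locally_compact X_hausdorff.
have us : uniform_separator [set x] (~` (U `&` K°)).
  apply: cr; last by apply; split => //; exact: nbhs_interior.
  by apply: open_closedC; apply: openI => //; exact: open_interior.
move/uniform_separatorP : us => /(_ R)[f [cf f01 fx0 fU1]].
have f1 y : ~ (U `&` K°) y -> f y = 1.
  by move=> h; apply: fU1; exists y.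
exists (fun y => 1 - f y); split => [|y||y nUy].
- apply/CcP => //; split; first by move=> y; apply: cvgB; [exact: cvg_cst|exact: cf].
  exists K => // y nKy; rewrite f1 ?subrr// => -[_ Ky].
  by apply: nKy; exact: interior_subset Ky.
- have : `[0, 1]%classic (f y) by apply: f01; exists y.
  by rewrite /= in_itv/= => /andP[? ?]; apply/andP; split; lra.
- by rewrite (fx0 (f x)) ?subr0//; exists x.
- by rewrite f1 ?subrr// => -[].
Qed.

(** Finitely many pointwise bumps have a sum above 1/2 on [K]; doubling it and cutting at 1 flattens
    it there. *)
Lemma bump_compact (K U : set X) : compact K -> open U -> K `<=` U ->
  exists f : X -> R, [/\ Cc f, forall y, 0 <= f y <= 1,
    forall y, K y -> f y = 1 & forall y, ~ U y -> f y = 0].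
Proof.
move=> cK oU KU.
have /choice[f fP] (x : X) : exists f : X -> R, U x ->
    [/\ Cc f, forall y, 0 <= f y <= 1, f x = 1 & forall y, ~ U y -> f y = 0].
  have [Ux|nUx] := pselect (U x); last by exists (fun=> 0).
  by have [f fP] := bump_point oU Ux; exists f.
have [|x Kx|D DK KD] := @compact_cover_seq _ _ K K
    (fun x => [set y | 2^-1 < f x y]) cK.
- move=> x Kx; have [[cf _] _ _ _] := fP x (KU x Kx).
  apply: (@open_comp _ _ (f x) [set z | 2^-1 < z]); last exact: open_gt.
  by move=> z _; exact: cf.
- exists x => //=; have [_ _ -> _] := fP x (KU x Kx).
  by rewrite invf_lt1 ?ltr1n.
have DU x : x \in D -> U x by move=> /DK /KU.
pose s y := \sum_(x <- D) f x y.
have cs : Cc s by apply: Cc_sum => // x xD; have [] := fP x (DU x xD).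
have s0 y : 0 <= s y.
  by rewrite /s big_seq sumr_ge0// => x xD; have [_ /(_ y)/andP[]] := fP x (DU x xD).
have sK y : K y -> 2^-1 < s y.
  move=> /KD[x xD fxy]; apply: lt_le_trans fxy _; rewrite /s.
  rewrite (big_rem x)//= lerDl big_seq sumr_ge0// => z /mem_rem zD.
  by have [_ /(_ y)/andP[]] := fP z (DU z zD).
have sU y : ~ U y -> s y = 0.
  move=> nUy; rewrite /s big_seq big1// => x xD.
  by have [_ _ _ ->] := fP x (DU x xD).
exists (fun y => Num.min 1 (2 * s y)); split => [|y|y Ky|y /sU ->].
- have [cs' [K' cK' sK']] := (CcP X_hausdorff _).1 cs.
  apply/CcP => //; split.
    move=> y; apply: (@continuous_min _ _ (fun=> 1) (fun y => 2 * s y)).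
      exact: cvg_cst.
    by apply: cvgM; [exact: cvg_cst|exact: cs'].
  by exists K' => // y /sK' ->; rewrite mulr0 min_r // ler01.
- by rewrite le_min ler01 mulr_ge0//= ge_min lexx.
- by apply/min_idPl; have := sK y Ky; lra.
- by rewrite mulr0 min_r // ler01.
Qed.

End bump_functions.

(** The injection of a countable base into [nat] is inverted; codes that are not hit receive the
    empty set. *)
Lemma second_countable_seq (X : ptopologicalType) : @second_countable X ->
  exists U : nat -> set X, (forall n, open (U n)) /\
    forall x O, open O -> O x -> exists2 n, U n x & U n `<=` O.
Proof.
move=> [B /countable_injP[f finj] [Bo Bn]].
have /choice[U UP] n : exists U, open U /\ forall V, B V -> f V = n -> V = U.
  have [[V [BV fV]]|h] := pselect (exists V, B V /\ f V = n).
    exists V; split; first exact: Bo.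
    by move=> W BW fW; apply: finj; rewrite ?inE ?fV ?fW.
  exists set0; split; first exact: open0.
  by move=> V BV fV; exfalso; apply: h; exists V.
exists U; split=> [n|x O oO Ox]; first by have [] := UP n.
have [V [BV Vx] VO] := Bn x O (open_nbhs_nbhs (conj oO Ox)).
by exists (f V); rewrite -((UP (f V)).2 V BV).
Qed.

Section second_countable_locally_compact.
Context (R : realType) (X : ptopologicalType).
Hypothesis X_locally_compact : locally_compact [set: X].
Hypothesis X_hausdorff : hausdorff_space X.
Hypothesis X_second_countable : @second_countable X.

(** Members of a base that lie in no compact set are emptied. The rest is still a base, since every
    open set may first be cut down to the interior of a compact neighbourhood. *)
Lemma relatively_compact_base : exists U : nat -> set X,
  [/\ forall n, open (U n), forall n, exists2 K, compact K & U n `<=` K &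
    forall x O, open O -> O x -> exists2 n, U n x & U n `<=` O].
Proof.
have [U [oU bU]] := second_countable_seq X_second_countable.
pose c n := exists2 K, compact K & U n `<=` K.
exists (fun n => [set x | U n x /\ c n]); split=> [n|n|x O oO Ox].
- have [cn|cn] := pselect (c n).
    rewrite (_ : [set _ | _] = U n) //.
    by apply/seteqP; split=> x /= => [[]|].
  rewrite (_ : [set _ | _] = set0); first exact: open0.
  by apply/seteqP; split=> x /= => [[]|].
- have [[K cK UK]|cn] := pselect (c n).
    by exists K => // x [/UK].
  by exists set0; [exact: compact0|move=> x []].
have [K xK cK] := locally_compact_nbhs X_locally_compact x.
have [|n Unx nO] := bU x (O `&` K°) (openI oO (@open_interior _ _)).
  by split=> //; exact: nbhs_interior.
have cn : c n by exists K => // y /nO[_]; exact: interior_subset.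
by exists n => // y [/nO[]].
Qed.

(** With a countable base, a compact set is the zero set of a continuous function [S], a geometric
    series of functions attached to the base; [(1 - S) * h0] then peaks exactly on [K]. *)
Lemma compact_peak (K : set X) : compact K -> exists h : X -> R,
  [/\ Cc h, forall x, 0 <= h x <= 1 & forall x, h x = 1 <-> K x].
Proof.
move=> cK; have clK : closed K by exact: compact_closed.
have [U [oU bU]] := second_countable_seq X_second_countable.
(* [g n] is positive on [U n] whenever some function vanishing on [K] can be, and 0 otherwise. A
   point off [K] has a bump avoiding [K], and a base set inside the positivity set of that bump
   serves. *)
have /choice[g gP] n : exists g : X -> R, [/\ continuous g,
    forall x, 0 <= g x <= 1, forall x, K x -> g x = 0 &
    (exists f : X -> R, [/\ continuous f, forall x, 0 <= f x <= 1,
       forall x, K x -> f x = 0 & forall x, U n x -> 0 < f x]) ->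
    forall x, U n x -> 0 < g x].
  have [[f [fc f01 fK fU]]|h] := pselect (exists f : X -> R, [/\ continuous f,
      forall x, 0 <= f x <= 1, forall x, K x -> f x = 0 &
      forall x, U n x -> 0 < f x]).
    by exists f.
  exists (fun=> 0); split=> // [x|x]; first exact: cvg_cst.
  by rewrite lexx ler01.
pose u n x := 2^-1 ^+ n.+1 * g n x.
have gc n : continuous (g n) by have [] := gP n.
have g01 n x : 0 <= g n x <= 1 by have [_ /(_ x)] := gP n.
have gK n x : K x -> g n x = 0 by have [_ _ /(_ x)] := gP n.
have p2 n : 0 < (2^-1 : R) ^+ n by rewrite exprn_gt0// invr_gt0.
have u0 n x : 0 <= u n x by case/andP: (g01 n x) => *; rewrite mulr_ge0// ltW.
have u1 n x : u n x <= 2^-1 ^+ n.+1.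
  by case/andP: (g01 n x) => *; rewrite ler_piMr// ltW.
have [h0 [h0c h001 h0K _]] := @bump_compact R X X_locally_compact X_hausdorff
  K setT cK openT (@subsetT _ _).
pose S := geosum u.
have Sc : continuous S.
  apply: geosum_continuous => // n x.
  by apply: cvgM; [exact: cvg_cst|exact: gc].
have S0 x : 0 <= S x by exact: geosum_ge0.
have S1 x : S x <= 1 by exact: geosum_le1.
have Spos x : ~ K x -> 0 < S x.
  move=> nKx; have oK : open (~` K) by exact: closed_openC.
  have [f [fC f01 fx fK]] := @bump_point R X X_locally_compact X_hausdorff x _ oK nKx.
  have [fc _] := fC.
  have of_ : open [set y | 0 < f y].
    apply: (@open_comp _ _ f [set z | 0 < z]); last exact: open_gt.
    by move=> z _; exact: fc.
  have [|n Unx Un] := bU x _ of_; first by rewrite /= fx.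
  apply: (@geosum_gt0 _ _ u u0 u1 x n); rewrite /u mulr_gt0//.
  have [_ _ _] := gP n; apply => //; exists f; split=> // y Ky.
  by apply: fK; exact.
exists (fun x => (1 - S x) * h0 x); split.
- apply: CcM => // x; apply: cvgB; first exact: cvg_cst.
  exact: Sc.
- move=> x; have /andP[? ?] := h001 x; have := S0 x; have := S1 x => ? ?.
  apply/andP; split; first by rewrite mulr_ge0 ?subr_ge0.
  by rewrite mulr_ile1 ?subr_ge0// gerBl.
move=> x; split=> [|Kx]; last first.
  rewrite h0K// mulr1 /S geosum_eq0 ?subr0// => n.
  by rewrite /u gK// mulr0.
apply: contraPP => nKx; have := Spos x nKx; have := S1 x.
have /andP[? ?] := h001 x; move=> ? ? /eqP.
by apply/negP; rewrite lt_eqF//; nra.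
Qed.

(** The fourth clause lets the indicator of the set where [f n] is 1 fit between [f n.+1] and [f n];
    the integrality of vague limits rests on it. *)
Lemma compact_approx (K : set X) : compact K -> exists f : nat -> X -> R,
  [/\ forall n, Cc (f n), forall n x, 0 <= f n x <= 1,
      forall n x, K x -> f n x = 1,
      forall n x, f n.+1 x != 0 -> f n x = 1 &
      forall x, ~ K x -> exists N, forall n, (N <= n)%N -> f n x = 0].
Proof.
move=> cK; have [h [hC h01 h1]] := compact_peak cK.
(* [f n] is 1 where [3 ^+ n.+1 * (1 - h x)] is at most 1 and 0 where it is at least 2. The base 3
   exceeds the ratio 2 of these thresholds, so the support of [f n.+1] falls where [f n] is 1. *)
pose f n x := Num.max 0 (Num.min 1 (2 - 3 ^+ n.+1 * (1 - h x))).
have e1 n x : 1 <= 2 - 3 ^+ n.+1 * (1 - h x) -> f n x = 1.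
  by move=> l; rewrite /f min_l// max_r.
have e0 n x : 2 - 3 ^+ n.+1 * (1 - h x) <= 0 -> f n x = 0.
  by move=> l; rewrite /f min_r ?max_l// (le_trans l).
have p3 n : 1 <= (3 : R) ^+ n by rewrite exprn_ege1// ler1n.
have [hc [K' cK' hK']] := (CcP X_hausdorff _).1 hC.
exists f; split.
- move=> n; apply/CcP => //; split.
    move=> y; apply: (@continuous_max _ _ (fun=> 0)
      (fun y => Num.min 1 (2 - 3 ^+ n.+1 * (1 - h y)))).
      exact: cvg_cst.
    apply: (@continuous_min _ _ (fun=> 1)
      (fun y => 2 - 3 ^+ n.+1 * (1 - h y))); first exact: cvg_cst.
    apply: cvgB; first exact: cvg_cst.
    apply: cvgM; first exact: cvg_cst.
    by apply: cvgB; [exact: cvg_cst|exact: hc].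
  exists K' => // y /hK' hy; apply: e0; rewrite hy subr0 mulr1 exprS.
  by have := p3 n; lra.
- move=> n x; rewrite /f le_max lexx/= ge_max ler01/= ge_min lexx//.
- move=> n x /h1 hx; apply: e1; rewrite hx subrr mulr0 subr0.
  by rewrite ler1n.
- move=> n x; apply: contra_neq_eq => /eqP fn.
  apply: e0; rewrite leNgt; apply/negP => l; apply: fn; apply: e1.
  by move: l; rewrite exprS; have /andP[_ ?] := h01 x; lra.
move=> x nKx; have hx : 0 < 1 - h x.
  rewrite subr_gt0 lt_neqAle; have /andP[_ ->] := h01 x; rewrite andbT.
  by apply/eqP => /h1.
have [N hN] := half_pow_lt (divr_gt0 hx (@ltr0n R 2)).
exists N => n Nn; apply: e0.
have h3 : 2 ^+ N <= (3 : R) ^+ n.+1.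
  apply: (@le_trans _ _ (2 ^+ n)).
    by rewrite ler_weXn2l// ler1n.
  apply: (@le_trans _ _ (3 ^+ n)); first by apply: lerXn2r; rewrite ?nnegrE ?ler_nat.
  by rewrite ler_weXn2l// ler1n.
have := hN; rewrite exprVn ltr_pdivlMr// -ltr_pdivlMl ?exprn_gt0 ?invr_gt0 ?exprn_gt0// invrK.
move=> h2; rewrite subr_le0; apply: (le_trans (ltW h2)).
by rewrite ler_pM2r.
Qed.

End second_countable_locally_compact.

(** Product measures and Fubini ask for the bundled structure, while Radon measures are only shown
    to be sigma-finite. Equality as set functions allows rewriting a measure by its packed copy. *)
Lemma sigma_finite_pack d (T : measurableType d) (R : realType)
    (m : {measure set T -> \bar R}) : sigma_finite setT m ->
  exists m' : {sigma_finite_measure set T -> \bar R}, m = m' :> (set T -> \bar R).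
Proof.
move=> sm.
pose m1 : SFiniteMeasure.type T R := HB.pack (Measure.sort m)
  (isSFinite.Build _ _ _ (Measure.sort m) (sfinite_measure_sigma_finite sm)).
pose m' : {sigma_finite_measure set T -> \bar R} :=
  HB.pack (Measure.sort m) m1 (@isSigmaFinite.Build _ _ _ (Measure.sort m) sm).
by exists m'.
Qed.

Lemma open_borel (T : ptopologicalType) (U : set T) : open U ->
  measurable (U : set (borel T)).
Proof. by move=> oU; apply: sub_sigma_algebra. Qed.

Lemma closed_borel (T : ptopologicalType) (U : set T) : closed U ->
  measurable (U : set (borel T)).
Proof.
move=> cU; rewrite -(setCK U); apply: measurableC; apply: open_borel.
exact: closed_openC.
Qed.

Lemma measurable_fun_open_gt d (T : measurableType d) (R : realType) (f : T -> R) :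
  (forall r, measurable [set x | r < f x]) -> measurable_fun setT f.
Proof.
move=> h; apply: (measurability _ (RGenOInfty.measurableE R)) => _ [_ [r ->] <-].
rewrite setTI (_ : _ @^-1` _ = [set x | r < f x]) //.
by apply/seteqP; split=> x /=; rewrite in_itv/= andbT.
Qed.

Lemma continuous_borel (T : ptopologicalType) (R : realType) (f : T -> R) :
  continuous f -> measurable_fun setT (f : borel T -> R).
Proof.
move=> cf; apply: measurable_fun_open_gt => r; apply: open_borel.
apply: (@open_comp _ _ f [set z | r < z]); last exact: open_gt.
by move=> z _; exact: cf.
Qed.

Lemma bounded_support_integrable d (T : measurableType d) (R : realType)
    (m : {measure set T -> \bar R}) (K : set T) (f : T -> R) (C : R) :
  measurable K -> (m K < +oo)%E -> measurable_fun setT f ->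
  (forall x, `|f x| <= C) -> (forall x, ~ K x -> f x = 0) ->
  m.-integrable setT (EFin \o f).
Proof.
move=> mK finK mf fC fK.
have -> : EFin \o f = (EFin \o f) \_ K.
  apply/funext => x; rewrite patchE; case: ifPn => //=.
  by move/negP; rewrite inE => /fK ->.
apply/(integrable_mkcond _ mK).1; apply: measurable_bounded_integrable => //.
  exact: measurable_funS mf.
exists C; split; first exact: num_real.
by move=> M CM x _; rewrite /= (le_trans (fC x))// ltW.
Qed.

(** * Radon measures and their products *)

Section radon_measures.
Context (R : realType) (X : ptopologicalType).
Hypothesis X_locally_compact : locally_compact [set: X].
Hypothesis X_hausdorff : hausdorff_space X.
Hypothesis X_second_countable : @second_countable X.
Implicit Types m : {measure set (borel X) -> \bar R}.

Lemma compact_borel (K : set X) : compact K -> measurable (K : set (borel X)).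
Proof. by move=> cK; apply: closed_borel; exact: compact_closed. Qed.

Lemma radon_compact m (K : set X) : is_radon m -> compact K -> (m K < +oo)%E.
Proof.
move=> [lf _] cK.
have /choice[U UP] (x : X) : exists U : set X, open_nbhs x U /\ (m U < +oo)%E.
  by have [U ? ?] := lf x; exists U.
have [||s _ Ks] := @compact_cover_seq _ _ K setT U cK.
- by move=> x _; have [[]] := UP x.
- by move=> x _; exists x => //; have [[]] := UP x.
have mU x : measurable (U x : set (borel X)).
  by apply: open_borel; have [[]] := UP x.
apply: (@le_lt_trans _ _ (m (\big[setU/set0]_(x <- s) U x))).
  apply: le_measure; rewrite ?inE; first exact: compact_borel.
    exact: bigsetU_measurable.
  move=> y /Ks[x xs Uxy]; rewrite -bigcup_seq; by exists x.
elim: s {Ks} => [|x s IH]; first by rewrite big_nil measure0 ltry.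
rewrite big_cons; apply: (le_lt_trans (measureU2 _ _ _)) => //.
  exact: bigsetU_measurable.
by rewrite lte_add_pinfty//; have [] := UP x.
Qed.

Lemma radon_sigma_finite m : is_radon m -> sigma_finite setT m.
Proof.
move=> rm; have [U [oU cU bU]] := relatively_compact_base X_locally_compact X_second_countable.
exists U.
  apply/seteqP; split=> // x _; have [n Ux _] := bU x setT openT I.
  by exists n.
move=> n; split; first exact: open_borel.
have [K cK UK] := cU n; apply: le_lt_trans (radon_compact rm cK).
by apply: le_measure => //; rewrite ?inE; [exact: open_borel|exact: compact_borel].
Qed.

Lemma Cc_borel (f : X -> R) : Cc f -> measurable_fun setT (f : borel X -> R).
Proof. by move=> [cf _]; exact: continuous_borel. Qed.

Lemma Cc_integrable m (f : X -> R) : is_radon m -> Cc f ->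
  m.-integrable setT (EFin \o f).
Proof.
move=> rm cf; have [C _ fC] := Cc_bounded X_hausdorff cf.
have [_ [K cK fK]] := (CcP X_hausdorff _).1 cf.
apply: (@bounded_support_integrable _ (borel X) R m K f C) => //.
- exact: compact_borel.
- exact: radon_compact.
- exact: Cc_borel.
Qed.

(** [borel X * borel X] carries the product sigma-algebra; it contains the open sets of the product
    because each of them is a countable union of rectangles of base sets. *)
Lemma open_prod_borel (O : set (X * X)) : open O ->
  measurable (O : set (borel X * borel X)).
Proof.
move=> oO; have [U [oU bU]] := second_countable_seq X_second_countable.
have -> : O = \bigcup_n \bigcup_k (if `[< U n `*` U k `<=` O >] then U n `*` U k else set0).
  apply/seteqP; split=> [[x y] Oxy|z [n _ [k _]]]; last first.
    by case: ifPn => // /asboolP; apply.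
  have [[V W] [/= xV yW] VWO] : nbhs (x, y) O by exact: open_nbhs_nbhs.
  have [n Ux UV] := bU x V° (@open_interior _ _) (nbhs_singleton (nbhs_interior xV)).
  have [k Uy UW] := bU y W° (@open_interior _ _) (nbhs_singleton (nbhs_interior yW)).
  exists n => //; exists k => //; rewrite ifT//; apply/asboolP => -[a b] [/= Ua Ub].
  by apply: VWO; split; apply: interior_subset; [exact: UV|exact: UW].
apply: bigcupT_measurable => n; apply: bigcupT_measurable => k.
case: ifP => _; last exact: measurable0.
by apply: measurableX; exact: open_borel.
Qed.

Lemma continuous_prod_borel (f : X * X -> R) : continuous f ->
  measurable_fun setT (f : borel X * borel X -> R).
Proof.
move=> cf; apply: measurable_fun_open_gt => r; apply: open_prod_borel.
apply: (@open_comp _ _ f [set z | r < z]); last exact: open_gt.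
by move=> z _; exact: cf.
Qed.

Lemma hausdorff_prod : hausdorff_space (X * X)%type.
Proof.
move=> [x y] [x' y'] h; congr (_, _); apply: X_hausdorff => A B xA xB.
  have [||[a b] [[/= Aa _] [Ba _]]] := h (A `*` setT) (B `*` setT); last by exists a.
    by exists (A, setT) => //; split => //; exact: filterT.
  by exists (B, setT) => //; split => //; exact: filterT.
have [||[a b] [[/= _ Aa] [_ Ba]]] := h (setT `*` A) (setT `*` B); last by exists b.
  by exists (setT, A) => //; split => //; exact: filterT.
by exists (setT, B) => //; split => //; exact: filterT.
Qed.

Lemma Cc_prod_support (f : X * X -> R) : Cc f -> exists2 K : set X, compact K &
  forall x y, ~ (K x /\ K y) -> f (x, y) = 0.
Proof.
move=> /(CcP hausdorff_prod)[cf [K cK fK]].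
have c1 : compact (fst @` K).
  by apply: continuous_compact => //; apply: continuous_subspaceT => z; exact: cvg_fst.
have c2 : compact (snd @` K).
  by apply: continuous_compact => //; apply: continuous_subspaceT => z; exact: cvg_snd.
exists (fst @` K `|` snd @` K); first exact: compactU.
move=> x y h; apply: fK => Kxy; apply: h.
by split; [left|right]; exists (x, y).
Qed.

Lemma Cc_tensor (f g : X -> R) : Cc f -> Cc g -> Cc (fun z : X * X => f z.1 * g z.2).
Proof.
move=> /(CcP X_hausdorff)[cf [K cK fK]] /(CcP X_hausdorff)[cg [K' cK' gK']].
apply/(CcP hausdorff_prod); split.
  move=> z; apply: (@cvgM _ _ (nbhs z) _ (f \o fst) (g \o snd)).
    by apply: continuous_comp; [exact: cvg_fst|exact: cf].
  by apply: continuous_comp; [exact: cvg_snd|exact: cg].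
exists (K `*` K'); first exact: compact_setX.
by move=> [x y] /= /not_andP[/fK ->|/gK' ->]; rewrite ?mul0r ?mulr0.
Qed.

Lemma Cc_prod_integrable m1 m2 (f : X * X -> R) : is_radon m1 -> is_radon m2 ->
  Cc f -> forall (n1 n2 : {sigma_finite_measure set (borel X) -> \bar R}),
  m1 = n1 :> (set _ -> \bar R) -> m2 = n2 :> (set _ -> \bar R) ->
  (n1 \x n2)%E.-integrable setT (EFin \o f).
Proof.
move=> r1 r2 Cf n1 n2 e1 e2; have [cf _] := Cf.
have [K cK fK] := Cc_prod_support Cf.
have [C _ fC] := Cc_bounded hausdorff_prod Cf.
apply: (@bounded_support_integrable _ (borel X * borel X)%type R (n1 \x n2)%E (K `*` K) f C) => //.
- by apply: measurableX; exact: compact_borel.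
- have mK := compact_borel cK.
  have E := product_measure1E n1 n2 mK mK.
  apply: (@le_lt_trans _ _ (n1 K * n2 K)%E); first by rewrite -E.
  have k1 : (n1 K < +oo)%E by rewrite -e1 radon_compact.
  have k2 : (n2 K < +oo)%E by rewrite -e2 radon_compact.
  by apply: lte_mul_pinfty => //; rewrite ge0_fin_numE.
- exact: continuous_prod_borel.
- by move=> [x y]; exact: fK.
Qed.

End radon_measures.

Lemma continuous_sum (R : realType) (T : topologicalType) (I : eqType)
    (s : seq I) (F : I -> T -> R) :
  (forall i, i \in s -> continuous (F i)) -> continuous (fun x => \sum_(i <- s) F i x).
Proof.
elim: s => [_|i s IH cF].
  by under eq_fun do rewrite big_nil; exact: cst_continuous.
under eq_fun do rewrite big_cons.
move=> x; apply: (@cvgD _ _ _ (nbhs x) _ (F i)); first exact: cF (mem_head _ _) _.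
by apply: IH => j js; apply: cF; rewrite in_cons js orbT.
Qed.

(** * Uniform approximation by sums of tensors *)

Section tensor_approximation.
Context (R : realType) (X : ptopologicalType).
Hypothesis X_locally_compact : locally_compact [set: X].
Hypothesis X_hausdorff : hausdorff_space X.

(** The tube lemma: continuity at each [(x, y)] gives a neighbourhood of [x] that depends on [y],
    and compactness of [K] makes it uniform in [y]. *)
Lemma slice_uniform (f : X * X -> R) (K : set X) (x : X) (e : R) :
  continuous f -> compact K -> (forall x y, ~ K y -> f (x, y) = 0) -> 0 < e ->
  exists W, [/\ open W, W x & forall x' y, W x' -> `|f (x', y) - f (x, y)| <= e].
Proof.
move=> cf cK fK e0.
have h : \forall x' \near x, forall y, K y -> `|f (x', y) - f (x, y)| <= e.
  have /compact_near_coveringP cov := cK.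
  apply: (cov X (nbhs x) (fun x' y => `|f (x', y) - f (x, y)| <= e)) => y Ky.
  have /cvgrPdist_le/(_ (e / 2)) := cf (x, y); rewrite divr_gt0// => /(_ isT).
  move=> [[V V'] [/= xV yV'] VV']; exists (V', V) => //= -[y' x'] [/= Vy' Vx'].
  have h1 := VV' (x', y') (conj Vx' Vy').
  have h2 := VV' (x, y') (conj (nbhs_singleton xV) Vy').
  rewrite (_ : _ - _ = (f (x, y) - f (x, y')) - (f (x, y) - f (x', y'))); last by ring.
  by rewrite (le_trans (ler_normB _ _))// [e]splitr lerD.
pose W := [set x' | forall y, K y -> `|f (x', y) - f (x, y)| <= e].
exists W°; split; [exact: open_interior|exact: h|].
move=> x' y /interior_subset Wx'; have [Ky|nKy] := pselect (K y); first exact: Wx'.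
by rewrite !fK// subrr normr0 ltW.
Qed.

(** A partition of unity in the first variable, with [f] frozen at its centres. The set [K] precedes
    [e]: all approximants live on one compact set, so a uniform error on it bounds the error of the
    double integral. *)
Lemma Cc_tensor_approx (f : X * X -> R) : Cc f -> exists2 K : set X, compact K &
  forall e, 0 < e -> exists s : seq ((X -> R) * (X -> R)),
  [/\ forall p, p \in s -> [/\ Cc p.1, Cc p.2 & forall x, ~ K x -> p.1 x = 0 /\ p.2 x = 0],
      forall x y, ~ (K x /\ K y) -> f (x, y) = 0 &
      forall x y, `|\sum_(p <- s) p.1 x * p.2 y - f (x, y)| <= e].
Proof.
move=> Cf; have [cf _] := Cf.
have [K0 cK0 fK0] := Cc_prod_support X_hausdorff Cf.
have [chi [Cchi chi01 chi1 _]] := bump_compact R X_locally_compact X_hausdorff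
  cK0 openT (@subsetT _ _).
have [cchi [K1 cK1 chiK1]] := (CcP X_hausdorff _).1 Cchi.
exists (K0 `|` K1); first exact: compactU.
move=> e e0.
have /choice[W WP] x := slice_uniform x cf cK0
  (fun x y nKy => fK0 x y (fun h => nKy h.2)) e0.
have och : open [set y | 2^-1 < chi y].
  apply: (@open_comp _ _ chi [set z | 2^-1 < z]); last exact: open_gt.
  by move=> z _; exact: cchi.
have h12 : (2^-1 : R) < 1 by rewrite invf_lt1 ?ltr1n.
have /choice[psi psiP] (x : X) : exists psi : X -> R, K0 x ->
    [/\ Cc psi, forall y, 0 <= psi y <= 1, psi x = 1,
        forall y, ~ W x y -> psi y = 0 & forall y, ~ K1 y -> psi y = 0].
  have [K0x|nK0x] := pselect (K0 x); last by exists (fun=> 0).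
  have [oW Wx _] := WP x.
  have [|psi [? ? ? psi0]] := bump_point R X_locally_compact X_hausdorff
      (openI oW och) (x := x).
    by split => //=; rewrite chi1.
  exists psi => _; split => // y nKy; apply: psi0 => -[_]//=.
  by rewrite chiK1// ltNge invr_ge0 ler0n.
have [||s sK0 scov] := @compact_cover_seq _ _ K0 K0
    (fun x => [set y | 2^-1 < psi x y]) cK0.
- move=> x K0x; have [[pc _] _ _ _ _] := psiP x K0x.
  apply: (@open_comp _ _ (psi x) [set z | 2^-1 < z]); last exact: open_gt.
  by move=> z _; exact: pc.
- by move=> x K0x; exists x => //=; have [_ _ -> _ _] := psiP x K0x.
pose S y := \sum_(x <- s) psi x y.
have psi0 x y : x \in s -> 0 <= psi x y.
  by move=> /sK0 /psiP[_ /(_ y)/andP[]].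
have S0 y : 0 <= S y by rewrite /S big_seq sumr_ge0// => x xs; exact: psi0.
have SK y : K0 y -> 2^-1 < S y.
  move=> /scov[x xs pxy]; apply: lt_le_trans pxy _; rewrite /S.
  rewrite (big_rem x)//= lerDl big_seq sumr_ge0// => z /mem_rem zs.
  exact: psi0.
have cS : continuous S.
  by have [] : Cc S by apply: Cc_sum => // x xs; have [] := psiP x (sK0 x xs).
(* A denominator that is continuous and positive everywhere and coincides with [S] on [K0], where
   the normalized functions therefore sum to 1. Off [K0] the values of [f] vanish. *)
pose d y := Num.max (S y) 2^-1.
have d0 y : 0 < d y by rewrite lt_max invr_gt0 ltr0n orbT.
have cd : continuous d.
  by move=> y; apply: (@continuous_max _ _ S (fun=> 2^-1)); [exact: cS|exact: cvg_cst].
pose phi x y := (d y)^-1 * psi x y.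
exists [seq (phi x, fun y => f (x, y)) | x <- s]; split.
- move=> _ /mapP[x xs ->] /=; have [Cpsi _ _ _ psiK1] := psiP x (sK0 x xs); split.
  + apply: CcM => // y; apply: cvgV; first by rewrite gt_eqF.
    exact: cd.
  + apply/(CcP X_hausdorff); split.
      move=> y; apply: (@continuous_comp _ _ _ (fun y => (x, y)) f) => //.
        by apply: cvg_pair; [exact: cvg_cst|exact: cvg_id].
      exact: cf.
    by exists K0 => // y nK; apply: fK0 => -[].
  + move=> y /not_orP[nK0 nK1]; rewrite /phi psiK1// mulr0; split=> //.
    by apply: fK0 => -[].
- by move=> x y h; apply: fK0 => -[? ?]; apply: h; split; left.
move=> x y; rewrite big_map /=.
have -> : \sum_(a <- s) phi a x * f (a, y) - f (x, y) =
  \sum_(a <- s) phi a x * (f (a, y) - f (x, y)) + (S x / d x - 1) * f (x, y).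
  under [in RHS]eq_bigr do rewrite mulrBr.
  rewrite sumrB -mulr_suml /phi -mulr_sumr -/(S x); ring.
have -> : (S x / d x - 1) * f (x, y) = 0.
  have [K0x|nK0x] := pselect (K0 x); last by rewrite fK0 ?mulr0// => -[].
  by rewrite /d max_l ?ltW ?SK// divff ?subrr ?mul0r// gt_eqF// (lt_trans _ (SK x K0x)) ?invr_gt0.
rewrite addr0; apply: (le_trans (ler_norm_sum _ _ _)).
apply: (@le_trans _ _ (\sum_(a <- s) phi a x * e)).
  rewrite big_seq [leRHS]big_seq; apply: ler_sum => a as_.
  have p0 : 0 <= phi a x by rewrite mulr_ge0 ?psi0// invr_ge0 ltW.
  rewrite normrM (ger0_norm p0).
  have [Wx|nWx] := pselect (W a x).
    rewrite ler_wpM2l// distrC; have [_ _] := WP a; exact.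
  have [_ _ _ h _] := psiP a (sK0 a as_).
  by rewrite /phi h// mulr0 !mul0r.
rewrite -mulr_suml /phi -mulr_sumr -/(S x) ler_piMl//; first exact: ltW.
by rewrite mulrC ler_pdivrMr// mul1r le_max lexx.
Qed.

End tensor_approximation.

(** * The vague topology and quadratic functionals *)

Section vague.
Context (R : realType) (X : ptopologicalType).

Let initial_at f := Topological.class (initial_topology (int1 (R := R) (X := X) f)).

Lemma int1_continuous (f : X -> R) : Cc f -> continuous (int1 f : signed_radon X R -> R).
Proof.
move=> Cf eta.
have h : nbhs eta --> (eta : vague_topology X R) by exact: cvg_id.
have := (cvg_sup (fun f : {f : X -> R | Cc f} => initial_at (sval f)) eta _).1 h.
move=> /(_ _ (exist _ f Cf)) h'.
apply: cvg_trans (@initial_continuous _ _ (int1 f) eta).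
by move=> A /= /h'.
Qed.

Lemma vague_cvg (F : set_system (signed_radon X R)) (eta : signed_radon X R) :
  Filter F -> (forall f, Cc f -> int1 f x @[x --> F] --> int1 f eta) -> F --> eta.
Proof.
move=> FF h.
have := (cvg_sup (fun f : {f : X -> R | Cc f} => initial_at (sval f)) eta FF).2.
apply => -[f Cf] A /= [_ [[B oB <-] Bf BA]].
have := h f Cf B (open_nbhs_nbhs (conj oB Bf)).
by rewrite /nbhs/=; apply: filterS => x /= /BA.
Qed.

End vague.

Lemma bounded_support_integral_le d (T : measurableType d) (R : realType)
    (m : {measure set T -> \bar R}) (K : set T) (f : T -> R) (C : R) :
  measurable K -> (m K < +oo)%E -> m.-integrable setT (EFin \o f) -> 0 <= C ->
  (forall x, `|f x| <= C) -> (forall x, ~ K x -> f x = 0) ->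
  `|\int[m]_x f x| <= C * fine (m K).
Proof.
move=> mK Koo If C0 fC fK.
have E0 : (\int[m]_z (f z)%:E = \int[m]_(z in K) (f z)%:E)%E.
  rewrite [RHS]integral_mkcond; apply: eq_integral => x _; rewrite patchE.
  by case: ifPn => //; rewrite notin_setE => h; rewrite fK.
have K_fin : m K \is a fin_num by rewrite ge0_fin_numE.
have f_fin : (\int[m]_z (f z)%:E)%E \is a fin_num.
  exact: (integrable_fin_num measurableT If).
rewrite /Rintegral -lee_fin -abse_EFin fineK// [X in (abse X <= _)%E]E0.
have mf : measurable_fun K (EFin \o f).
  by apply: measurable_funTS; exact: measurable_int If.
apply: (le_trans (le_abse_integral _ mK mf)).
apply: (@le_trans _ _ (C%:E * m K)%E).
  by apply: integral_le_bound => //; apply: aeW => z _; rewrite lee_fin.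
by rewrite EFinM fineK.
Qed.

Section quadratic_functionals.
Context (R : realType) (X : ptopologicalType).
Hypothesis X_locally_compact : locally_compact [set: X].
Hypothesis X_hausdorff : hausdorff_space X.
Hypothesis X_second_countable : @second_countable X.
Implicit Types m : {measure set (borel X) -> \bar R}.

Let radon_pack m : is_radon m ->
  exists n : {sigma_finite_measure set (borel X) -> \bar R}, m = n :> (set _ -> \bar R).
Proof. by move=> rm; apply: sigma_finite_pack; exact: radon_sigma_finite. Qed.

Let prod_int m1 m2 (f : X * X -> R) : R := fine (\int[m1 \x m2]_z (f z)%:E)%E.

Let prod_intZD m1 m2 a f g : is_radon m1 -> is_radon m2 -> Cc f -> Cc g ->
  prod_int m1 m2 (fun z => a * f z + g z) = a * prod_int m1 m2 f + prod_int m1 m2 g.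
Proof.
move=> r1 r2 Cf Cg; have [n1 e1] := radon_pack r1; have [n2 e2] := radon_pack r2.
rewrite /prod_int e1 e2.
have If := Cc_prod_integrable X_hausdorff X_second_countable r1 r2 Cf e1 e2.
have Ig := Cc_prod_integrable X_hausdorff X_second_countable r1 r2 Cg e1 e2.
have Iaf : (n1 \x n2)%E.-integrable setT (EFin \o (fun z => a * f z)).
  exact: (integrableZl measurableT a If).
have := RintegralD measurableT Iaf Ig; rewrite /Rintegral => ->.
congr (_ + _); have := RintegralZl a measurableT If; by rewrite /Rintegral.
Qed.

Let prod_int_tensor m1 m2 f g : is_radon m1 -> is_radon m2 -> Cc f -> Cc g ->
  prod_int m1 m2 (fun z => f z.1 * g z.2) = (\int[m1]_x f x) * (\int[m2]_x g x).
Proof.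
move=> r1 r2 Cf Cg; have [n1 e1] := radon_pack r1; have [n2 e2] := radon_pack r2.
have I1 := Cc_integrable X_hausdorff r1 Cf.
have I2 := Cc_integrable X_hausdorff r2 Cg.
rewrite /prod_int.
have Ifg := Cc_prod_integrable X_hausdorff X_second_countable r1 r2
  (Cc_tensor X_hausdorff Cf Cg) e1 e2.
rewrite e1 e2 -(integral12_prod_meas1 Ifg) /fubini_F /=.
rewrite (eq_integral (fun x : borel X => (\int[m2]_y (g y)%:E) * (f x)%:E)%E); last first.
  by move=> x _; rewrite muleC -integralZl//= e2.
rewrite -[X in fine (integral X _ _)]e1.
have g_fin : (\int[m2]_y (g y)%:E)%E \is a fin_num by exact: (integrable_fin_num measurableT I2).
rewrite -(fineK g_fin) integralZl// fineM//; first by rewrite mulrC.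
exact: (integrable_fin_num measurableT I1).
Qed.

Let prod_int_bound m1 m2 (K : set X) f e : is_radon m1 -> is_radon m2 -> Cc f ->
  compact K -> (forall x y, ~ (K x /\ K y) -> f (x, y) = 0) ->
  (forall z, `|f z| <= e) ->
  `|prod_int m1 m2 f| <= e * (fine (m1 K) * fine (m2 K)).
Proof.
move=> r1 r2 Cf cK fK fe; have [n1 e1] := radon_pack r1; have [n2 e2] := radon_pack r2.
have If := Cc_prod_integrable X_hausdorff X_second_countable r1 r2 Cf e1 e2.
have mK := compact_borel X_hausdorff cK.
have mKK : measurable (K `*` K : set (borel X * borel X)) by exact: measurableX.
have E : ((n1 \x n2) (K `*` K) = m1 K * m2 K)%E.
  by rewrite e1 e2; exact: (product_measure1E n1 n2 mK mK).
have k1 : m1 K \is a fin_num by rewrite ge0_fin_numE// radon_compact.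
have k2 : m2 K \is a fin_num by rewrite ge0_fin_numE// radon_compact.
have e0 : 0 <= e by apply: le_trans (fe point).
have koo : ((n1 \x n2) (K `*` K) < +oo)%E.
  by rewrite E -ge0_fin_numE ?mule_ge0// fin_numM.
have -> : fine (m1 K) * fine (m2 K) = fine ((n1 \x n2) (K `*` K))%E.
  by rewrite -[X in _ = X]/(fine ((n1 \x n2)%E (K `*` K))) E fineM.
rewrite /prod_int e1 e2.
apply: (bounded_support_integral_le mKK koo If e0 fe).
by move=> [x y]; exact: fK.
Qed.

Let int2E f (eta : signed_radon X R) : int2 f eta =
  (prod_int (pos eta) (pos eta) f + prod_int (neg eta) (neg eta) f) -
  (prod_int (pos eta) (neg eta) f + prod_int (neg eta) (pos eta) f).
Proof. by []. Qed.

Lemma int1ZD a f g (eta : signed_radon X R) : Cc f -> Cc g ->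
  int1 (fun x => a * f x + g x) eta = a * int1 f eta + int1 g eta.
Proof.
move=> Cf Cg; rewrite /int1.
have h m : is_radon m ->
    \int[m]_x (a * f x + g x) = a * \int[m]_x f x + \int[m]_x g x.
  move=> rm; rewrite RintegralD//; last exact: Cc_integrable.
    by rewrite RintegralZl//; exact: Cc_integrable.
  apply: Cc_integrable => //; exact: CcZ.
rewrite !h; [ring|exact: neg_radon|exact: pos_radon].
Qed.

Lemma int2ZD a f g (eta : signed_radon X R) : Cc f -> Cc g ->
  int2 (fun z => a * f z + g z) eta = a * int2 f eta + int2 g eta.
Proof.
move=> Cf Cg; have pr := pos_radon eta; have nr := neg_radon eta.
rewrite !int2E !prod_intZD//.
move: (prod_int (pos eta) (pos eta) f) (prod_int (pos eta) (neg eta) f)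
  (prod_int (neg eta) (pos eta) f) (prod_int (neg eta) (neg eta) f) => ? ? ? ?.
move: (prod_int (pos eta) (pos eta) g) (prod_int (pos eta) (neg eta) g)
  (prod_int (neg eta) (pos eta) g) (prod_int (neg eta) (neg eta) g) => ? ? ? ?.
ring.
Qed.

Lemma int2_tensor f g (eta : signed_radon X R) : Cc f -> Cc g ->
  int2 (fun z => f z.1 * g z.2) eta = int1 f eta * int1 g eta.
Proof.
move=> Cf Cg; have pr := pos_radon eta; have nr := neg_radon eta.
rewrite !int2E !prod_int_tensor// /int1.
by move: (\int[pos eta]_x f x) (\int[neg eta]_x f x)
  (\int[pos eta]_x g x) (\int[neg eta]_x g x) => *; ring.
Qed.

(** With [p] and [n] the masses of [K] under the two parts of [eta], the four products add up to
    [(p + n) ^+ 2]. The constant depends on [eta] but not on [f]. *)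
Lemma int2_bound (eta : signed_radon X R) (K : set X) : compact K ->
  exists2 C, 0 <= C & forall f e, Cc f ->
  (forall x y, ~ (K x /\ K y) -> f (x, y) = 0) -> (forall z, `|f z| <= e) ->
  `|int2 f eta| <= e * C.
Proof.
move=> cK; pose p := fine (pos eta K); pose n := fine (neg eta K).
exists ((p + n) ^+ 2); first by rewrite sqr_ge0.
move=> f e Cf fK fe; rewrite int2E.
have pr := pos_radon eta; have nr := neg_radon eta.
have := prod_int_bound pr pr Cf cK fK fe; have := prod_int_bound nr nr Cf cK fK fe.
have := prod_int_bound pr nr Cf cK fK fe; have := prod_int_bound nr pr Cf cK fK fe.
rewrite -/p -/n; move: (prod_int (pos eta) (pos eta) f) (prod_int (pos eta) (neg eta) f)
  (prod_int (neg eta) (pos eta) f) (prod_int (neg eta) (neg eta) f) => ? ? ? ?.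
rewrite !ler_norml => /andP[? ?] /andP[? ?] /andP[? ?] /andP[? ?].
by apply/andP; split; lra.
Qed.

Lemma int2_sum (eta : signed_radon X R) (s : seq ((X -> R) * (X -> R))) :
  (forall p, p \in s -> Cc p.1 /\ Cc p.2) ->
  Cc (fun z => \sum_(p <- s) p.1 z.1 * p.2 z.2) /\
  int2 (fun z => \sum_(p <- s) p.1 z.1 * p.2 z.2) eta =
  \sum_(p <- s) int1 p.1 eta * int1 p.2 eta.
Proof.
elim: s => [_|p s IH Cs].
  have C0 : Cc (fun _ : X * X => 0 : R) by apply: Cc0; exact: hausdorff_prod.
  have E : (fun z : X * X => \sum_(p <- [::] : seq ((X -> R) * (X -> R))) p.1 z.1 * p.2 z.2) = (fun _ => 0).
    by apply/funext => z; rewrite big_nil.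
  rewrite E big_nil; split=> //.
  have := int2ZD 1 eta C0 C0; rewrite !mul1r addr0.
  by move: (int2 _ _) => x; lra.
have [Cp1 Cp2] := Cs p (mem_head _ _).
have [|IH1 IH2] := IH; first by move=> q qs; apply: Cs; rewrite in_cons qs orbT.
have E : (fun z : X * X => \sum_(p <- p :: s) p.1 z.1 * p.2 z.2) =
    (fun z => 1 * (p.1 z.1 * p.2 z.2) + \sum_(p <- s) p.1 z.1 * p.2 z.2).
  by apply/funext => z; rewrite big_cons mul1r.
have Cp : Cc (fun z => p.1 z.1 * p.2 z.2) by apply: Cc_tensor.
rewrite E; split; first by apply: CcZD => //; exact: hausdorff_prod.
by rewrite int2ZD// IH2 mul1r big_cons int2_tensor.
Qed.

(** For a sum of tensors the double integral is a sum of products of vaguely continuous functionals.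
    Since the constant of [int2_bound] varies with [eta], the approximation is only pointwise in
    [eta], which is enough for measurability. *)
Lemma int2_measurable f : Cc f ->
  measurable_fun setT (int2 f : borel (signed_radon X R) -> R).
Proof.
move=> Cf; have [K cK /(_ _ (harmonic_gt0 _))/=] :=
  @Cc_tensor_approx R X X_locally_compact X_hausdorff f Cf.
move=> h; have /choice[s sP] := h; clear h.
pose F n (eta : signed_radon X R) := \sum_(p <- s n) int1 p.1 eta * int1 p.2 eta.
apply: (@measurable_fun_cvg _ (borel (signed_radon X R)) R setT F (int2 f)) => [n|eta _].
  apply: continuous_borel; have [sC _ _] := sP n.
  apply: (@continuous_sum _ _ _ _ (fun p eta => int1 p.1 eta * int1 p.2 eta)).
  by move=> p ps eta; have [? ? _] := sC p ps;
    apply: (@cvgM _ _ (nbhs eta) _ (int1 p.1) (int1 p.2)); apply: int1_continuous.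
have [C C0 CP] := int2_bound eta cK.
have [_ fK _] := sP 0%N.
have le n : `|F n eta - int2 f eta| <= harmonic n * C.
  have [sC _ sf] := sP n.
  rewrite /F; have [|Cs <-] := @int2_sum eta (s n); first by move=> p /sC[].
  rewrite addrC -mulN1r -int2ZD//; apply: CP.
  - by apply: CcZD => //; exact: hausdorff_prod.
  - move=> x y nK; rewrite fK// mulr0 add0r /= big_seq big1// => p /sC[_ _ pK].
    have [/pK[-> _]|nKx] := pselect (~ K x); first by rewrite mul0r.
    have [/pK[_ ->]|nKy] := pselect (~ K y); first by rewrite mulr0.
    by exfalso; apply: nK; split; exact: contrapT.
  - by move=> [x y]; rewrite mulN1r addrC; exact: sf.
apply/cvgrPdist_le => e e0.
have /cvgrPdist_le/(_ e e0) : harmonic n * C @[n --> \oo] --> 0 * C.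
  by apply: cvgM; [exact: cvg_harmonic|exact: cvg_cst].
apply: filterS => n; rewrite mul0r sub0r normrN distrC ger0_norm; last first.
  by rewrite mulr_ge0// ltW// harmonic_gt0.
exact: le_trans (le n).
Qed.

Lemma quadraticZD a f0 g0 f1 g1 f2 g2 : Cc f1 -> Cc g1 -> Cc f2 -> Cc g2 ->
  (fun eta : signed_radon X R => a * quadratic f0 f1 f2 eta + quadratic g0 g1 g2 eta) =
  quadratic (a * f0 + g0) (fun x => a * f1 x + g1 x) (fun z => a * f2 z + g2 z).
Proof.
move=> Cf1 Cg1 Cf2 Cg2; apply/funext => eta; rewrite /quadratic.
by rewrite int1ZD// int2ZD//; ring.
Qed.

Lemma quadratic_measurable f0 f1 f2 : Cc f1 -> Cc f2 ->
  measurable_fun setT (quadratic f0 f1 f2 : borel (signed_radon X R) -> R).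
Proof.
move=> Cf1 Cf2; apply: measurable_funD; last exact: int2_measurable.
apply: measurable_funD; first exact: measurable_cst.
by apply: continuous_borel; exact: int1_continuous.
Qed.

End quadratic_functionals.

(** A bounded set of naturals attains its maximum, an unbounded one has supremum +oo. Through inner
    regularity this carries integrality from compact sets to all Borel sets. *)
Lemma ereal_sup_nat (R : realType) (S : set (\bar R)) : S !=set0 ->
  (forall s, S s -> (exists k : nat, s = k%:R%:E) \/ s = +oo%E) ->
  (exists k : nat, ereal_sup S = k%:R%:E) \/ ereal_sup S = +oo%E.
Proof.
move=> [s0 Ss0] Sn.
have [[m hm]|h] := pselect (exists m : nat, forall s, S s -> (s <= m%:R%:E)%E).
  left; pose P (k : nat) := `[< S (k%:R%:E) >].
  have exP : exists k, P k.
    have [[k e]|e] := Sn s0 Ss0; first by exists k; apply/asboolP; rewrite -e.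
    by have := hm _ Ss0; rewrite e leye_eq.
  have bP k : P k -> (k <= m)%N by move=> /asboolP /hm; rewrite lee_fin ler_nat.
  exists (ex_maxn exP bP); case: ex_maxnP => k /asboolP Sk kmax.
  apply/eqP; rewrite eq_le; apply/andP; split; last exact: ereal_sup_ubound.
  apply: ge_ereal_sup => s Ss; have [[l e]|e] := Sn s Ss.
    by rewrite e lee_fin ler_nat; apply: kmax; apply/asboolP; rewrite -e.
  by have := hm _ Ss; rewrite e leye_eq.
right; apply/eqP; rewrite -leye_eq leNgt; apply/negP => lt_oo; apply: h.
have s0sup : (s0 <= ereal_sup S)%E by exact: ereal_sup_ubound.
have s00 : (0 <= s0)%E.
  by have [[k ->]|->] := Sn s0 Ss0; rewrite ?leey// lee_fin ler0n.
have supfin : ereal_sup S \is a fin_num.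
  by rewrite ge0_fin_numE// (le_trans s00).
have [m _ hm] : \forall m \near \oo, fine (ereal_sup S) < m%:R.
  exact: (nbhs_infty_gtr (fine (ereal_sup S))).
exists m => s Ss; apply: (@le_trans _ _ (ereal_sup S)); first exact: ereal_sup_ubound.
by rewrite -(fineK supfin) lee_fin ltW//; apply: hm => /=.
Qed.

(** Lets the double product enter Tonelli as one factor of the triple product. *)
Lemma prod_sigma_finite d (T : measurableType d) (R : realType)
    (n1 n2 : {sigma_finite_measure set T -> \bar R}) : sigma_finite setT (n1 \x n2)%E.
Proof.
have /sigma_finiteP[F [TF ndF mF]] := sigma_finiteT n1.
have /sigma_finiteP[G [TG ndG mG]] := sigma_finiteT n2.
exists (fun i => F i `*` G i).
  apply/seteqP; split=> // -[x y] _.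
  have [i _ Fix_] : (\bigcup_i F i) x by rewrite -TF.
  have [j _ Gjy] : (\bigcup_i G i) y by rewrite -TG.
  exists (maxn i j) => //; split => /=.
    by move: Fix_; apply/subsetPset/ndF; rewrite leq_maxl.
  by move: Gjy; apply/subsetPset/ndG; rewrite leq_maxr.
move=> i; have [mFi Fi] := mF i; have [mGi Gi] := mG i; split.
  exact: measurableX.
rewrite product_measure1E//; apply: lte_mul_pinfty => //.
by rewrite ge0_fin_numE.
Qed.

Lemma tensor3_integral d (T : measurableType d) (R : realType)
    (n : {sigma_finite_measure set T -> \bar R}) (g : T -> R) :
  measurable_fun setT g -> (forall y, 0 <= g y) ->
  (\int[(n \x n) \x n]_z (g z.1.1 * g z.1.2 * g z.2)%:E =
   (\int[n]_y (g y)%:E) * (\int[n]_y (g y)%:E) * (\int[n]_y (g y)%:E))%E.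
Proof.
move=> mg g0; set I := (\int[n]_y (g y)%:E)%E.
have I0 : (0 <= I)%E by apply: integral_ge0 => y _; rewrite lee_fin.
have mgE : measurable_fun setT (EFin \o g) by exact/measurable_EFinP.
have m2 : measurable_fun setT (fun u : T * T => (g u.1 * g u.2)%:E).
  apply/measurable_EFinP; apply: measurable_funM; exact: measurableT_comp.
have [n2 e2] := sigma_finite_pack (prod_sigma_finite n n).
have E2 : (\int[n \x n]_u (g u.1 * g u.2)%:E = I * I)%E.
  rewrite fubini_tonelli1//; last by move=> z; rewrite lee_fin mulr_ge0.
  rewrite -ge0_integralZl//; last by move=> y _; rewrite lee_fin.
  apply: eq_integral => y _; rewrite /fubini_F /= muleC.
  by rewrite -ge0_integralZl//; [move=> z _|]; rewrite lee_fin.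
rewrite e2 fubini_tonelli1//; last 2 first.
- apply/measurable_EFinP; apply: measurable_funM; last exact: measurableT_comp.
  have : measurable_fun setT (fun u : T * T => g u.1 * g u.2).
    by apply: measurable_funM; exact: measurableT_comp.
  move=> h; exact: (measurableT_comp h).
- by move=> z; rewrite lee_fin !mulr_ge0.
transitivity (\int[n2]_u (I * (g u.1 * g u.2)%:E))%E.
  apply: eq_integral => u _; rewrite /fubini_F /= muleC.
  by rewrite -ge0_integralZl//; [move=> z _|]; rewrite lee_fin ?mulr_ge0.
rewrite ge0_integralZl//; last by move=> y _; rewrite lee_fin mulr_ge0.
by rewrite -[X in (I * integral X _ _)%E]e2 E2 muleA.
Qed.

(** * Point configurations as sequences of slots *)

Section slot_measures.
Context d (T : measurableType d) (R : realType).
Implicit Types (o : option T) (x : nat -> option T).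

Definition odirac o : {measure set T -> \bar R} :=
  if o is Some y then \d_y else mzero.

Lemma odiracE o A : odirac o A = (oapp (\1_A : T -> R) 0 o)%:E.
Proof. by case: o. Qed.

(** Empty slots give finite and infinite configurations one format, and they receive the points that
    escape to infinity in a limit. Repeated entries account for multiplicity. *)
Definition slot_measure x : {measure set T -> \bar R} :=
  mseries (fun i => odirac (x i)) 0.

Lemma slot_measureE x A N :
  (forall i y, (N <= i)%N -> x i = Some y -> ~ A y) ->
  slot_measure x A = (\sum_(i < N) oapp (\1_A : T -> R) 0 (x i))%:E.
Proof.
move=> h; rewrite /slot_measure/= /mseries (@nneseries_split _ _ 0 N)// add0n.
rewrite [X in (_ + X)%E]eseries0 ?adde0; last first.
  move=> i Ni _; rewrite odiracE; case E: (x i) => [y|]//=.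
  by rewrite indicE memNset//; exact: h E.
by rewrite big_mkord -sumEFin; apply: eq_bigr => i _; exact: odiracE.
Qed.

Lemma slot_measure_ge x A N :
  ((\sum_(i < N) oapp (\1_A : T -> R) 0 (x i))%:E <= slot_measure x A)%E.
Proof.
rewrite -sumEFin -(big_mkord xpredT (fun i => (oapp (\1_A : T -> R) 0 (x i))%:E)).
under eq_bigr do rewrite -odiracE.
exact: nneseries_lim_ge.
Qed.

Lemma slot_measure_le x A (M : \bar R) :
  (forall N, (\sum_(i < N) oapp (\1_A : T -> R) 0 (x i))%:E <= M)%E ->
  (slot_measure x A <= M)%E.
Proof.
move=> h; apply: lime_le; first exact: is_cvg_nneseries.
apply: nearW => N; under eq_bigr do rewrite odiracE.
by rewrite big_mkord sumEFin.
Qed.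

Lemma slot_integral x (m : {measure set T -> \bar R}) (K : set T) N (f : T -> R) :
  (forall A, measurable A -> m A = slot_measure x A) -> measurable K ->
  (forall i y, (N <= i)%N -> x i = Some y -> ~ K y) ->
  measurable_fun setT f -> (forall y, 0 <= f y) -> (forall y, ~ K y -> f y = 0) ->
  (\int[m]_y (f y)%:E)%E = (\sum_(i < N) oapp f 0 (x i))%:E.
Proof.
move=> mE mK xK mf f0 fK.
have -> : (\int[m]_y (f y)%:E = \int[m]_(y in K) (f y)%:E)%E.
  rewrite [RHS]integral_mkcond; apply: eq_integral => y _; rewrite patchE.
  by case: ifPn => //; rewrite notin_setE => h; rewrite fK.
rewrite (@eq_measure_integral _ _ _ _ (msum (fun i => odirac (x i)) N)); last first.
  move=> A mA AK; rewrite mE// (slot_measureE (N := N)).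
    by rewrite /= /msum -sumEFin; apply: eq_bigr => i _; rewrite -odiracE.
  by move=> i y Ni /(xK _ _ Ni) nKy /AK.
have mfK : measurable_fun K (EFin \o f).
  by apply: measurable_funTS; exact/measurable_EFinP.
rewrite ge0_integral_measure_sum//; last by move=> y _; rewrite lee_fin.
rewrite -sumEFin; apply: eq_bigr => i _.
case: (x i) => [y|] /=; last by rewrite integral_measure_zero.
rewrite integral_dirac// diracE; case: (boolP (y \in K)) => [_|]; first by rewrite mul1e.
by rewrite notin_setE => /fK ->; rewrite mul0e.
Qed.

End slot_measures.

Section slot_configurations.
Context (R : realType) (X : ptopologicalType).
Hypothesis X_locally_compact : locally_compact [set: X].
Hypothesis X_hausdorff : hausdorff_space X.
Hypothesis X_second_countable : @second_countable X.
Implicit Types (x : nat -> option X) (eta : signed_radon X R).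

Definition locally_finite x := forall K : set X, compact K ->
  exists N, forall i y, (N <= i)%N -> x i = Some y -> ~ K y.

Definition slots_of eta x := forall B : set (borel X), measurable B ->
  pos eta B = slot_measure (T := borel X) R x B /\ neg eta B = 0%E.

(** For inner regularity, the points of [B] among the first [N] slots form a finite, hence compact,
    set that already carries the [N]-th partial sum. *)
Lemma slot_radon x : locally_finite x -> is_radon (slot_measure (T := borel X) R x).
Proof.
move=> lx; split=> [y|B mB].
  have [K yK cK] := locally_compact_nbhs X_locally_compact y.
  have [N KN] := lx K cK.
  exists K°; first by split; [exact: open_interior|exact: nbhs_singleton (nbhs_interior yK)].
  rewrite (@slot_measureE _ _ _ _ _ N) ?ltry// => i z Ni xz /interior_subset.
  exact: KN xz.
apply/eqP; rewrite eq_le; apply/andP; split; last first.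
  apply: ge_ereal_sup => _ [K [cK KB] <-]; apply: le_measure; rewrite ?inE//.
  exact: compact_borel.
apply: slot_measure_le => N.
pose K := [set y | B y /\ exists2 i, (i < N)%N & x i = Some y].
have cK : compact K.
  apply: finite_compact; apply: (@sub_finite_set _ _ ((fun i => odflt point (x i)) @` `I_N)).
    by move=> y [_ [i iN xi]]; exists i => //=; rewrite xi.
  by apply: finite_image; exact: finite_II.
apply: (@le_trans _ _ (slot_measure (T := borel X) R x K)); last first.
  by apply: ereal_sup_ubound; exists K => //; split=> // y [].
apply: le_trans (@slot_measure_ge _ (borel X) R x K N); rewrite lee_fin.
apply: ler_sum => i _; case E: (x i) => [y|]//=.
rewrite !indicE; case: (boolP (y \in B)) => // /set_mem By.
by rewrite mem_set//; split=> //; exists i.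
Qed.

Lemma slot_singular x : exists A : set (borel X), [/\ measurable A,
  slot_measure (T := borel X) R x A = 0%E & mzero (~` A) = 0%E :> \bar R].
Proof. by exists set0; split=> //; rewrite measure0. Qed.

Definition slot_config x (lx : locally_finite x) : signed_radon X R :=
  SignedRadon (slot_radon lx) (@mzero_radon X R) (slot_singular x).

Lemma slot_configP x (lx : locally_finite x) : slots_of (slot_config lx) x.
Proof. by []. Qed.

Lemma slots_point_configuration eta x : locally_finite x -> slots_of eta x ->
  point_configurations eta.
Proof.
move=> lx ex B mB; have [eB ->] := ex B mB; split=> //.
rewrite eB (slot_radon lx).2//; apply: ereal_sup_nat.
  by exists (slot_measure (T := borel X) R x set0); exists set0 => //; split => //; exact: compact0.
move=> _ [K [cK KB] <-]; left; have [N KN] := lx K cK.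
exists (\sum_(i < N) oapp (fun y => nat_of_bool (y \in K)) 0 (x i))%N.
rewrite (@slot_measureE _ _ _ _ _ N)//; congr EFin.
by rewrite natr_sum; apply: eq_bigr => i _; case: (x i).
Qed.

Lemma slots_int1 eta x (K : set X) N f : slots_of eta x -> Cc f -> compact K ->
  (forall i y, (N <= i)%N -> x i = Some y -> ~ K y) ->
  (forall y, ~ K y -> f y = 0) ->
  int1 f eta = \sum_(i < N) oapp f 0 (x i).
Proof.
move=> ex Cf cK xK fK; have mK := compact_borel X_hausdorff cK.
have [cf _] := Cf.
(* [slot_integral] is stated for nonnegative functions; [f] is then recovered from its positive and
   negative parts, which vanish off the same [K]. *)
have key (g : X -> R) : continuous g -> (forall y, 0 <= g y) -> (forall y, ~ K y -> g y = 0) ->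
    int1 g eta = \sum_(i < N) oapp g 0 (x i).
  move=> cg g0 gK; rewrite /int1 /Rintegral.
  rewrite (@slot_integral _ (borel X) R x (pos eta) K N g)//.
  - rewrite (@eq_measure_integral _ _ _ _ mzero); last by move=> A mA _; rewrite (ex _ mA).2.
    by rewrite integral_measure_zero/= subr0.
  - by move=> A mA; rewrite (ex _ mA).1.
  - exact: continuous_borel.
have cp : continuous (fun y => Num.max (f y) 0).
  by move=> y; apply: (@continuous_max _ _ f (fun=> 0)); [exact: cf|exact: cvg_cst].
have cn : continuous (fun y => Num.max (- f y) 0).
  move=> y; apply: (@continuous_max _ _ (fun y => - f y) (fun=> 0)).
    by apply: cvgN; exact: cf.
  exact: cvg_cst.
have pK y : ~ K y -> Num.max (f y) 0 = 0 by move=> /fK ->; rewrite max_l.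
have nK y : ~ K y -> Num.max (- f y) 0 = 0 by move=> /fK ->; rewrite oppr0 max_l.
have Cp : Cc (fun y => Num.max (f y) 0) by apply/(CcP X_hausdorff); split=> //; exists K.
have Cn : Cc (fun y => Num.max (- f y) 0) by apply/(CcP X_hausdorff); split=> //; exists K.
have fE y : f y = -1 * Num.max (- f y) 0 + Num.max (f y) 0.
  have [f0|f0] := leP 0 (f y); last by rewrite max_l ?oppr_ge0 ?ltW//; ring.
  by rewrite max_r ?oppr_le0//; ring.
rewrite (_ : f = (fun y => -1 * Num.max (- f y) 0 + Num.max (f y) 0)); last exact/funext.
rewrite int1ZD// !key// => [|y|y]; [|by rewrite le_max lexx orbT..].
rewrite mulN1r -sumrN -big_split; apply: eq_bigr => i _.
by case: (x i) => [y|]/=; rewrite ?oppr0 ?addr0 ?mulN1r.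
Qed.

(** True for tensors as a product of two sums, then for [f] by approximation, with errors [e * C]
    for the integral and [e * N^2] for the sum. [K] depends on [f] alone, so it serves a whole
    converging family of configurations. *)
Lemma slots_int2 (f : X * X -> R) : Cc f -> exists2 K : set X, compact K &
  forall eta x N, slots_of eta x ->
  (forall i y, (N <= i)%N -> x i = Some y -> ~ K y) ->
  int2 f eta = \sum_(i < N) \sum_(j < N)
    oapp (fun y => oapp (fun z => f (y, z)) 0 (x j)) 0 (x i).
Proof.
move=> Cf; have [K cK fapp] := Cc_tensor_approx X_locally_compact X_hausdorff Cf.
exists K => // eta x N ex xK; set S := RHS.
have [C C0 CP] := int2_bound X_locally_compact X_hausdorff X_second_countable eta cK.
suff le e : 0 < e -> `|int2 f eta - S| <= e * (C + N%:R * N%:R).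
  apply/eqP; rewrite -subr_eq0 -normr_le0; apply/ler_addgt0Pl => e e0; rewrite addr0.
  have D0 : 0 < C + N%:R * N%:R + 1.
    by rewrite ltr_pwDr// addr_ge0// mulr_ge0.
  apply: (le_trans (le _ (divr_gt0 e0 D0))).
  by rewrite mulrAC ler_pdivrMr// ler_wpM2l ?lerDl// ltW.
move=> e0; have [s [sC fK sf]] := fapp e e0.
have [|Cs Es] := int2_sum X_locally_compact X_hausdorff X_second_countable eta (s := s).
  by move=> p /sC[].
pose h z := \sum_(p <- s) p.1 z.1 * p.2 z.2.
have Sh : int2 h eta = \sum_(i < N) \sum_(j < N)
    oapp (fun y => oapp (fun z => h (y, z)) 0 (x j)) 0 (x i).
  rewrite Es.
  transitivity (\sum_(p <- s) \sum_(i < N) \sum_(j < N) oapp p.1 0 (x i) * oapp p.2 0 (x j)).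
    rewrite big_seq [RHS]big_seq; apply: eq_bigr => p /sC[Cp1 Cp2 pK].
    rewrite (slots_int1 ex Cp1 cK xK) => [|y /pK[]//].
    rewrite (slots_int1 ex Cp2 cK xK) => [|y /pK[]//].
    by rewrite mulr_suml; apply: eq_bigr => i _; rewrite mulr_sumr.
  rewrite exchange_big/=; apply: eq_bigr => i _.
  rewrite exchange_big/=; apply: eq_bigr => j _.
  case: (x i) => [y|]/=; last by rewrite big1// => p _; rewrite mul0r.
  by case: (x j) => [z|]//=; rewrite big1// => p _; rewrite mulr0.
have h1 : `|int2 (fun z => -1 * f z + h z) eta| <= e * C.
  apply: CP.
  - by apply: CcZD => //; exact: hausdorff_prod.
  - move=> y z nK; rewrite fK// mulr0 add0r /h /= big_seq big1// => p /sC[_ _ pK].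
    have [/pK[-> _]|nKx] := pselect (~ K y); first by rewrite mul0r.
    have [/pK[_ ->]|nKy] := pselect (~ K z); first by rewrite mulr0.
    by exfalso; apply: nK; split; exact: contrapT.
  - by move=> [y z]; rewrite mulN1r addrC; exact: sf.
have h2 : `|int2 h eta - S| <= e * (N%:R * N%:R).
  rewrite Sh /S -sumrB; apply: (le_trans (ler_norm_sum _ _ _)).
  apply: (@le_trans _ _ (\sum_(i < N) (e * N%:R))); last first.
    by rewrite sumr_const card_ord -[leLHS]mulr_natr mulrA.
  apply: ler_sum => i _; rewrite -sumrB; apply: (le_trans (ler_norm_sum _ _ _)).
  apply: (@le_trans _ _ (\sum_(j < N) e)); last first.
    by rewrite sumr_const card_ord -[leLHS]mulr_natr.
  apply: ler_sum => j _; case: (x i) => [y|]/=; last by rewrite subrr normr0 ltW.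
  by case: (x j) => [z|]/=; [exact: sf|rewrite subrr normr0 ltW].
move: h1; rewrite int2ZD// => h1.
rewrite (_ : _ - S = (int2 h eta - S) - (-1 * int2 f eta + int2 h eta)); last first.
  by move: (int2 f eta) (int2 h eta) S {h2} => a b c; ring.
apply: (le_trans (ler_normB _ _)); apply: (le_trans (lerD h2 h1)).
by rewrite [leRHS]mulrDr addrC.
Qed.

Lemma int3_tensor3 eta (g : X -> R) : measurable_fun setT (g : borel X -> R) ->
  (forall y, 0 <= g y) ->
  (int3 (tensor3 g) eta = (\int[pos eta]_y (g y)%:E) * (\int[pos eta]_y (g y)%:E) *
    (\int[pos eta]_y (g y)%:E))%E.
Proof.
move=> mg g0.
have [n e] := sigma_finite_pack
  (radon_sigma_finite X_locally_compact X_hausdorff X_second_countable (pos_radon eta)).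
by rewrite /int3 e; exact: tensor3_integral.
Qed.

End slot_configurations.

(** * Integer-valued measures as sums of Dirac masses *)

Section integer_measures.
Context (R : realType) (X : ptopologicalType).
Hypothesis X_hausdorff : hausdorff_space X.
Hypothesis X_second_countable : @second_countable X.
Implicit Types (m : {measure set (borel X) -> \bar R}) (A B : set (borel X)).

Lemma point_borel (x : X) : measurable ([set x] : set (borel X)).
Proof. by apply: compact_borel => //; exact: compact_set1. Qed.

(* Some point of [A] has only neighbourhoods of nonzero mass in [A]; along a
   decreasing basis of them the integer masses are at least 1, so it is an atom. *)
Lemma integer_measure_atom m A : measurable A ->
  (forall B, measurable B -> B `<=` A -> exists k : nat, m B = k%:R%:E) ->
  m A != 0%E -> exists2 x : X, A x & m [set x] != 0%E.
Proof.
move=> mA intA mA0; have [U [oU bU]] := second_countable_seq X_second_countable.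
have mU n : measurable (U n : set (borel X)) by exact: open_borel.
have ge1 B : measurable B -> B `<=` A -> m B != 0%E -> (1 <= m B)%E.
  move=> mB BA; have [k ->] := intA B mB BA.
  by rewrite eqe pnatr_eq0 lee_fin ler1n lt0n.
pose Z n : set (borel X) := if m (U n `&` A) == 0%E then U n `&` A else set0.
have mZ n : measurable (Z n).
  by rewrite /Z; case: ifP => _; [exact: measurableI|exact: measurable0].
have Z0 : m (\bigcup_n Z n) = 0%E.
  apply/negligibleP; first exact: bigcupT_measurable.
  apply: negligible_bigcup => n; apply/negligibleP => //.
  by rewrite /Z; case: ifPn => [/eqP//|_]; exact: measure0.
have [x [Ax nZx]] : exists x, A x /\ forall n, ~ Z n x.
  apply: contrapT => h; move/negP: mA0; apply; rewrite -measure_le0 -Z0.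
  apply: le_measure; rewrite ?inE//; first exact: bigcupT_measurable.
  move=> x Ax; apply: contrapT => nZ; apply: h; exists x; split=> // n Znx.
  by apply: nZ; exists n.
exists x => //; have posU n : U n x -> (1 <= m (U n `&` A))%E.
  move=> Ux; apply: ge1; [exact: measurableI|by move=> y []|].
  apply/negP => m0; apply: (nZx n); by rewrite /Z m0.
(* Intersections of the base sets around [x]; a base set that misses [x] is skipped by intersecting
   with the whole space. Separation of points shrinks them to [{x}]. *)
pose O := fix O n : set X := if n is n'.+1 then
  O n' `&` (if `[< U n' x >] then U n' else setT) else setT.
have oO n : open (O n) /\ O n x.
  elim: n => [|n [oOn Onx]] /=; first by split=> //; exact: openT.
  case: ifPn => [/asboolP Ux|_]; split => //; first exact: openI.
  by apply: openI => //; exact: openT.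
have OU n : U n x -> O n.+1 `<=` U n by move=> Ux /= y [_]; rewrite ifT//; exact/asboolP.
have ndO : forall i j, (i <= j)%N -> O j `<=` O i.
  move=> i j; elim: j => [|j IH]; first by rewrite leqn0 => /eqP ->.
  by rewrite leq_eqVlt => /predU1P[->//|/IH h] y /= [/h].
pose W n : set (borel X) := A `&` O n.
have mW n : measurable (W n).
  by apply: measurableI => //; apply: open_borel; have [] := oO n.
have W1 n : (1 <= m (W n))%E.
  have [oOn Onx] := oO n; have [i Ux Ui] := bU x _ oOn Onx.
  apply: (le_trans (posU i Ux)); apply: le_measure; rewrite ?inE//.
    exact: measurableI.
  by move=> y [/Ui ? ?]; split.
have capW : \bigcap_n W n = [set x].
  apply/seteqP; split=> [y Wy|_ ->]; last by move=> n _; split=> //; have [] := oO n.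
  apply: contrapT => yx; have := @accessible_closed_set1 _ (hausdorff_accessible X_hausdorff) y.
  rewrite -openC => oy; have [n Ux Uy] := bU x (~` [set y]) oy (fun e => yx (esym e)).
  have [_] := Wy n.+1 I; by move=> /(OU _ Ux) /Uy; apply.
have mW0 : (m (W 0%N) < +oo)%E.
  by have [k ->] := intA _ (mW 0%N) (@subIsetl _ _ _); rewrite ltry.
have := nonincreasing_cvg_mu mW0 mW.
rewrite capW => /(_ (point_borel x)) cv.
have {cv} cv : m \o W @ \oo --> m [set x].
  by apply: cv => i j ij; apply/subsetPset => y [? /(ndO _ _ ij)].
apply/negP => /eqP mx0; rewrite mx0 in cv.
have : (1 <= 0 :> \bar R)%E by apply: cvge_ge cv; exact: nearW.
by rewrite leNgt lte01.
Qed.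

(** Strong induction on the mass: an atom [x] of integer mass [l > 0] is split off, entering the
    list [l] times, and the remainder has smaller mass. *)
Lemma finite_integer_measure m k A : measurable A ->
  (forall B, measurable B -> B `<=` A -> exists k : nat, m B = k%:R%:E) ->
  m A = k%:R%:E -> exists s : seq X, [/\ size s = k, forall y, y \in s -> A y &
    forall B, measurable B -> m (B `&` A) = (\sum_(y <- s) (\1_B : X -> R) y)%:E].
Proof.
elim/ltn_ind: k A => k IH A mA intA mAk.
have [k0|k0] := eqVneq k 0%N.
  exists [::]; split=> // B mB; rewrite big_nil; apply/eqP; rewrite -measure_le0.
  rewrite (_ : 0%E = m A); last by rewrite mAk k0.
  by apply: le_measure; rewrite ?inE//; exact: measurableI.
have [|x Ax mx] := integer_measure_atom mA intA.
  by rewrite mAk eqe pnatr_eq0.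
have mpx := point_borel x.
have [l ml] := intA [set x] mpx (fun y e => eq_ind_r A Ax e).
have mAx : measurable (A `\` [set x] : set (borel X)) by exact: measurableD.
have [k' mk'] := intA (A `\` [set x]) mAx (@subDsetl _ _ _).
have Esplit (B : set (borel X)) : measurable B ->
    m (B `&` A) = (m (B `&` [set x]) + m (B `&` (A `\` [set x])))%E.
  move=> mB; have -> : B `&` A = (B `&` [set x]) `|` (B `&` (A `\` [set x])).
    rewrite -setIUr setDUK// => y ->//.
  rewrite measureU//; [exact: measurableI|exact: measurableI|].
  by apply/seteqP; split=> // y [[_ ->] [_ [_ nx]]]; exact: nx.
have kE : (k = l + k')%N.
  have := Esplit setT measurableT; rewrite !setTI mAk ml mk' -EFinD.
  by move=> [] /eqP; rewrite -natrD eqr_nat => /eqP.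
have l0 : (0 < l)%N by move: mx; rewrite ml eqe pnatr_eq0 lt0n.
have [||s [sk sA sE]] := IH k' _ _ mAx _ mk'.
- by rewrite kE -{1}[k']add0n ltn_add2r.
- by move=> B mB BA; apply: intA => //; apply: subset_trans BA _; exact: subDsetl.
exists (nseq l x ++ s); split.
- by rewrite size_cat size_nseq sk kE.
- move=> y; rewrite mem_cat mem_nseq => /orP[/andP[_ /eqP ->]//|/sA[]//].
move=> B mB; rewrite Esplit// sE// big_cat/= EFinD; congr (_ + _)%E.
rewrite big_nseq iter_addr addr0 -mulr_natr indicE.
have [xB|xB] := boolP (x \in B).
  by rewrite setIC (setIidl _) ?ml ?mul1r//= => y ->; exact: set_mem.
rewrite mul0r (_ : B `&` [set x] = set0) ?measure0//.
by apply/seteqP; split=> // y [By e]; move: xB; rewrite notin_setE -e.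
Qed.

(** Each shell [C j.+1] minus [C j] has finite integer mass, so its points can be listed; the slots
    run through the shells in order. The bound [J + k] counts the [k] points of [C J] and one
    separator for each of its [J] shells. *)
Lemma point_configuration_slots (eta : signed_radon X R) (C : nat -> set X) :
  point_configurations eta -> (forall j, compact (C j)) -> C 0%N = set0 ->
  (forall j, C j `<=` C j.+1) -> (forall y, exists j, C j y) ->
  exists x : nat -> option X, slots_of eta x /\
  forall J k i y, pos eta (C J) = k%:R%:E -> (J + k <= i)%N ->
    x i = Some y -> ~ C J y.
Proof.
move=> eN cC C0 CS Ccov.
have mC j : measurable (C j : set (borel X)) by exact: compact_borel.
have CJ : forall i j, (i <= j)%N -> C i `<=` C j.
  move=> i j; elim: j => [|j IH]; first by rewrite leqn0 => /eqP ->.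
  by rewrite leq_eqVlt => /predU1P[->//|/IH h] y /h /CS.
pose A j : set (borel X) := C j.+1 `\` C j.
have mA j : measurable (A j) by exact: measurableD.
have intC B j : measurable B -> B `<=` C j -> exists k : nat, pos eta B = k%:R%:E.
  move=> mB BC; have [_ [//|eoo]] := eN B mB.
  have : (pos eta B <= pos eta (C j))%E by apply: le_measure; rewrite ?inE.
  rewrite eoo leye_eq => /eqP e.
  by have := radon_compact X_hausdorff (pos_radon eta) (cC j); rewrite e ltxx.
have /choice[s sP] j : exists s : seq X, (forall y, y \in s -> A j y) /\
    forall B : set (borel X), measurable B ->
      pos eta (B `&` A j) = (\sum_(y <- s) (\1_B : X -> R) y)%:E.
  have [k Ak] := intC (A j) j.+1 (mA j) (@subDsetl _ _ _).
  have [|s [_ sA sE]] := finite_integer_measure (mA j) _ Ak; last by exists s.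
  by move=> B mB BA; apply: (intC B j.+1) => // y /BA[].
(* The final [None] of each shell makes the prefix of [J] shells at least [J] long even if shells
   are empty, so entry [i] is always found in the prefix of [i.+1] shells. *)
have [pref [pref0 prefS]] : exists pref : nat -> seq (option X), pref 0%N = [::] /\
    forall J, pref J.+1 = pref J ++ rcons (map Some (s J)) None.
  by exists (fix pref J := if J is J'.+1 then
    pref J' ++ rcons (map Some (s J')) None else [::]).
have size_pref J : (J <= size (pref J))%N.
  elim: J => // J IH; rewrite prefS size_cat size_rcons addnS ltnS.
  by rewrite (leq_trans IH)// leq_addr.
have prefW J d : exists r, pref (J + d)%N = pref J ++ r /\
    forall y, Some y \in r -> ~ C J y.
  elim: d => [|d [r [IH rC]]]; first by exists [::]; rewrite addn0 cats0.
  exists (r ++ rcons (map Some (s (J + d)%N)) None); rewrite addnS prefS IH catA.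
  split=> // y; rewrite mem_cat mem_rcons in_cons/= => /orP[/rC//|].
  rewrite (mem_map Some_inj) => /(sP _).1[_ nC] CJy; apply: nC.
  by apply: CJ CJy; exact: leq_addr.
pose x i := nth None (pref i.+1) i.
have xE J i : (i < size (pref J))%N -> nth None (pref J) i = x i.
  move=> iJ; rewrite /x; have [le|lt] := leqP J i.+1.
    have [r [e _]] := prefW J (i.+1 - J)%N.
    by rewrite subnKC// in e; rewrite e nth_cat iJ.
  have [r [e _]] := prefW i.+1 (J - i.+1)%N.
  have sz : (i < size (pref i.+1))%N := size_pref i.+1.
  by rewrite subnKC ?(ltnW lt)// in e; rewrite e nth_cat sz.
have sumE B J : measurable (B : set (borel X)) ->
    (\sum_(i < size (pref J)) oapp (\1_B : X -> R) 0 (x i))%:E = pos eta (B `&` C J).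
  move=> mB; transitivity ((\sum_(o <- pref J) oapp (\1_B : X -> R) 0 o)%:E).
    rewrite (big_nth None) big_mkord; congr EFin; apply: eq_bigr => i _.
    by rewrite xE.
  elim: J => [|J IH]; first by rewrite pref0 big_nil C0 setI0 measure0.
  rewrite prefS big_cat/= EFinD IH big_rcons/= addr0 big_map/=.
  have -> : B `&` C J.+1 = (B `&` C J) `|` (B `&` A J).
    rewrite -setIUr; congr (_ `&` _); rewrite /A setDE setUIr setUCr setIT.
    by rewrite setUidr//; exact: CS.
  rewrite measureU//; [|exact: measurableI|exact: measurableI|].
    by rewrite -(sP J).2.
  by apply/seteqP; split=> // y [[_ Cy] [_ [_]]]; apply.
exists x; split=> [B mB|J k i y ek ki xi].
  have [-> _] := eN B mB; split=> //.
  apply/eqP; rewrite eq_le; apply/andP; split.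
    have cv : (fun J => pos eta (B `&` C J)) @ \oo --> pos eta (\bigcup_J (B `&` C J)).
      apply: nondecreasing_cvg_mu.
      - by move=> J; exact: measurableI.
      - by apply: bigcupT_measurable => J; exact: measurableI.
      - by move=> i j ij; apply/subsetPset => y [? ?]; split=> //; exact: CJ ij _ _.
    have -> : B = \bigcup_J (B `&` C J).
      apply/seteqP; split=> [y By|y [J _ []]//]; have [J Jy] := Ccov y.
      by exists J.
    apply: (cvge_le _ cv); apply: nearW => J; rewrite -sumE//.
    have -> : \bigcup_J (B `&` C J) = B.
      apply/seteqP; split=> [y [? _ []]//|y By]; have [j jy] := Ccov y.
      by exists j.
    exact: slot_measure_ge.
  apply: slot_measure_le => N.
  apply: (@le_trans _ _ (pos eta (B `&` C N))); last first.
    by apply: le_measure; rewrite ?inE//; exact: measurableI.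
  rewrite -sumE// lee_fin.
  rewrite -!(big_mkord xpredT (fun i => oapp (\1_B : X -> R) 0 (x i))).
  rewrite (@big_cat_nat _ _ _ N 0 (size (pref N)))//= lerDl.
  apply: sumr_ge0 => i _; case: (x i) => //= z; exact: indic_ge0.
have szJ : size (pref J) = (J + k)%N.
  have : ((size (pref J))%:R%:E = J%:R%:E + pos eta (C J))%E.
    elim: J {ek ki} => [|J IH]; first by rewrite pref0 C0 measure0 adde0.
    have AE : pos eta (A J) = (size (s J))%:R%:E.
      rewrite -[A J]setTI (sP J).2//; congr EFin.
      under eq_bigr do rewrite indicT.
      by rewrite big_const_seq count_predT iter_addr addr0.
    rewrite prefS size_cat size_rcons size_map addnS -addSn natrD EFinD -AE.
    rewrite -addn1 natrD EFinD IH.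
    have -> : C J.+1 = C J `|` A J.
      by rewrite /A setDE setUIr setUCr setIT setUidr//; exact: CS.
    have -> : pos eta (C J `|` A J) = (pos eta (C J) + pos eta (A J))%E.
      by rewrite measureU//; apply/seteqP; split=> // z [Cz [_]]; apply.
    have [c ->] := intC (C J) J (mC J) (fun _ => id).
    by rewrite AE -!EFinD -natr1; congr EFin; ring.
  by rewrite ek -EFinD -natrD => -[] /eqP; rewrite eqr_nat => /eqP.
have iJ : (J <= i)%N by rewrite (leq_trans _ ki)// leq_addr.
have [r [e rC]] := prefW J (i.+1 - J)%N; rewrite subnKC ?(leqW iJ)// in e.
move: xi; rewrite /x e nth_cat szJ ltnNge ki /= => xi.
apply: rC; rewrite -xi; apply: mem_nth.
have := size_pref i.+1; rewrite e size_cat szJ => h.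
by rewrite ltn_subLR.
Qed.

End integer_measures.

(** Distinct naturals are at distance at least 1. Approximants within 1/4 therefore agree, and one
    that also halves the distance to [v] forces this distance to be 0. *)
Lemma natr_limit (R : realType) (v : R) :
  (forall e, 0 < e -> exists k : nat, `|v - k%:R| <= e) -> exists k : nat, v = k%:R.
Proof.
move=> h; have q0 : 0 < 4^-1 :> R by rewrite invr_gt0.
have [k hk] := h _ q0; exists k; apply/eqP; rewrite -subr_eq0 -normr_le0 leNgt.
apply/negP => d0; have e0 : 0 < Num.min 4^-1 (`|v - k%:R| / 2).
  by rewrite lt_min q0 divr_gt0.
have [l] := h _ e0; rewrite le_min => /andP[l4 ld].
have kl : `|(k%:R : R) - l%:R| <= 2^-1.
  rewrite (_ : _ - _ = (v - l%:R) - (v - k%:R)); last by ring.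
  by apply: (le_trans (ler_normB _ _)); lra.
have ekl : k = l.
  apply/eqP; apply: contrapT => /negP; rewrite neq_ltn => /orP[] lt.
    have : k.+1%:R <= l%:R :> R by rewrite ler_nat.
    by rewrite -natr1; move: kl; rewrite ler_norml => /andP[]; lra.
  have : l.+1%:R <= k%:R :> R by rewrite ler_nat.
  by rewrite -natr1; move: kl; rewrite ler_norml => /andP[]; lra.
by move: ld d0; rewrite -ekl; lra.
Qed.

(** * Vague closedness of the set of configurations *)

Section closedness.
Context (R : realType) (X : ptopologicalType).
Hypothesis X_locally_compact : locally_compact [set: X].
Hypothesis X_hausdorff : hausdorff_space X.
Hypothesis X_second_countable : @second_countable X.

(** Dominated convergence with the integrable bound [f 0%N]: the sequence decreases, since [f n] is
    1 wherever [f n.+1] does not vanish. *)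
Lemma compact_approx_integral (m : {measure set (borel X) -> \bar R}) (K : set X)
    (f : nat -> X -> R) : is_radon m -> compact K ->
  (forall n, Cc (f n)) -> (forall n x, 0 <= f n x <= 1) ->
  (forall n x, K x -> f n x = 1) ->
  (forall n x, f n.+1 x != 0 -> f n x = 1) ->
  (forall x, ~ K x -> exists N, forall n, (N <= n)%N -> f n x = 0) ->
  \int[m]_x f n x @[n --> \oo] --> fine (m K).
Proof.
move=> rm cK Cf f01 fK fS f0; have mK := compact_borel X_hausdorff cK.
have mKfin : m K \is a fin_num by rewrite ge0_fin_numE// radon_compact.
have fle n x : `|f n x| <= f 0%N x.
  have /andP[p0 _] := f01 n x; rewrite ger0_norm//.
  elim: n {p0} => // n IH; apply: le_trans IH.
  have [->|/fS ->] := eqVneq (f n.+1 x) 0; first by have /andP[] := f01 n x.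
  by have /andP[] := f01 n.+1 x.
have mf n : @measurable_fun _ _ (borel X) _ setT (EFin \o f n).
  by apply/measurable_EFinP; exact: Cc_borel.
have [|||||_ _ cv] := @dominated_convergence _ (borel X) R m setT measurableT
    (fun n => EFin \o f n) (EFin \o \1_K) (EFin \o f 0%N).
- by [].
- by apply/measurable_EFinP; exact: measurable_indic.
- apply: aeW => x _; apply: cvg_EFin; first exact: nearW.
  apply: cvg_near_cst.
  have [Kx|nKx] := pselect (K x).
    by apply: nearW => n /=; rewrite fK// indicE mem_set.
  have [N fN] := f0 x nKx; exists N => // n /= Nn.
  by rewrite fN// indicE memNset.
- exact: Cc_integrable.
- by apply: aeW => x n _ /=; rewrite lee_fin.
move: cv; rewrite integral_indic// setIT => cv.
by rewrite /Rintegral; apply: fine_cvg; rewrite fineK.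
Qed.

(** Near a limit point, configurations agree with it up to any error on two test functions at a
    time. That suffices both for positivity and for integrality on compact sets, and inner
    regularity does the rest. *)
Lemma point_configurations_closed :
  closed (@point_configurations X R : set (signed_radon X R)).
Proof.
move=> eta cl.
have near_conf f g e : 0 < e -> Cc f -> Cc g -> exists xi, [/\ point_configurations xi,
    `|int1 f eta - int1 f xi| < e & `|int1 g eta - int1 g xi| < e].
  move=> e0 Cf Cg.
  have /cvgrPdist_lt/(_ e e0) nf := @int1_continuous R X f Cf eta.
  have /cvgrPdist_lt/(_ e e0) ng := @int1_continuous R X g Cg eta.
  have [xi [xiN [h1 h2]]] := cl _ (filterI nf ng).
  by exists xi.
have xi_int xi f : point_configurations xi -> int1 f xi = \int[pos xi]_x f x.
  move=> xiN; rewrite /int1 [X in _ - X](_ : _ = 0) ?subr0//.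
  rewrite /Rintegral (@eq_measure_integral _ _ _ _ mzero); last first.
    by move=> A mA _; rewrite (xiN A mA).1.
  by rewrite integral_measure_zero.
have int_ge0 f : Cc f -> (forall x, 0 <= f x) -> 0 <= int1 f eta.
  move=> Cf f0; rewrite leNgt; apply/negP => lt0.
  have e0 : 0 < - int1 f eta by rewrite oppr_gt0.
  have [xi [xiN h _]] := near_conf f f _ e0 Cf Cf.
  have : 0 <= int1 f xi by rewrite xi_int//; apply: Rintegral_ge0.
  by move: h; rewrite ltr_norml => /andP[? ?]; lra.
have pr := pos_radon eta; have nr := neg_radon eta.
have neg_le (K : set X) : compact K -> fine (neg eta K) <= fine (pos eta K).
  move=> cK.
  have [f [Cf f01 fK fS f0]] := compact_approx R X_locally_compact X_hausdorff X_second_countable cK.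
  have cp := compact_approx_integral pr cK Cf f01 fK fS f0.
  have cn := compact_approx_integral nr cK Cf f01 fK fS f0.
  apply: (ler_cvg_to cn cp); apply: nearW => n; rewrite -subr_ge0.
  by apply: int_ge0 => // x; have /andP[] := f01 n x.
have [A [mA pA nA]] := pos_neg_singular eta.
have finK (m : {measure set (borel X) -> \bar R}) (K : set X) : is_radon m -> compact K ->
    m K \is a fin_num by move=> rm cK; rewrite ge0_fin_numE// radon_compact.
(* On compact subsets of [A] the negative part is dominated by the positive one, which vanishes on
   [A]; off [A] the negative part is null by singularity. So it is zero altogether. *)
have nA0 : neg eta A = 0%E.
  apply/eqP; rewrite eq_le measure_ge0 andbT (nr.2 A mA); apply: ge_ereal_sup => _ [K [cK KA] <-].
  rewrite -(fineK (finK _ _ nr cK)); apply: (@le_trans _ _ (fine (pos eta K))%:E).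
    by rewrite lee_fin neg_le.
  rewrite fineK ?finK// -pA; apply: le_measure => //; rewrite ?inE//.
  exact: compact_borel.
have n0 B : measurable (B : set (borel X)) -> neg eta B = 0%E.
  move=> mB; apply/eqP; rewrite -measure_le0.
  rewrite -[leRHS]adde0 -{1}nA0 -nA -measureU//; last exact: setICr.
    by rewrite setUCr; apply: le_measure; rewrite ?inE.
  exact: measurableC.
have etaE f : int1 f eta = \int[pos eta]_x f x.
  rewrite /int1 [X in _ - X](_ : _ = 0) ?subr0//.
  rewrite /Rintegral (@eq_measure_integral _ _ _ _ mzero); last first.
    by move=> B mB _; rewrite n0.
  by rewrite integral_measure_zero.
have pK (K : set X) : compact K -> exists k : nat, pos eta K = k%:R%:E.
  move=> cK; suff [k hk] : exists k : nat, fine (pos eta K) = k%:R.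
    by exists k; rewrite -hk fineK// finK.
  apply: natr_limit => e e0.
  have [f [Cf f01 fK fS f0]] := compact_approx R X_locally_compact X_hausdorff X_second_countable cK.
  have /cvgrPdist_le/(_ (e / 2)) := compact_approx_integral pr cK Cf f01 fK fS f0.
  rewrite divr_gt0// => /(_ isT)[N _ hN].
  have h1 := hN N (leqnn N); have h2 := hN N.+1 (leqnSn N).
  have e20 : 0 < e / 2 by rewrite divr_gt0.
  have [xi [xiN x1 x2]] := near_conf (f N) (f N.+1) (e / 2) e20 (Cf N) (Cf N.+1).
  (* The indicator of the compact set [F] lies between [f N.+1] and [f N]. The integer mass of [F]
     under the nearby configuration [xi] is thus squeezed between two integrals that are both within
     [e] of the mass of [K] under [eta]. *)
  pose F : set X := [set x | f N x = 1].
  have [cfN [K' cK' fK']] := (CcP X_hausdorff _).1 (Cf N).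
  have clF : closed F.
    apply: (@closed_comp _ _ (f N) [set 1]); last exact: closed_eq.
    by move=> x _; exact: cfN.
  have cF : compact F.
    apply: (subclosed_compact clF cK') => x Fx; apply: contrapT => /fK' fx.
    by move: Fx; rewrite /F/= fx => /eqP; rewrite eq_sym oner_eq0.
  have mF := compact_borel X_hausdorff cF.
  have Ffin := finK _ _ (pos_radon xi) cF.
  have [_ [[k Fk]|Foo]] := xiN _ mF; last by rewrite Foo in Ffin.
  have IF : fine (\int[pos xi]_x (\1_F x)%:E)%E = k%:R.
    by rewrite integral_indic// setIT Fk.
  have I1 : (pos xi).-integrable setT (EFin \o (\1_F : borel X -> R)).
    apply: (@bounded_support_integrable _ (borel X) R (pos xi) F _ 1) => //.
    - by rewrite Fk ltry.
    - by move=> x; rewrite indicE ger0_norm// lern1 leq_b1.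
    - by move=> x nFx; rewrite indicE memNset.
  have l1 : int1 (f N.+1) xi <= k%:R.
    rewrite xi_int// -IF; apply: le_Rintegral => //.
      exact: (Cc_integrable X_hausdorff (pos_radon xi) (Cf _)).
    move=> x _; rewrite indicE; have [->|/fS fx] := eqVneq (f N.+1 x) 0.
      by rewrite ler0n.
    by rewrite mem_set//; have /andP[] := f01 N.+1 x.
  have l2 : k%:R <= int1 (f N) xi.
    rewrite xi_int// -IF; apply: le_Rintegral => //.
      exact: (Cc_integrable X_hausdorff (pos_radon xi) (Cf _)).
    move=> x _; rewrite indicE; have [/set_mem ->//|_] := boolP (x \in F).
    by have /andP[] := f01 N x.
  exists k; rewrite ler_norml; move: h1 h2 x1 x2.
  rewrite -!etaE !ler_norml !ltr_norml => /andP[? ?] /andP[? ?] /andP[? ?] /andP[? ?].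
  by apply/andP; split; lra.
move=> B mB; split; first exact: n0.
rewrite (pr.2 B mB); apply: ereal_sup_nat.
  by exists (pos eta set0); exists set0 => //; split => //; exact: compact0.
by move=> _ [K [cK KB] <-]; left; exact: pK.
Qed.

End closedness.

(** * Hahn-Banach domination *)

Section hahn_banach.
Context (R : realType) (V : lmodType R) (E : set V) (p : V -> R).
Hypothesis E0 : E 0.
Hypothesis EZD : forall a f g, E f -> E g -> E (a *: f + g).

Let sublinear (q : V -> R) :=
  (forall f g, E f -> E g -> q (f + g) <= q f + q g) /\
  (forall a f, 0 < a -> E f -> q (a *: f) = a * q f).

Hypothesis subp : sublinear p.

Let ED f g : E f -> E g -> E (f + g).
Proof. by move=> Ef Eg; rewrite -[f]scale1r; exact: EZD. Qed.

Let EZ a f : E f -> E (a *: f).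
Proof. by move=> Ef; rewrite -[_ *: _]addr0; exact: EZD. Qed.

Let EN f : E f -> E (- f).
Proof. by move=> Ef; rewrite -scaleN1r; exact: EZ. Qed.

Let sub0 q : sublinear q -> q 0 = 0.
Proof.
move=> [_ /(_ 2 0 (ltr0n _ 2) E0)]; rewrite scaler0 => h.
by move: h; lra.
Qed.

Let subN q f : sublinear q -> E f -> - q (- f) <= q f.
Proof.
move=> sq Ef; have := sq.1 f (- f) Ef (EN Ef).
by rewrite subrr sub0//; lra.
Qed.

(** Used for a chain of sublinear functionals and for the one-parameter family that tests linearity.
    The lower bound [m] keeps the infimum from being the default value of an unbounded set. *)
Let inf_sublinear I (D : set I) (q : I -> V -> R) (m : V -> R) : D !=set0 ->
  (forall i f, D i -> E f -> m f <= q i f) ->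
  (forall i j f g, D i -> D j -> E f -> E g ->
     exists2 k, D k & q k (f + g) <= q i f + q j g) ->
  (forall a i f, 0 < a -> D i -> E f -> exists2 j, D j & q j (a *: f) <= a * q i f) ->
  sublinear (fun f => inf [set q i f | i in D]) /\
  forall i f, D i -> E f -> inf [set q i f | i in D] <= q i f.
Proof.
move=> [i0 Di0] mq qD qZ; set qs := fun f => inf _.
have lb f : E f -> has_lbound [set q i f | i in D].
  by move=> Ef; exists (m f) => _ [i Di <-]; exact: mq.
have ne f : [set q i f | i in D] !=set0 by exists (q i0 f); exists i0.
have le i f : D i -> E f -> qs f <= q i f.
  by move=> Di Ef; apply: ge_inf; [exact: lb|exists i].
split=> //; split=> [f g Ef Eg|a f a0 Ef].
  rewrite -lerBlDl; apply: lb_le_inf => // _ [j Dj <-].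
  rewrite lerBlDl -lerBlDr; apply: lb_le_inf => // _ [i Di <-].
  rewrite lerBlDr; have [k Dk h] := qD i j f g Di Dj Ef Eg.
  by apply: le_trans h; apply: le => //; exact: ED.
have le1 b h : 0 < b -> E h -> qs (b *: h) <= b * qs h.
  move=> b0 Eh; rewrite -ler_pdivrMl//; apply: lb_le_inf => // _ [i Di <-].
  rewrite ler_pdivrMl//; have [j Dj ij] := qZ b i h b0 Di Eh.
  by apply: le_trans ij; apply: le => //; exact: EZ.
apply/eqP; rewrite eq_le le1//= -ler_pdivlMl//.
have := le1 a^-1 (a *: f); rewrite invr_gt0 => /(_ a0 (EZ a Ef)).
by rewrite scalerA mulVf ?gt_eqF// scale1r.
Qed.

(** A minimal sublinear functional below [p] is linear. No subspace is extended: agreement with a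
    given functional will follow from bounds of [p] at a vector and at its opposite. *)
Lemma hahn_banach_sublinear : exists l : V -> R,
  (forall a f g, E f -> E g -> l (a *: f + g) = a * l f + l g) /\
  (forall f, E f -> l f <= p f).
Proof.
pose T := {q : V -> R | sublinear q /\ forall f, E f -> q f <= p f}.
(* The order is reversed, so that Zorn's premaximal element is a minimal functional. *)
pose r (q q' : T) := `[< forall f, E f -> sval q' f <= sval q f >].
have p_in : sublinear p /\ forall f, E f -> p f <= p f by split.
have low (q : T) f : E f -> - p (- f) <= sval q f.
  case: q => q [sq qp] /= Ef; apply: le_trans (subN sq Ef).
  by rewrite lerN2; apply: qp; exact: EN.
have [q qmin] : exists q : T, premaximal r q.
  apply: ZL_preorder; first exact: (exist _ p p_in).
  - by move=> q; apply/asboolP.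
  - move=> a b c /asboolP ab /asboolP bc; apply/asboolP => f Ef.
    by apply: le_trans (bc f Ef) (ab f Ef).
  move=> A Atot; have [A0|/set0P A0] := eqVneq A set0.
    by exists (exist _ p p_in) => s; rewrite A0.
  have [| | |sq le] := @inf_sublinear T A (fun q => sval q) (fun f => - p (- f)) A0.
  - by move=> i f _; exact: low.
  - move=> i j f g Ai Aj Ef Eg; have [/asboolP ij|/asboolP ji] := Atot i j Ai Aj.
      exists j => //; apply: (le_trans ((svalP j).1.1 f g Ef Eg)).
      by rewrite lerD2r; exact: ij.
    exists i => //; apply: (le_trans ((svalP i).1.1 f g Ef Eg)).
    by rewrite lerD2l; exact: ji.
  - by move=> a i f a0 Ai Ef; exists i => //; rewrite (svalP i).1.2.
  have [i0 Ai0] := A0.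
  have qp f : E f -> inf [set sval i f | i in A] <= p f.
    by move=> Ef; apply: (le_trans (le i0 f Ai0 Ef)); exact: (svalP i0).2.
  pose t : T := exist _ (fun f => inf [set sval i f | i in A]) (conj sq qp).
  exists t => s As; apply/asboolP => f Ef /=.
  exact: le.
have [sq qp] := svalP q; set l := sval q in sq qp *.
have lN f : E f -> l (- f) = - l f.
  (* The infimum over [t >= 0] of [l (h + t f) - t l f] is sublinear and below [l], hence equal to
     [l] on [E] by minimality. At [h = - f] and [t = 1] it is at most [- l f], so
     [l (- f) <= - l f]. *)
  move=> Ef; pose qt t h := l (h + t *: f) - t * l f.
  have [| | | |sq' le] := @inf_sublinear R [set t | 0 <= t] qt (fun h => - l (- h)).
  - by exists 0 => /=.
  - move=> t h /=; rewrite le_eqVlt => /predU1P[<-|t0] Eh.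
      by rewrite /qt scale0r addr0 mul0r subr0; exact: subN.
    have := sq.1 (h + t *: f) (- h); rewrite addrAC subrr add0r sq.2//.
    have Eth : E (h + t *: f) by apply: ED => //; exact: EZ.
    by move=> /(_ Eth (EN Eh)); rewrite /qt; lra.
  - move=> s t g h /= s0 t0 Eg Eh; exists (s + t) => /=; first exact: addr_ge0.
    have Egs : E (g + s *: f) by apply: ED => //; exact: EZ.
    have Eht : E (h + t *: f) by apply: ED => //; exact: EZ.
    have := sq.1 (g + s *: f) (h + t *: f) Egs Eht.
    by rewrite addrACA -scalerDl /qt mulrDl; lra.
  - move=> a t h a0 /= t0 Eh; exists (a * t) => /=; first by rewrite mulr_ge0// ltW.
    rewrite /qt -scalerA -scalerDr sq.2//; last by apply: ED => //; exact: EZ.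
    by rewrite mulrBr mulrA.
  have le0 h : E h -> inf [set qt t h | t in [set t | 0 <= t]] <= l h.
    move=> Eh; apply: (le_trans (le 0 h _ Eh)) => //=.
    by rewrite /qt scale0r addr0 mul0r subr0.
  have q'p h : E h -> inf [set qt t h | t in [set t | 0 <= t]] <= p h.
    by move=> Eh; apply: (le_trans (le0 h Eh)); exact: qp.
  pose q' : T := exist _ (fun h => inf [set qt t h | t in [set t | 0 <= t]]) (conj sq' q'p).
  have : r q q' by apply/asboolP => h Eh; exact: le0.
  move=> /qmin/asboolP/(_ (- f) (EN Ef)) /= h1.
  have := le 1 (- f) ler01 (EN Ef); rewrite /qt scale1r addNr sub0// mul1r => h2.
  have := subN sq Ef; rewrite -/l in h1 *; lra.
have lD f g : E f -> E g -> l (f + g) = l f + l g.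
  move=> Ef Eg; apply/eqP; rewrite eq_le sq.1//=.
  have := sq.1 (f + g) (- g) (ED Ef Eg) (EN Eg).
  by rewrite addrK lN//; lra.
exists l; split=> // a f g Ef Eg; rewrite lD//; last exact: EZ.
congr (_ + _); have [a0|a0|->] := ltgtP a 0.
- rewrite -[in LHS](opprK a) scaleNr lN; last exact: EZ.
  by rewrite sq.2 ?oppr_gt0// mulNr opprK.
- by rewrite sq.2.
- by rewrite scale0r sub0// mul0r.
Qed.

End hahn_banach.

(** * Representing a monotone functional on an interval *)

(* Splitting [D] successively by the sets [Q i] cuts [0, mass D) into intervals
   whose lengths are the masses [l (\1_P)] of the pieces; [cell k t] is the piece
   of the k-th generation that owns the point [t]. *)
Section bisection_tree.
Context (R : realType) (T : Type) (D : set T) (Q : nat -> set T).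
Variable l : (T -> R) -> R.
Let bounded (f : T -> R) := exists B, forall x, `|f x| <= B.
Hypothesis l_linear : forall a f g, bounded f -> bounded g ->
  l (fun x => a * f x + g x) = a * l f + l g.
Hypothesis l_mono : forall f g, bounded f -> bounded g ->
  (forall x, D x -> f x <= g x) -> l f <= l g.

Definition mass (P : set T) : R := l (\1_P).

Let state := (set T * R)%type.

(** A state is a piece with the left end of its interval; the part inside [Q i] takes the left
    portion. Half-open intervals ensure that no point enters a part of mass zero. *)
Definition bisect (i : nat) (s : state) (t : R) : state :=
  let c := s.2 + mass (s.1 `&` Q i) in
  if t < c then (s.1 `&` Q i, s.2) else (s.1 `\` Q i, c).

Fixpoint walk k i s t : state :=
  if k is k'.+1 then walk k' i.+1 (bisect i s t) t else s.

Lemma walkSr k i s t : walk k.+1 i s t = bisect (i + k) (walk k i s t) t.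
Proof.
elim: k i s => [|k IH] i s; first by rewrite addn0.
by rewrite -[LHS]/(walk k.+1 i.+1 (bisect i s t) t) IH addnS.
Qed.

Definition cell k t : set T := (walk k 0 (D, 0) t).1.

Let bounded_indic (P : set T) : bounded (\1_P).
Proof. by exists 1 => x; rewrite indicE ger0_norm// lern1 leq_b1. Qed.

Let boundedM f g : bounded f -> bounded g -> bounded (fun x => f x * g x).
Proof.
move=> [B fB] [C gC]; exists (B * C) => x; rewrite normrM.
by apply: ler_pM.
Qed.

Let boundedZ a f : bounded f -> bounded (fun x => a * f x).
Proof. by move=> bf; apply: boundedM => //; exists `|a| => x. Qed.

Let bounded0 : bounded (fun=> 0).
Proof. by exists 0 => x; rewrite normr0. Qed.

Let l0 : l (fun=> 0) = 0.
Proof.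
have := l_linear 1 bounded0 bounded0; rewrite (_ : (fun x => _) = (fun=> 0)).
  by lra.
by apply/funext => x; rewrite mulr0 addr0.
Qed.

Let lZ a f : bounded f -> l (fun x => a * f x) = a * l f.
Proof.
move=> bf; have := l_linear a bf bounded0; rewrite l0 addr0 => <-.
by congr l; apply/funext => x; rewrite addr0.
Qed.

Let lD f g : bounded f -> bounded g -> l (fun x => f x + g x) = l f + l g.
Proof.
move=> bf bg; have := l_linear 1 bf bg; rewrite mul1r => <-.
by congr l; apply/funext => x; rewrite mul1r.
Qed.

Lemma mass_ge0 P : 0 <= mass P.
Proof. by rewrite -l0; apply: l_mono => // x _; rewrite indicE. Qed.

Lemma mass0 : mass set0 = 0.
Proof. by rewrite /mass -l0; congr l; apply/funext => x; rewrite indicE in_set0. Qed.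

Lemma mass_split P i : mass P = mass (P `&` Q i) + mass (P `\` Q i).
Proof.
rewrite /mass -lD//; congr l; apply/funext => x.
rewrite !indicE in_setI in_setD.
by case: (x \in P); case: (x \in Q i); rewrite /= ?addr0 ?add0r.
Qed.

Let inside (s : state) t := s.2 <= t < s.2 + mass s.1.

Lemma bisect_inside i s t : inside s t -> inside (bisect i s t) t.
Proof.
rewrite /inside /bisect => /andP[h1 h2].
case: ltP => h3 /=; first by rewrite h1.
by rewrite h3 -addrA -mass_split.
Qed.

Lemma walk_inside k i s t : inside s t -> inside (walk k i s t) t.
Proof. by elim: k i s => //= k IH i s h; apply: IH; exact: bisect_inside. Qed.

Lemma cellS k t : cell k.+1 t `<=` cell k t.
Proof. by rewrite /cell walkSr /bisect; case: ifP => _ x []. Qed.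

Lemma cell_nonincreasing j k t : (j <= k)%N -> cell k t `<=` cell j t.
Proof.
elim: k => [|k IH]; first by rewrite leqn0 => /eqP ->.
by rewrite leq_eqVlt => /predU1P[->//|/IH h]; apply: subset_trans h; exact: cellS.
Qed.

Lemma cell_sub k t : cell k t `<=` D.
Proof. exact: (@cell_nonincreasing 0 k). Qed.

Lemma cell_decides i k t : (i < k)%N -> cell k t `<=` Q i \/ cell k t `<=` ~` Q i.
Proof.
move=> ik; have h := @cell_nonincreasing i.+1 k t ik.
suff : cell i.+1 t `<=` Q i \/ cell i.+1 t `<=` ~` Q i.
  by move=> [|] h'; [left|right]; exact: subset_trans h h'.
by rewrite /cell walkSr add0n /bisect; case: ifP => _; [left|right] => x [].
Qed.

(** The interval of the cell contains [t], so it has positive length, whereas the empty piece has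
    mass zero. *)
Lemma cell_nonempty k t : 0 <= t < mass D -> cell k t !=set0.
Proof.
move=> ht; have : inside (D, 0) t by rewrite /inside/= add0r.
move=> /(@walk_inside k 0) /andP[h1 h2]; apply/set0P/eqP => e.
by move: h2; rewrite -/(cell k t) e mass0 addr0 ltNge h1.
Qed.

(** States carry no sigma-algebra, hence the arbitrary real-valued [phi]; a walk depends on [t] only
    through comparisons. *)
Lemma walk_measurable k i s (phi : state -> R) :
  measurable_fun setT (fun t : R => phi (walk k i s t)).
Proof.
elim: k i s phi => [|k IH] i s phi; first exact: (@measurable_cst _ _ _ _ setT (phi s)).
rewrite (_ : (fun t => _) = (fun t => if t < (walk k i s t).2 + mass ((walk k i s t).1 `&` Q (i + k))
  then phi ((walk k i s t).1 `&` Q (i + k), (walk k i s t).2)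
  else phi ((walk k i s t).1 `\` Q (i + k), 
    (walk k i s t).2 + mass ((walk k i s t).1 `&` Q (i + k))))); last first.
  by apply/funext => t; rewrite walkSr /bisect; case: ifP.
apply: measurable_fun_ifT.
- apply: measurable_fun_ltr => //.
  exact: (IH i s (fun s => s.2 + mass (s.1 `&` Q (i + k)))).
- exact: (IH i s (fun s => phi (s.1 `&` Q (i + k), s.2))).
- exact: (IH i s (fun s => phi (s.1 `\` Q (i + k), s.2 + mass (s.1 `&` Q (i + k))))).
Qed.

Let walk_finite k i s : finite_set (range (walk k i s)).
Proof.
elim: k => [|k IH].
  by apply: (@sub_finite_set _ _ [set s]) => // _ [t _ <-].
pose c s' := s'.2 + mass (s'.1 `&` Q (i + k)).
apply: (@sub_finite_set _ _
  ((fun s' : state => (s'.1 `&` Q (i + k), s'.2)) @` range (walk k i s) `|`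
   (fun s' : state => (s'.1 `\` Q (i + k), c s')) @` range (walk k i s))).
  move=> _ [t _ <-]; rewrite walkSr /bisect; case: ifP => _.
    by left; exists (walk k i s t) => //; exists t.
  by right; exists (walk k i s t) => //; exists t.
by rewrite finite_setU; split; exact: finite_image.
Qed.

(** [C] collects the cut points of all generations; each generation has finitely many states, so [C]
    is countable. *)
Lemma cell_locally_constant : exists2 C : set R, countable C &
  forall t, ~ C t -> forall k, \forall t' \near t, cell k t' = cell k t.
Proof.
pose c k (s : state) := s.2 + mass (s.1 `&` Q k).
exists (\bigcup_k (c k @` range (walk k 0 (D, 0)))).
  apply: bigcup_countable => // k _; apply: finite_set_countable.
  by apply: finite_image; exact: walk_finite.
move=> t nC k.
suff : \forall t' \near t, walk k 0 (D, 0) t' = walk k 0 (D, 0) t.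
  by apply: filterS => t'; rewrite /cell => ->.
elim: k => [|k IH]; first by apply: (@filterS _ (nbhs t) _ setT) => //; exact: filterT.
set s := walk k 0 (D, 0) t in IH.
have tc : t != c k s.
  apply/eqP => e; apply: nC; exists k => //.
  by exists s; [exists t|exact: esym e].
have near_lt : \forall t' \near t, (t' < c k s) = (t < c k s).
  have [lt|gt|e] := ltgtP t (c k s); last by rewrite e eqxx in tc.
    have : \forall t' \near t, t' \in `]-oo, c k s[ by apply: near_in_itvNyo; rewrite in_itv.
    by apply: filterS => t'; rewrite in_itv.
  have : \forall t' \near t, t' \in `]c k s, +oo[ by apply: near_in_itvoy; rewrite in_itv/= gt.
  by apply: filterS => t'; rewrite in_itv/= andbT => h; apply/negbTE; rewrite -leNgt ltW.
apply: filterS2 IH near_lt => t' e1 e2.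
by rewrite !walkSr add0n e1 -/s /bisect -/(c k s) e2.
Qed.

Let mu := @lebesgue_measure R.

Section upper_sum.
Context (F : T -> R) (B : R).
Hypothesis FB : forall x, `|F x| <= B.

Let FBle x : - B <= F x <= B.
Proof. by rewrite -ler_norml. Qed.

Let B0 : T -> 0 <= B.
Proof. by move=> x; exact: le_trans (FB x). Qed.

(** The default 0 on the empty piece is harmless, as that piece has mass zero. *)
Definition upper (P : set T) : R := if `[< P !=set0 >] then sup (F @` P) else 0.

Lemma upper_ge P x : P x -> F x <= upper P.
Proof.
move=> Px; rewrite /upper ifT; last by apply/asboolP; exists x.
apply: ub_le_sup; last by exists x.
by exists B => _ [y _ <-]; have /andP[] := FBle y.
Qed.

Lemma upper_le P M : P !=set0 -> (forall x, P x -> F x <= M) -> upper P <= M.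
Proof.
move=> P0 FM; rewrite /upper ifT; last exact/asboolP.
apply: ge_sup; first by have [x Px] := P0; exists (F x); exists x.
by move=> _ [y Py <-]; exact: FM.
Qed.

(** Stated with the absolute value of [B], since [B] may be negative when [T] is empty. *)
Lemma upper_bounded P : `|upper P| <= `|B|.
Proof.
have [[x Px]|h] := pselect (P !=set0); last by rewrite /upper ifF ?normr0//; exact/asboolPn.
have B0' : `|B| = B by rewrite ger0_norm// B0.
rewrite B0' ler_norml; apply/andP; split.
  by apply: le_trans (upper_ge Px); have /andP[] := FBle x.
by apply: upper_le => [|y _]; [exists x|have /andP[] := FBle y].
Qed.

Let seg a (P : set T) : set R := [set` `[a, a + mass P[].

Let segE a P : seg a P = `[a, a + mass P[%classic. Proof. by []. Qed.

Let mseg a P : measurable (seg a P).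
Proof. by rewrite segE; exact: measurable_itv. Qed.

Let mu_seg a P : mu (seg a P) = (mass P)%:E.
Proof.
rewrite /mu segE lebesgue_measure_itv /= lte_fin ltrDl; case: ltP => h.
  by rewrite -EFinD; congr EFin; ring.
by congr EFin; apply/eqP; rewrite eq_le mass_ge0.
Qed.

(** A Darboux upper sum after [k] splittings, by induction: both sides are additive over the two
    parts of [P]. Finite additivity and monotonicity of [l] are all that enters. *)
Lemma upper_sum_ge k i P a : l (fun x => F x * \1_P x) <=
  \int[mu]_(t in seg a P) upper (walk k i (P, a) t).1.
Proof.
have integ k' i' s (A : set R) : measurable A -> (mu A < +oo)%E ->
    mu.-integrable A (EFin \o (fun t => upper (walk k' i' s t).1)).
  move=> mA Aoo; apply: measurable_bounded_integrable => //.
    by apply: measurable_funTS; exact: (walk_measurable _ _ _ (fun s => upper s.1)).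
  exists `|B|; split; first exact: num_real.
  by move=> M BM t _ /=; apply: le_trans (ltW BM); exact: upper_bounded.
elim: k i P a => [|k IH] i P a /=.
  have -> : \int[mu]_(_ in seg a P) upper P = upper P * mass P.
    rewrite Rintegral_cst; last exact: mseg.
    congr (_ * _).
    exact: (congr1 fine (mu_seg a P)).
  rewrite -lZ//; apply: l_mono.
  - by apply: boundedM => //; exists B.
  - exact: boundedZ.
  - move=> x Dx; rewrite indicE; case: (boolP (x \in P)) => [/set_mem Px|_].
      by rewrite !mulr1; exact: upper_ge.
    by rewrite !mulr0.
pose c := a + mass (P `&` Q i).
have ac : a <= c by rewrite lerDl mass_ge0.
have cb : c + mass (P `\` Q i) = a + mass P by rewrite [in RHS](mass_split P i) addrA.
have cle : c <= a + mass P by rewrite -cb lerDl mass_ge0.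
have Eseg : seg a P = seg a (P `&` Q i) `|` seg c (P `\` Q i).
  rewrite !segE -/c cb; apply/seteqP; split=> t /=; rewrite !in_itv/=.
    by move=> /andP[h1 h2]; have [h|h] := ltP t c; [left|right]; apply/andP.
  case=> /andP[h1 h2]; apply/andP; split=> //; last exact: le_trans h1.
  exact: lt_le_trans h2 cle.
rewrite Eseg Rintegral_setU; [|exact: mseg|exact: mseg|..]; last 2 first.
- rewrite -Eseg; apply: (integ k.+1 i (P, a)); first exact: mseg.
  by rewrite mu_seg ltry.
- rewrite disj_set2E; apply/eqP/seteqP; split=> // t [] /=.
  rewrite !segE /= !in_itv/= => /andP[_ h1] /andP[h2 _].
  by move: h1; rewrite -/c ltNge h2.
have -> : l (fun x => F x * \1_P x) =
    l (fun x => F x * \1_(P `&` Q i) x) + l (fun x => F x * \1_(P `\` Q i) x).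
  rewrite -lD; [|by apply: boundedM => //; exists B..].
  congr l; apply/funext => x; rewrite !indicE in_setI in_setD.
  by case: (x \in P); case: (x \in Q i); rewrite /= ?mulr0 ?addr0 ?add0r.
apply: lerD.
  apply: le_trans (IH i.+1 (P `&` Q i) a) _.
  rewrite le_eqVlt; apply/orP; left; apply/eqP; apply: eq_Rintegral => t.
  by rewrite inE segE /= in_itv/= => /andP[_ h]; rewrite /bisect/= -/c ifT.
apply: le_trans (IH i.+1 (P `\` Q i) c) _.
rewrite le_eqVlt; apply/orP; left; apply/eqP; apply: eq_Rintegral => t.
rewrite inE segE /= in_itv/= => /andP[h _]; rewrite /bisect/= -/c ifF//.
by apply/negbTE; rewrite -leNgt.
Qed.

End upper_sum.

Let dom : set R := `[0, mass D[%classic.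

(** Here finite additivity turns into an honest integral. If the oscillation of [F] along each
    branch tends to 0, the upper sums converge pointwise to [G], and dominated convergence gives one
    inequality; [- F] gives the other. *)
Lemma tree_integral (F : T -> R) (G : R -> R) : bounded F ->
  (forall t e, dom t -> 0 < e -> exists k, forall x, cell k t x -> `|F x - G t| <= e) ->
  measurable_fun dom G /\ \int[mu]_(t in dom) G t = l F.
Proof.
move=> bF osc; have mdom : measurable dom by exact: measurable_itv.
have mu_dom : mu dom = (mass D)%:E.
  rewrite /mu /dom lebesgue_measure_itv /= lte_fin; case: ltP => h.
    by rewrite -EFinD subr0.
  by congr EFin; apply/eqP; rewrite eq_le mass_ge0 h.
have main (H : T -> R) (K : R -> R) B : (forall x, `|H x| <= B) ->
    (forall t e, dom t -> 0 < e -> exists k, forall x, cell k t x -> `|H x - K t| <= e) ->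
    [/\ measurable_fun dom K, mu.-integrable dom (EFin \o K) &
        l H <= \int[mu]_(t in dom) K t].
  move=> HB oscH.
  pose u k t := upper H (cell k t).
  have mu_ k : measurable_fun dom (u k).
    by apply: measurable_funTS; exact: (walk_measurable _ _ _ (fun s => upper H s.1)).
  have ucv t : dom t -> u ^~ t @ \oo --> K t.
    move=> dt; have dt' : 0 <= t < mass D by move: dt; rewrite /dom/= in_itv.
    apply/cvgrPdist_le => e e0; have [k hk] := oscH t e dt e0; exists k => // j /= kj.
    have [x xj] := cell_nonempty j dt'; have xk := cell_nonincreasing kj xj.
    rewrite ler_norml; apply/andP; split.
      suff : upper H (cell j t) <= K t + e by rewrite /u; lra.
      apply: upper_le; first by exists x.
      move=> y yj; have := hk y (cell_nonincreasing kj yj).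
      by rewrite ler_norml => /andP[_]; lra.
    have := upper_ge HB xj; have := hk x xk; rewrite ler_norml => /andP[h _] h'.
    by rewrite /u; lra.
  have mK : measurable_fun dom K by apply: (measurable_fun_cvg mu_).
  have icst : mu.-integrable dom (EFin \o (fun=> `|B|)).
    have mu_oo : (mu dom < +oo)%E by rewrite mu_dom ltry.
    apply: (@measurable_bounded_integrable _ _ _ mu (cst `|B|) dom mdom mu_oo); first exact: measurable_cst.
    exists `|B|; split; first exact: num_real.
    by move=> M BM t _ /=; rewrite normr_id ltW.
  have [|||||iK _ cv] := @dominated_convergence _ (measurableTypeR R) R mu dom mdom
      (fun k => EFin \o u k) (EFin \o K) (EFin \o (fun=> `|B|)).
  - by move=> k; apply/measurable_EFinP; exact: mu_.
  - by apply/measurable_EFinP; exact: mK.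
  - apply: aeW => t dt; apply: cvg_EFin; first exact: nearW.
    exact: ucv.
  - exact: icst.
  - by apply: aeW => t k dt /=; rewrite lee_fin; exact: upper_bounded.
  split=> //.
  have fin_cv : \int[mu]_(t in dom) u k t @[k --> \oo] --> \int[mu]_(t in dom) K t.
    rewrite /Rintegral; apply: fine_cvg; rewrite fineK; first exact: cv.
    by apply: integrable_fin_num; [exact: mdom|exact: iK].
  apply: (cvgr_to_ge fin_cv); apply: nearW => k.
  have := @upper_sum_ge H B HB k 0 D 0; rewrite add0r; apply: le_trans.
  apply: l_mono; first by exists B.
    by apply: boundedM => //; exists B.
  by move=> x Dx; rewrite indicE mem_set// mulr1.
have [B FB] := bF.
have [mG iG le1] := main F G B FB osc.
split=> //; apply/eqP; rewrite eq_le le1 andbT.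
have [||_ _ ] := main (fun x => - F x) (fun t => - G t) B.
- by move=> x; rewrite normrN.
- move=> t e dt e0; have [k hk] := osc t e dt e0; exists k => x /hk.
  by rewrite -opprD normrN.
rewrite (_ : l (fun x => - F x) = - l F); last first.
  by rewrite -mulN1r -lZ//; congr l; apply/funext => x; rewrite mulN1r.
rewrite (_ : \int[mu]_(t in dom) - G t = - \int[mu]_(t in dom) G t) ?lerN2//.
rewrite -mulN1r -RintegralZl//; apply: eq_Rintegral => t _; by rewrite mulN1r.
Qed.

End bisection_tree.

(** * Limits of configurations *)

Section option_limits.
Context (R : realType) (X : ptopologicalType).
Hypothesis X_hausdorff : hausdorff_space X.

(* Convergence in the one-point compactification, [None] being the point at infinity. *)
Definition opt_cvg (F : set_system (option X)) (o : option X) : Prop :=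
  if o is Some z
  then forall V, open V -> V z -> F [set o' | exists2 y, o' = Some y & V y]
  else forall K, compact K -> F [set o' | forall y, o' = Some y -> ~ K y].

(** If some base set is eventually occupied, compactness yields a cluster point, and since [F]
    decides every base set, clustering becomes convergence. If none is, finitely many unoccupied
    base sets cover any compact set, so the limit is [None]. *)
Lemma opt_cvg_exists (F : set_system (option X)) (U : nat -> set X) :
  ProperFilter F -> (forall l, open (U l)) ->
  (forall l, exists2 K, compact K & U l `<=` K) ->
  (forall x O, open O -> O x -> exists2 l, U l x & U l `<=` O) ->
  (forall l, F [set o | exists2 y, o = Some y & U l y] \/
             F (~` [set o | exists2 y, o = Some y & U l y])) ->
  exists o, opt_cvg F o.
Proof.
move=> PF oU cU bU dec.
have [[l Fl]|none] := pselect (exists l, F [set o | exists2 y, o = Some y & U l y]).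
  have [K cK UK] := cU l.
  pose G : set_system X := fun A => F [set o | exists2 y, o = Some y & A y].
  have GS A B : A `<=` B -> G A -> G B.
    by move=> AB; apply: (@filterS _ F) => o [y -> /AB By]; exists y.
  have GK : G K by exact: GS UK Fl.
  have PG : ProperFilter G.
    split; first by move=> /(@filter_ex _ F PF) [w [y]].
    split; first by exact: GS Fl.
      move=> A B; apply: (@filterS2 _ F) => o [y -> Ay] [z [<-] Bz].
      by exists y.
    by move=> A B; exact: GS.
  have [z [Kz zG]] := cK G PG GK.
  exists (Some z) => V oV Vz; have [l' Uz UV] := bU z V oV Vz.
  have [F'|F'] := dec l'; first exact: GS UV F'.
  have G' : G (~` U l').
    by apply: filterS2 F' Fl => o h [y oy _]; exists y => // Uy; apply: h; exists y.
  have [y [nUy Uy]] := zG _ _ G' (open_nbhs_nbhs (conj (oU l') Uz)).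
  by exfalso; exact: nUy.
exists None => K cK; have [|x Kx|s _ Ks] := @compact_cover_seq _ _ K setT U cK.
- by move=> i _; exact: oU.
- by have [l Ux _] := bU x setT openT I; exists l.
suff : F [set o | forall l y, l \in s -> o = Some y -> ~ U l y].
  apply: filterS => o h y oy Ky; have [l ls Ul] := Ks y Ky.
  exact: h ls oy Ul.
elim: s {Ks} => [|l s IH]; first by apply: (@filterS _ F _ setT) filterT.
have Fl : F (~` [set o | exists2 y, o = Some y & U l y]).
  by have [h|//] := dec l; exfalso; apply: none; exists l.
apply: filterS2 Fl IH => o h1 h2 l' y; rewrite in_cons => /predU1P[->|l's] oy Uy.
  by apply: h1; exists y.
exact: h2 l's oy Uy.
Qed.

Section evaluation.
Context (Omega : Type) (G : set_system Omega).
Hypothesis PG : ProperFilter G.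

Lemma opt_cvg_oapp (u : Omega -> option X) o (f : X -> R) : opt_cvg (u @ G) o ->
  Cc f -> oapp f 0 (u w) @[w --> G] --> oapp f 0 o.
Proof.
move=> uo /(CcP X_hausdorff)[cf [K cK fK]]; case: o uo => [z|] uo /=.
  apply/cvgrPdist_lt => e e0.
  have /cvgrPdist_lt/(_ e e0) zW := cf z.
  have := uo _ (@open_interior _ _) (nbhs_singleton (nbhs_interior zW)).
  apply: (@filterS _ G) => w /= [y -> ] zy /=.
  exact: (interior_subset zy).
apply: cvg_near_cst; have := uo K cK; apply: (@filterS _ G) => w h.
by case E : (u w) => [y|]//=; rewrite fK//; exact: h E.
Qed.

Lemma opt_cvg_oapp2 (u v : Omega -> option X) o o' (f : X * X -> R) :
  opt_cvg (u @ G) o -> opt_cvg (v @ G) o' -> Cc f ->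
  oapp (fun y => oapp (fun z => f (y, z)) 0 (v w)) 0 (u w) @[w --> G] -->
  oapp (fun y => oapp (fun z => f (y, z)) 0 o') 0 o.
Proof.
move=> uo vo Cf; have [cf _] := Cf.
have [K cK fK] := Cc_prod_support X_hausdorff Cf.
case: o uo => [y0|] uo /=; last first.
  apply: cvg_near_cst; have := uo K cK; apply: (@filterS _ G) => w h.
  case E : (u w) => [y|]//=; case: (v w) => [z|]//=.
  by rewrite fK// => -[Ky _]; exact: h E Ky.
case: o' vo => [z0|] vo /=; last first.
  apply: cvg_near_cst; have := vo K cK; apply: (@filterS _ G) => w h.
  case: (u w) => [y|]//=; case E : (v w) => [z|]//=.
  by rewrite fK// => -[_ Kz]; exact: h E Kz.
apply/cvgrPdist_lt => e e0.
have /cvgrPdist_lt/(_ e e0)[[V W] [/= yV zW] VW] := cf (y0, z0).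
have uV := uo V° (@open_interior _ _) (nbhs_singleton (nbhs_interior yV)).
have vW := vo W° (@open_interior _ _) (nbhs_singleton (nbhs_interior zW)).
apply: (@filterS2 _ G) uV vW => w [y -> Vy] [z -> Wz] /=.
by apply: (VW (y, z)); split; exact: interior_subset.
Qed.

Lemma opt_cvg_closed (u : Omega -> option X) z (A : set X) : closed A ->
  opt_cvg (u @ G) (Some z) -> G [set w | forall y, u w = Some y -> A y] -> A z.
Proof.
move=> clA uz GA; apply: contrapT => nAz.
have h : G [set w | exists2 y, u w = Some y & ~ A y].
  exact: (uz (~` A) (closed_openC clA) nAz).
by have [w [[y uy nAy] /(_ y uy)]] := filter_ex (filterI h GA).
Qed.

End evaluation.

End option_limits.

Lemma cvg_sum_ord (R : realType) (T : Type) (F : set_system T) (N : nat)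
    (f : 'I_N -> T -> R) (a : 'I_N -> R) : Filter F ->
  (forall i, f i w @[w --> F] --> a i) ->
  \sum_(i < N) f i w @[w --> F] --> \sum_(i < N) a i.
Proof.
move=> FF; elim: N f a => [|N IH] f a h.
  by rewrite big_ord0; under eq_fun do rewrite big_ord0; exact: cvg_cst.
rewrite big_ord_recl; under eq_fun do rewrite big_ord_recl.
apply: cvgD => //; exact: IH.
Qed.

(** * Heights and limits of configurations of bounded height *)

Section exhaustion.
Context (R : realType) (X : ptopologicalType).
Hypothesis X_locally_compact : locally_compact [set: X].
Hypothesis X_hausdorff : hausdorff_space X.
Hypothesis X_second_countable : @second_countable X.
Context (Gamma : X -> R).
Hypothesis Gamma_C0 : C0 Gamma.
Hypothesis Gamma_gt0 : forall y, 0 < Gamma y.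
Implicit Types (eta : signed_radon X R) (x : nat -> option X).

Let Gamma_continuous : continuous Gamma. Proof. by case: Gamma_C0. Qed.

(** The set where Gamma is at least [1/j]; the product form makes [layer 0] empty, as the
    construction of slots requires. *)
Definition layer (j : nat) : set X := [set y | 1 <= Gamma y * j%:R].

Lemma layer_compact j : compact (layer j).
Proof.
have cl : closed (layer j).
  apply: (@closed_comp _ _ (fun y => Gamma y * j%:R) [set r | 1 <= r]); last exact: closed_ge.
  by move=> y _; apply: cvgM; [exact: Gamma_continuous|exact: cvg_cst].
have e0 : 0 < (j.+1%:R : R)^-1 by rewrite invr_gt0.
have [_ /(_ _ e0)[K cK KG]] := Gamma_C0.
apply: (subclosed_compact cl cK) => y; rewrite /layer/= => yj.
apply: contrapT => /KG; rewrite gtr0_norm// => lt; move: yj; apply/negP; rewrite -ltNge.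
apply: (@le_lt_trans _ _ (Gamma y * j.+1%:R)); first by rewrite ler_pM2l// ler_nat.
by rewrite -ltr_pdivlMr// mul1r.
Qed.

Lemma layer0 : layer 0 = set0.
Proof. by apply/seteqP; split=> // y; rewrite /layer/= mulr0 ler10. Qed.

Lemma layerS j : layer j `<=` layer j.+1.
Proof.
move=> y; rewrite /layer/= => /le_trans; apply; rewrite ler_pM2l//.
by rewrite ler_nat.
Qed.

Lemma layer_above (c : R) : 0 < c -> exists j : nat, 1 < c * j%:R.
Proof.
move=> c0; exists (Num.bound c^-1); rewrite -ltr_pdivrMl// mulr1.
by apply: archi_boundP; rewrite invr_ge0 ltW.
Qed.

Lemma layer_cover y : exists j, layer j y.
Proof. by have [j /ltW] := layer_above (Gamma_gt0 y); exists j. Qed.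

Definition total_weight eta : \bar R := (\int[pos eta]_y (Gamma y)%:E)%E.

(** An infinite total weight gets height 0 through [fine], so bounds on the height are only
    meaningful together with membership in [finite_configurations]. *)
Definition height eta : R := fine (total_weight eta).

Definition finite_configurations : set (signed_radon X R) :=
  [set eta | point_configurations eta /\ (total_weight eta < +oo)%E].

Lemma total_ge0 eta : (0 <= total_weight eta)%E.
Proof. by apply: integral_ge0 => y _; rewrite lee_fin ltW. Qed.

Lemma height_ge0 eta : 0 <= height eta.
Proof. by rewrite fine_ge0// total_ge0. Qed.

Lemma heightE eta : finite_configurations eta -> total_weight eta = (height eta)%:E.
Proof. by move=> [_ oo]; rewrite fineK// ge0_fin_numE// total_ge0. Qed.

Let Gamma_measurable : measurable_fun setT (Gamma : borel X -> R).
Proof. exact: continuous_borel. Qed.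

Lemma slots_total eta x : slots_of eta x ->
  total_weight eta = (\sum_(0 <= i <oo) (oapp Gamma 0 (x i))%:E)%E.
Proof.
move=> ex; rewrite /total_weight.
rewrite (@eq_measure_integral _ _ _ _ (slot_measure (T := borel X) R x)); last first.
  by move=> A mA _; rewrite (ex A mA).1.
rewrite ge0_integral_measure_series//; last 2 first.
- by move=> y _; rewrite lee_fin ltW.
- by apply/measurable_EFinP.
apply: eq_eseriesr => i _; case: (x i) => [y|]/=; last by rewrite integral_measure_zero.
rewrite integral_dirac//; last by apply/measurable_EFinP.
by rewrite diracT mul1e.
Qed.

Lemma slots_height eta x N : finite_configurations eta -> slots_of eta x ->
  \sum_(i < N) oapp Gamma 0 (x i) <= height eta.
Proof.
move=> fe ex; rewrite -lee_fin -heightE// (slots_total ex) -sumEFin.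
rewrite -(big_mkord xpredT (fun i => (oapp Gamma 0 (x i))%:E)).
apply: nneseries_lim_ge => i _ _; rewrite lee_fin.
by case: (x i) => //= y; exact: ltW.
Qed.

(** Markov's inequality: [Gamma y * j%:R] is at least 1 on the layer. *)
Lemma layer_mass eta j k : finite_configurations eta ->
  pos eta (layer j) = k%:R%:E -> k%:R <= j%:R * height eta.
Proof.
move=> fe jk; have mj := compact_borel X_hausdorff (@layer_compact j).
have mg : measurable_fun setT (fun y : borel X => (Gamma y * j%:R)%:E).
  by apply/measurable_EFinP; apply: measurable_funM => //; exact: measurable_cst.
rewrite -lee_fin -jk.
have -> : pos eta (layer j) = (\int[pos eta]_(y in layer j) (cst 1%E y))%E.
  by rewrite integral_cst// mul1e.
apply: (@le_trans _ _ (\int[pos eta]_(y in layer j) (Gamma y * j%:R)%:E)%E).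
  apply: (@ge0_le_integral _ (borel X) R) => //.
  exact: measurable_funTS.
apply: (@le_trans _ _ (\int[pos eta]_y (Gamma y * j%:R)%:E)%E).
  apply: (@ge0_subset_integral _ (borel X) R) => //.
  by move=> y _; rewrite lee_fin mulr_ge0// ltW.
under eq_integral do rewrite mulrC EFinM.
rewrite (@ge0_integralZl _ (borel X) R)//; first by rewrite -/(total_weight eta) heightE.
  by apply/measurable_EFinP.
by move=> y _; rewrite lee_fin ltW.
Qed.

Lemma finite_slots eta : finite_configurations eta -> exists x,
  slots_of eta x /\ forall n J i y, height eta <= n%:R -> (J + J * n <= i)%N ->
  x i = Some y -> ~ layer J y.
Proof.
move=> fe; have [pe _] := fe.
have [||||x [ex xC]] := @point_configuration_slots _ _ X_hausdorff X_second_countable eta layer pe.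
- exact: layer_compact.
- exact: layer0.
- exact: layerS.
- exact: layer_cover.
exists x; split=> // n J i y hn Ji; have [_ peJ] := pe _ (compact_borel X_hausdorff (@layer_compact J)).
have Joo := radon_compact X_hausdorff (pos_radon eta) (@layer_compact J).
case: peJ => [[k Jk]|e]; last by rewrite e in Joo.
apply: (xC J k i y Jk); apply: leq_trans Ji; rewrite leq_add2l -(ler_nat R) natrM.
by apply: (le_trans (layer_mass fe Jk)); rewrite ler_wpM2l.
Qed.

(* A uniform version of local finiteness that passes to slotwise limits. *)
Definition admissible n x := forall J i y, (J + J * n <= i)%N -> x i = Some y ->
  Gamma y * J%:R <= 1.

(** Admissibility keeps late slots out of the open sets where [Gamma y * j%:R > 1]; finitely many of
    them cover [K], and [J] is their largest index. It depends neither on [n] nor on [x]. *)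
Lemma admissible_uniform K : compact K -> exists J, forall n x, admissible n x ->
  forall i y, (J + J * n <= i)%N -> x i = Some y -> ~ K y.
Proof.
move=> cK; have [|y Ky|s _ Ks] := @compact_cover_seq X nat K setT
    (fun j => [set y | 1 < Gamma y * j%:R]) cK.
- move=> j _; apply: (@open_comp _ _ (fun y => Gamma y * j%:R) [set r | 1 < r]).
    by move=> y _; apply: cvgM; [exact: Gamma_continuous|exact: cvg_cst].
  exact: open_gt.
- by have [j Gj] := layer_above (Gamma_gt0 y); exists j.
exists (\max_(j <- s) j) => n x ax i y Ji xy Ky; have [j js Gj] := Ks y Ky.
have := ax _ _ _ Ji xy; apply/negP; rewrite -ltNge; apply: (lt_le_trans Gj).
by rewrite ler_pM2l// ler_nat; apply: leq_bigmax_seq.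
Qed.

Lemma admissible_locally_finite n x : admissible n x -> locally_finite x.
Proof.
move=> ax K cK; have [J JK] := admissible_uniform cK.
by exists (J + J * n)%N; exact: JK ax.
Qed.

Section compactification.
Context (sl : signed_radon X R -> nat -> option X).
Hypothesis sl_slots : forall eta, finite_configurations eta -> slots_of eta (sl eta).
Hypothesis sl_admissible : forall eta n, finite_configurations eta ->
  height eta <= n%:R -> admissible n (sl eta).
Context (U : nat -> set X).
Hypothesis U_open : forall j, open (U j).
Hypothesis U_compact : forall j, exists2 K, compact K & U j `<=` K.
Hypothesis U_base : forall y O, open O -> O y -> exists2 j, U j y & U j `<=` O.

(** Height bounds and slot positions are enumerated jointly through [pickle]; codes outside its
    image give the trivial decision. *)
Definition decision (m : nat) : set (signed_radon X R) :=
  match unpickle m : option (nat + nat * nat) with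
  | Some (inl n) => [set eta | height eta <= n%:R]
  | Some (inr (i, j)) => [set eta | exists2 y, sl eta i = Some y & U j y]
  | None => setT
  end.

Lemma decision_height n :
  decision (pickle (inl n : nat + nat * nat)) = [set eta | height eta <= n%:R].
Proof. by rewrite /decision pickleK. Qed.

Lemma decision_slot i j : decision (pickle (inr (i, j) : nat + nat * nat)) =
  [set eta | exists2 y, sl eta i = Some y & U j y].
Proof. by rewrite /decision pickleK. Qed.

(** The successor appears because the [k]-th cell has settled the decisions of index below [k]. *)
Definition stage (n : nat) : nat := (pickle (inl n : nat + nat * nat)).+1.

Context (l : (signed_radon X R -> R) -> R).
Let bounded (f : signed_radon X R -> R) := exists B, forall eta, `|f eta| <= B.
Hypothesis l_linear : forall a f g, bounded f -> bounded g ->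
  l (fun eta => a * f eta + g eta) = a * l f + l g.
Hypothesis l_mono : forall f g, bounded f -> bounded g ->
  (forall eta, finite_configurations eta -> f eta <= g eta) -> l f <= l g.

Notation cell := (cell finite_configurations decision l).
Notation top := (mass l finite_configurations).

Definition ends (t : R) : set_system (signed_radon X R) := filter_from setT (cell^~ t).

Definition level n t : Prop := cell (stage n) t `<=` [set eta | height eta <= n%:R].

Definition good_parameter t := (0 <= t < top) /\ exists n, level n t.

Lemma ends_proper t : 0 <= t < top -> ProperFilter (ends t).
Proof.
move=> ht; apply: filter_from_proper; last first.
  by move=> k _; exact: (cell_nonempty _ l_linear).
apply: filter_from_filter; first by exists 0%N.
move=> i j _ _; exists (maxn i j) => //.
by move=> x h; split; apply: cell_nonincreasing h; rewrite ?leq_maxl ?leq_maxr.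
Qed.

Lemma level_or n t : level n t \/
  cell (stage n) t `<=` [set eta | ~ (height eta <= n%:R)].
Proof.
have := @cell_decides _ _ finite_configurations decision l
  (pickle (inl n : nat + nat * nat)) (stage n) t (leqnn _).
by rewrite decision_height.
Qed.

Lemma level_admissible n t : level n t -> ends t [set eta |
  [/\ finite_configurations eta, height eta <= n%:R & admissible n (sl eta)]].
Proof.
move=> nt; exists (stage n) => // eta h; have fe := cell_sub h.
by split=> //; [exact: nt|apply: sl_admissible => //; exact: nt].
Qed.

Lemma limit_slots t : 0 <= t < top -> exists x, forall i, opt_cvg (sl^~ i @ ends t) (x i).
Proof.
move=> ht; have PG := ends_proper ht.
have /choice[x hx] (i : nat) : exists o, opt_cvg (sl^~ i @ ends t) o.
  apply: (opt_cvg_exists _ U_open U_compact U_base) => j.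
  have := @cell_decides _ _ finite_configurations decision l
    (pickle (inr (i, j) : nat + nat * nat)) _ t (leqnn _).
  by rewrite decision_slot => -[h|h]; [left|right]; exists (pickle (inr (i, j) : nat + nat * nat)).+1.
by exists x.
Qed.

(** Along the branch, and at the limit, integrals of a compactly supported function are sums over
    the same first [J + J * n] slots, so slotwise convergence suffices. The height need not
    converge: points of small weight may escape to infinity. *)
Lemma limit_configuration t : good_parameter t -> exists eta,
  [/\ point_configurations eta,
      forall f, Cc f -> int1 f eta' @[eta' --> ends t] --> int1 f eta &
      forall f, Cc f -> int2 f eta' @[eta' --> ends t] --> int2 f eta].
Proof.
move=> [ht [n nt]]; have PG := ends_proper ht; have [x hx] := limit_slots ht.
have En := level_admissible nt.
have ax : admissible n x.
  move=> J i y Ji xy; have hi := hx i; rewrite xy in hi.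
  apply: (opt_cvg_closed PG (A := [set y | Gamma y * J%:R <= 1]) _ hi).
    apply: (@closed_comp _ _ (fun y => Gamma y * J%:R) [set r | r <= 1]); last exact: closed_le.
    by move=> z _; apply: cvgM; [exact: Gamma_continuous|exact: cvg_cst].
  by apply: (@filterS _ (ends t)) En => eta [_ _ ae] z; exact: ae.
have lx := admissible_locally_finite ax.
exists (slot_config R X_locally_compact X_hausdorff lx).
have ex := slot_configP R X_locally_compact X_hausdorff lx.
split.
- exact: (slots_point_configuration X_locally_compact X_hausdorff lx ex).
- move=> f Cf; have [_ [K cK fK]] := (CcP X_hausdorff _).1 Cf.
  have [J JK] := admissible_uniform cK.
  rewrite (slots_int1 X_hausdorff ex Cf cK (JK _ _ ax) fK).
  apply: (@cvg_trans _ (\sum_(i < J + J * n) oapp f 0 (sl eta' i) @[eta' --> ends t])).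
    apply: near_eq_cvg; apply: (@filterS _ (ends t)) En => eta [fe _ ae].
    by rewrite (slots_int1 X_hausdorff (sl_slots fe) Cf cK (JK _ _ ae) fK).
  apply: cvg_sum_ord => i; exact: (opt_cvg_oapp X_hausdorff PG (hx i) Cf).
- move=> f Cf; have [K cK fK] := slots_int2 X_locally_compact X_hausdorff X_second_countable Cf.
  have [J JK] := admissible_uniform cK.
  rewrite (fK _ _ _ ex (JK _ _ ax)).
  apply: (@cvg_trans _ (\sum_(i < J + J * n) \sum_(j < J + J * n)
      oapp (fun y => oapp (fun z => f (y, z)) 0 (sl eta' j)) 0 (sl eta' i) @[eta' --> ends t])).
    apply: near_eq_cvg; apply: (@filterS _ (ends t)) En => eta [fe _ ae].
    by rewrite (fK _ _ _ (sl_slots fe) (JK _ _ ae)).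
  apply: cvg_sum_ord => i; apply: cvg_sum_ord => j.
  exact: (opt_cvg_oapp2 X_hausdorff PG (hx i) (hx j) Cf).
Qed.

End compactification.

End exhaustion.

Lemma pushforward_pack d1 d2 (T1 : measurableType d1) (T2 : measurableType d2)
    (R : realType) (m : {measure set T1 -> \bar R}) (f : T1 -> T2) :
  measurable_fun setT f -> exists nu : {measure set T2 -> \bar R},
    nu = pushforward m f :> (set T2 -> \bar R).
Proof.
move=> mf.
pose mf_mixin := isMeasurableFun.Build _ _ _ _ _ mf.
pose f' : {mfun T1 >-> T2} := HB.pack f mf_mixin.
have mf' : measurable_fun setT f' by [].
by unshelve eexists (pushforward m f' : {measure set T2 -> \bar R}).
Qed.

(** * The representing measure *)

Section restricted_pushforward.
Context d (T : measurableType d) (R : realType).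
Notation mu := (@lebesgue_measure R).
Context (A : set R) (phi : R -> T).
Hypothesis mA : measurable A.
Hypothesis mphi : measurable_fun setT phi.

Lemma restricted_pushforward : exists nu : {measure set T -> \bar R},
  (forall B, nu B = mu (phi @^-1` B `&` A)) /\
  forall f : T -> R, measurable_fun setT f -> (forall y, 0 <= f y) ->
  (\int[nu]_y (f y)%:E = \int[mu]_(x in A) (f (phi x))%:E)%E.
Proof.
have [nu nuE] := pushforward_pack (mrestr mu mA) mphi.
exists nu; split=> [B|f mf f0]; first by rewrite nuE.
rewrite nuE ge0_integral_pushforward//; last 2 first.
- exact/measurable_EFinP.
- by move=> y _; rewrite lee_fin.
have mfp : measurable_fun setT (EFin \o (f \o phi)).
  by apply/measurable_EFinP; exact: measurableT_comp.
rewrite preimage_setT (@ge0_negligible_integral _ _ _ (mrestr mu mA) setT (~` A))//.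
- rewrite setDE setTI setCK; apply: eq_measure_integral => B mB BA.
  by rewrite /= /mrestr setIidl.
- exact: measurableC.
- by move=> x _; rewrite lee_fin.
- by rewrite /= /mrestr setICl measure0.
Qed.

End restricted_pushforward.

Section limit_measure.
Context (R : realType) (X : ptopologicalType).
Hypothesis X_locally_compact : locally_compact [set: X].
Hypothesis X_hausdorff : hausdorff_space X.
Hypothesis X_second_countable : @second_countable X.
Notation mu := (@lebesgue_measure R).

Lemma point_zero : point_configurations (point : signed_radon X R).
Proof. by move=> B mB; split=> //; left; exists 0%N. Qed.

(* An almost everywhere continuous parametrization transports the regularity
   of Lebesgue measure. *)
Lemma radon_pushforward (A : set R) (T : R -> signed_radon X R) (C : set R)
    (nu : {measure set (borel (signed_radon X R)) -> \bar R}) :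
  measurable A -> (mu A < +oo)%E -> countable C ->
  (forall t, A t -> ~ C t -> T t' @[t' --> within A (nbhs t)] --> T t) ->
  measurable_fun setT (T : R -> borel (signed_radon X R)) ->
  (forall B, nu B = mu (T @^-1` B `&` A)) ->
  is_radon nu.
Proof.
move=> mA Aoo cC Tc mT nuE.
have numono B B' : B `<=` B' -> (nu B <= nu B')%E.
  by move=> BB'; rewrite !nuE; apply: le_outer_measure; apply: setSI => x /BB'.
have mC : measurable C.
  by apply: countable_measurable => // t; exact: measurable_set1.
have C0 : mu C = 0%E by exact: countable_lebesgue_measure0.
have nuoo B : (nu B < +oo)%E.
  by rewrite nuE; apply: le_lt_trans Aoo; apply: le_outer_measure => x [].
split=> [eta|B mB]; first by exists setT => //; split=> //; exact: openT.
apply/eqP; rewrite eq_le; apply/andP; split; last first.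
  by apply: ge_ereal_sup => _ [K [_ KB] <-]; exact: numono.
have mTB : measurable (T @^-1` B) by rewrite -[_ @^-1` _]setTI; exact: mT.
(* Removing the countable set [C] costs no measure, and [T] is continuous on compact subsets of the
   rest; these map to compact subsets of [B]. *)
pose S := (T @^-1` B `&` A) `\` C.
have mS : measurable S by apply: measurableD => //; exact: measurableI.
have Soo : (mu S < +oo)%E.
  by apply: le_lt_trans Aoo; apply: le_outer_measure => x [[]].
have nuS : (nu B <= mu S)%E.
  rewrite nuE -(setDKU (A := T @^-1` B `&` A `&` C) (B := T @^-1` B `&` A)); last by move=> x [].
  rewrite setDIr setDv set0U.
  apply: (le_trans (outer_measureU2 _ _ _)).
  rewrite -/S [X in (_ + X <= _)%E](_ : _ = 0%E) ?adde0//.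
  apply/eqP; rewrite eq_le measure_ge0 andbT -C0.
  by apply: le_outer_measure => x [].
apply/lee_addgt0Pr => e e0.
have [V [cV VS muV]] := lebesgue_regularity_inner mS Soo e0.
apply: (le_trans nuS); apply: (@le_trans _ _ (mu V + mu (S `\` V))%E).
  rewrite -[X in (mu X <= _)%E](setDKU VS) setUC; exact: outer_measureU2.
apply: leeD; last exact: ltW.
apply: (@le_trans _ _ (nu (T @` V))).
  rewrite nuE; apply: le_outer_measure => t Vt; split; first by exists t.
  by have [[]] := VS _ Vt.
apply: ereal_sup_ubound; exists (T @` V) => //; split.
  apply: continuous_compact => //; apply/subspace_continuousP => t Vt.
  have [[_ At] nCt] := VS _ Vt.
  apply: cvg_trans (Tc t At nCt); apply: cvg_app; apply: within_subset => t' Vt'.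
  by have [[]] := VS _ Vt'.
by move=> _ [t Vt <-]; have [[]] := VS _ Vt.
Qed.

End limit_measure.

(** * Representing the functional by an image of Lebesgue measure *)

Section riesz_markov.
Context (R : realType) (X : ptopologicalType).
Hypothesis X_locally_compact : locally_compact [set: X].
Hypothesis X_hausdorff : hausdorff_space X.
Hypothesis X_second_countable : @second_countable X.
Context (Gamma : X -> R).
Hypothesis Gamma_C0 : C0 Gamma.
Hypothesis Gamma_gt0 : forall y, 0 < Gamma y.
Notation mu := (@lebesgue_measure R).
Notation finite_configurations := (@finite_configurations R X Gamma).
Notation height := (@height R X Gamma).

Definition bounded_height n : set (signed_radon X R) :=
  [set eta | finite_configurations eta /\ height eta <= n%:R].

(** Convergence of [int2] is put into the hypothesis because the vague topology refers to [int1]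
    only; limits along branches supply both. *)
Definition vaguely_continuous (F : signed_radon X R -> R) : Prop :=
  forall (G : set_system (signed_radon X R)) eta, ProperFilter G ->
    (forall f, Cc f -> int1 f eta' @[eta' --> G] --> int1 f eta) ->
    (forall f, Cc f -> int2 f eta' @[eta' --> G] --> int2 f eta) ->
    F eta' @[eta' --> G] --> F eta.

Context (l : (signed_radon X R -> R) -> R).
Let bounded (f : signed_radon X R -> R) := exists B, forall eta, `|f eta| <= B.
Hypothesis l_linear : forall a f g, bounded f -> bounded g ->
  l (fun eta => a * f eta + g eta) = a * l f + l g.
Hypothesis l_mono : forall f g, bounded f -> bounded g ->
  (forall eta, finite_configurations eta -> f eta <= g eta) -> l f <= l g.

Section parametrization.
Context (Q : nat -> set (signed_radon X R)) (stage : nat -> nat).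
Notation cell := (cell finite_configurations Q l).
Notation top := (mass l finite_configurations).
Notation dom := `[0, top[%classic.
Definition lev n t : Prop := cell (stage n) t `<=` [set eta | height eta <= n%:R].
Hypothesis lev_or : forall n t, lev n t \/
  cell (stage n) t `<=` [set eta | ~ (height eta <= n%:R)].
Context (C : set R) (T : R -> signed_radon X R).
Hypothesis C_countable : countable C.
Hypothesis C_constant : forall t, ~ C t -> forall k, \forall t' \near t, cell k t' = cell k t.
Let good_at n : set R := [set t | dom t /\ lev n t].
Let good := \bigcup_n good_at n.
Let ends t : set_system (signed_radon X R) := filter_from setT (cell^~ t).
Hypothesis ends_proper : forall t, dom t -> ProperFilter (ends t).
Hypothesis T_point : forall t, ~ good t -> T t = point.
Hypothesis T_int1 : forall t, good t -> forall f, Cc f ->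
  int1 f eta @[eta --> ends t] --> int1 f (T t).
Hypothesis T_int2 : forall t, good t -> forall f, Cc f ->
  int2 f eta @[eta --> ends t] --> int2 f (T t).

Lemma good_dom t : good t -> dom t.
Proof. by move=> [n _ []]. Qed.

Lemma cell_inhabited k t : dom t -> cell k t !=set0.
Proof. by move=> ht; apply: (cell_nonempty _ l_linear); move: ht; rewrite /= in_itv. Qed.

(** The truncated function has vanishing oscillation on every branch: either the heights are
    eventually at most [n] and [F] converges to its value at [T t], or they are eventually above [n]
    and both sides are 0. *)
Lemma level_integral F n : vaguely_continuous F ->
  (exists B, forall eta, bounded_height n eta -> `|F eta| <= B) ->
  measurable_fun dom (fun t => F (T t) * \1_(lev n) t) /\
  \int[mu]_(t in dom) (F (T t) * \1_(lev n) t) =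
  l (fun eta => F eta * \1_(bounded_height n) eta).
Proof.
move=> Fc [B FB]; apply: (tree_integral l_linear l_mono (Q := Q)).
  exists `|B| => eta; rewrite indicE; case: (boolP (eta \in _)) => [/set_mem h|_].
    by rewrite mulr1; apply: (le_trans (FB _ h)); exact: ler_norm.
  by rewrite mulr0 normr0.
move=> t e ht e0; have [lt|gt] := lev_or n t.
  have gt : good t by exists n.
  have PG := ends_proper ht.
  have /cvgrPdist_le/(_ e e0)[k _ kF] := Fc (ends t) (T t) PG (T_int1 gt) (T_int2 gt).
  exists (maxn k (stage n)) => eta h.
  have h1 : cell k t eta by apply: cell_nonincreasing h; rewrite leq_maxl.
  have h2 : cell (stage n) t eta by apply: cell_nonincreasing h; rewrite leq_maxr.
  rewrite !indicE !mem_set//; first by rewrite !mulr1 distrC; exact: kF.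
  by split; [exact: cell_sub h2|exact: lt].
exists (stage n) => eta h; rewrite !indicE !memNset ?mulr0 ?subrr ?normr0 ?ltW//.
  move=> lt; have [eta' h'] := cell_inhabited (stage n) ht.
  exact: (gt _ h') (lt _ h').
by move=> [_ h']; exact: (gt _ h).
Qed.

(** The case [F = 1] of [level_integral]: the indicator of the level is a limit of measurable upper
    sums. *)
Lemma good_at_measurable n : measurable (good_at n).
Proof.
have [||m1 _] := @level_integral (cst 1) n.
- by move=> G eta PG _ _; exact: cvg_cst.
- by exists 1 => eta _; rewrite normr1.
have m2 := m1 (measurable_itv _) _ (measurable_itv `]0, +oo[).
apply: (eq_ind _ measurable m2).
apply/seteqP; split=> t [ht h]; split=> //; move: h; rewrite /preimage/= in_itv/= andbT mul1r indicE.
  by case: (boolP (t \in _)) => [/set_mem//|_]; rewrite ltxx.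
by move=> h; rewrite mem_set.
Qed.

Lemma good_measurable : measurable good.
Proof. by apply: bigcup_measurable => n _; exact: good_at_measurable. Qed.

Lemma good_finite : (mu good < +oo)%E.
Proof.
apply: (@le_lt_trans _ _ (mu dom)); first by apply: le_outer_measure => t /good_dom.
by rewrite /= lebesgue_measure_itv /=; case: ifP => _; rewrite ltry.
Qed.

Lemma good_at_nondecreasing : nondecreasing_seq good_at.
Proof.
move=> n m nm; apply/subsetPset => t [ht lt]; split=> //.
have [//|gt] := lev_or m t.
have [eta h] := cell_inhabited (maxn (stage n) (stage m)) ht.
exfalso; apply: (gt eta); first by apply: cell_nonincreasing h; rewrite leq_maxr.
apply: (@le_trans _ _ n%:R); last by rewrite ler_nat.
by apply: lt; apply: cell_nonincreasing h; rewrite leq_maxl.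
Qed.

(** Off [C], parameters near [t] share its cell of a given generation. Their limits come from
    configurations in that cell, where [int1 f] is within [e] of its value at [T t], a closed
    condition. *)
Lemma T_continuous t : good t -> ~ C t -> T t' @[t' --> within good (nbhs t)] --> T t.
Proof.
move=> gt nC; apply: vague_cvg => f Cf; apply/cvgrPdist_le => e e0.
have PGt := ends_proper (good_dom gt).
have /cvgrPdist_le/(_ e e0)[k _ kf] := T_int1 gt Cf.
rewrite /within/=; apply: filterS (C_constant nC k) => t' tt' gt'.
have PG := ends_proper (good_dom gt').
apply: (@closed_cvg _ _ (ends t') PG (int1 f) [set r | `|int1 f (T t) - r| <= e] _ _ _ (T_int1 gt' Cf)).
  apply: (@closed_comp _ _ (fun r => `|int1 f (T t) - r|) [set r | r <= e]); last exact: closed_le.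
  by move=> r _; apply: cvg_norm; apply: cvgB; [exact: cvg_cst|exact: cvg_id].
by exists k => // eta; rewrite tt'; exact: kf.
Qed.

(** The preimage of an open set is relatively open in the good parameters off [C], countable on [C],
    and all or nothing on the bad parameters, where [T] is constant. *)
Lemma T_measurable : measurable_fun setT (T : R -> borel (signed_radon X R)).
Proof.
have mC (S : set R) : S `<=` C -> measurable S.
  move=> SC; apply: countable_measurable => [t|]; first exact: measurable_set1.
  exact: sub_countable (subset_card_le SC) C_countable.
have gen : @measurable _ (borel (signed_radon X R)) = <<s @open (signed_radon X R) >> by [].
apply: (@measurability _ _ _ (borel (signed_radon X R)) setT T _ gen) => _ [V oV <-].
rewrite setTI; pose W : set R := [set t | good t -> V (T t)]°.
have -> : T @^-1` V = ((good `\` C) `&` W) `|` (C `&` (good `&` T @^-1` V)) `|`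
    (~` good `&` [set t | V point]).
  apply/seteqP; split=> t /=.
    move=> Vt; have [gt|gt] := pselect (good t); last by right; split=> //; rewrite -(T_point gt).
    left; have [Ct|nCt] := pselect (C t); [by right|left; split=> //].
    exact: (T_continuous gt nCt (open_nbhs_nbhs (conj oV Vt))).
  move=> [[[[gt _] /interior_subset h]|[_ [_ //]]]|[gt Vp]]; first exact: h.
  by rewrite /preimage/= T_point.
apply: measurableU; first apply: measurableU.
- apply: measurableI; first by apply: measurableD; [exact: good_measurable|exact: mC].
  by apply: open_measurable; exact: open_interior.
- by apply: mC => t [].
- apply: measurableI; first by apply: measurableC; exact: good_measurable.
  have [Vp|nVp] := pselect (V point).
    by rewrite (_ : [set _ | _] = setT)//; apply/seteqP; split.
  by rewrite (_ : [set _ | _] = set0)//; apply/seteqP; split.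
Qed.

Lemma tree_measure : (forall t, point_configurations (T t)) ->
  exists nu : {measure set (borel (signed_radon X R)) -> \bar R},
  [/\ is_radon nu, nu (~` (@point_configurations X R)) = 0%E &
    forall F, vaguely_continuous F ->
      measurable_fun setT (F : borel (signed_radon X R) -> R) ->
      (forall eta, 0 <= F eta) ->
      (forall n, exists B, forall eta, bounded_height n eta -> F eta <= B) ->
      (l (fun eta => F eta * \1_(bounded_height n) eta))%:E @[n --> \oo] -->
      (\int[nu]_eta (F eta)%:E)%E].
Proof.
move=> TN; have [nu [nuE nu_int]] := restricted_pushforward good_measurable T_measurable.
exists nu; split.
- exact: (radon_pushforward good_measurable good_finite C_countable T_continuous T_measurable nuE).
- by rewrite nuE (_ : _ `&` _ = set0) ?measure0//; apply/seteqP; split=> // t [/(_ (TN t))].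
- move=> F Fc mF F0 FB; rewrite nu_int//.
  have mFT : measurable_fun setT (fun t => (F (T t))%:E).
    by apply/measurable_EFinP; exact: (measurableT_comp mF T_measurable).
  apply: (@cvg_trans _ ((\int[mu]_(t in good_at n) (F (T t))%:E)%E @[n --> \oo])).
    apply: near_eq_cvg; apply: nearW => n.
    have [|m1 i1] := level_integral (F := F) (n := n) Fc.
      by have [B hB] := FB n; exists B => eta h; rewrite ger0_norm//; exact: hB.
    have [B hB] := FB n.
    (* [T t] is only a limit of configurations of height at most [n], but the bound on [F] passes to
       it. It makes the integral over the level finite, so that [fine] loses nothing. *)
    have FTB t : good_at n t -> F (T t) <= B.
      move=> [ht lt]; have gt : good t by exists n.
      apply: (@closed_cvg _ _ (ends t) (ends_proper ht) F [set r | r <= B] _ _ _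
        (Fc _ _ (ends_proper ht) (T_int1 gt) (T_int2 gt))); first exact: closed_le.
      by exists (stage n) => // eta h; apply: hB; split; [exact: cell_sub h|exact: lt].
    rewrite -i1 /Rintegral.
    have -> : (\int[mu]_(t in dom) (F (T t) * \1_(lev n) t)%:E =
        \int[mu]_(t in good_at n) (F (T t))%:E)%E.
      rewrite [RHS]integral_mkcondr; apply: eq_integral => t _.
      by rewrite patchE indicE; case: (t \in _); rewrite ?mulr1 ?mulr0.
    rewrite fineK// ge0_fin_numE; last by apply: integral_ge0 => t _; rewrite lee_fin.
    apply: (@le_lt_trans _ _ (\int[mu]_(t in good_at n) (cst `|B|%:E t))%E).
      apply: ge0_le_integral => //.
      - exact: good_at_measurable.
      - by move=> t _; rewrite lee_fin.
      - exact: measurable_funTS.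
      - by move=> t gt; rewrite lee_fin (le_trans (FTB _ gt))// ler_norm.
    rewrite integral_cst; last exact: good_at_measurable.
    apply: lte_mul_pinfty => //.
    by apply: le_lt_trans good_finite; apply: le_outer_measure => t; exists n.
  apply: ge0_nondecreasing_set_cvg_integral.
  - exact: good_at_nondecreasing.
  - exact: good_at_measurable.
  - by move=> n; exact: measurable_funTS.
  - by move=> n t _; rewrite lee_fin.
Qed.

End parametrization.

(** The limit of the truncations is not claimed to be [l F]: a finitely additive [l] may keep mass
    above every height. Growth estimates will exclude this for the functions of interest. *)
Theorem riesz_markov : exists nu : {measure set (borel (signed_radon X R)) -> \bar R},
  [/\ is_radon nu, nu (~` (@point_configurations X R)) = 0%E &
    forall F, vaguely_continuous F ->
      measurable_fun setT (F : borel (signed_radon X R) -> R) ->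
      (forall eta, 0 <= F eta) ->
      (forall n, exists B, forall eta, bounded_height n eta -> F eta <= B) ->
      (l (fun eta => F eta * \1_(bounded_height n) eta))%:E @[n --> \oo] -->
      (\int[nu]_eta (F eta)%:E)%E].
Proof.
have /choice[sl slP] (eta : signed_radon X R) : exists x, finite_configurations eta ->
    slots_of eta x /\ forall n J i y, height eta <= n%:R -> (J + J * n <= i)%N ->
    x i = Some y -> ~ layer Gamma J y.
  have [fe|nfe] := pselect (finite_configurations eta); last by exists (fun=> None).
  by have [x xP] := finite_slots X_hausdorff X_second_countable Gamma_C0 Gamma_gt0 fe; exists x.
have sl_slots eta : finite_configurations eta -> slots_of eta (sl eta).
  by move=> /slP[].
have sl_adm eta n : finite_configurations eta -> height eta <= n%:R ->
    admissible Gamma n (sl eta).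
  move=> /slP[_ h] hn J i y Ji xy; rewrite leNgt; apply/negP => lt.
  by apply: (h n J i y hn Ji xy); exact: ltW.
have [U [oU cU bU]] := relatively_compact_base X_locally_compact X_second_countable.
have [C cC CP] := cell_locally_constant finite_configurations (decision Gamma sl U) l.
pose good := \bigcup_n [set t | `[0, (mass l finite_configurations)[%classic t /\
  lev (decision Gamma sl U) stage n t].
have goodP t : good t -> good_parameter Gamma sl U l t.
  by move=> [n _ [ht lt]]; split; [move: ht; rewrite /= in_itv|exists n].
have /choice[T TP] (t : R) : exists eta : signed_radon X R, point_configurations eta /\
    (if `[< good t >] then
      (forall f, Cc f -> int1 f eta' @[eta' --> ends Gamma sl U l t] --> int1 f eta) /\
      (forall f, Cc f -> int2 f eta' @[eta' --> ends Gamma sl U l t] --> int2 f eta)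
     else eta = point).
  case: asboolP => [gt|_]; last by exists point; split=> //; exact: point_zero.
  have [eta [h1 h2 h3]] := limit_configuration X_locally_compact X_hausdorff X_second_countable
    Gamma_C0 Gamma_gt0 sl_slots sl_adm oU cU bU l_linear (goodP _ gt).
  by exists eta.
apply: (@tree_measure (decision Gamma sl U) stage _ C T cC CP).
- by move=> n t; exact: level_or.
- by move=> t ht; apply: ends_proper => //; move: ht; rewrite /= in_itv.
- by move=> t gt; have [_] := TP t; rewrite ifF//; exact/asboolPn.
- by move=> t gt; have [_] := TP t; rewrite ifT; [case|exact/asboolP].
- by move=> t gt; have [_] := TP t; rewrite ifT; [case|exact/asboolP].
- by move=> t; have [] := TP t.
Qed.

End riesz_markov.

(** Integrals of nonnegative functions are suprema over simple functions below, so the comparison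
    also covers [int3 (tensor3 \1_K)], whose measurability in the configuration is not
    established. *)
Lemma ge0_le_integral_all d (T : measurableType d) (R : realType)
    (m : {measure set T -> \bar R}) (D : set T) (f g : T -> \bar R) :
  (forall x, D x -> (0 <= f x)%E) -> (forall x, D x -> (f x <= g x)%E) ->
  (\int[m]_(x in D) f x <= \int[m]_(x in D) g x)%E.
Proof.
move=> f0 fg; rewrite [leLHS]integral_mkcond [leRHS]integral_mkcond.
have fg' x : (0 <= (f \_ D) x <= (g \_ D) x)%E.
  by rewrite !patchE; case: ifP => [/set_mem Dx|_]; rewrite ?f0 ?fg ?lexx.
rewrite !ge0_integralTE; last 2 first.
- by move=> x; have /andP[h1 h2] := fg' x; exact: le_trans h2.
- by move=> x; have /andP[] := fg' x.
apply: le_ereal_sup => _ [h hf <-]; exists h => // x.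
by apply: le_trans (hf x) _; have /andP[] := fg' x.
Qed.

(** * From the cubic condition to a representing measure *)

Section growth.
Context (R : realType) (X : ptopologicalType).
Hypothesis X_locally_compact : locally_compact [set: X].
Hypothesis X_hausdorff : hausdorff_space X.
Hypothesis X_second_countable : @second_countable X.
Context (Gamma : X -> R).
Hypothesis Gamma_C0 : C0 Gamma.
Hypothesis Gamma_gt0 : forall y, 0 < Gamma y.
Notation finite_configurations := (@finite_configurations R X Gamma).
Notation height := (@height R X Gamma).
Implicit Types (eta : signed_radon X R).

Let Gamma_continuous : continuous Gamma. Proof. by case: Gamma_C0. Qed.

Let height_ge0 eta : 0 <= height eta. Proof. exact: height_ge0. Qed.

Lemma finite_locally_finite eta : finite_configurations eta ->
  exists x, slots_of eta x /\ locally_finite x.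
Proof.
move=> fe; have [x [ex h]] := finite_slots X_hausdorff X_second_countable Gamma_C0 Gamma_gt0 fe.
exists x; split=> //; apply: (admissible_locally_finite Gamma_C0 Gamma_gt0 (n := Num.bound (height eta))).
move=> J i y Ji xy; rewrite leNgt; apply/negP => lt.
apply: (h _ J i y _ Ji xy); last exact: ltW.
by apply: ltW; apply: archi_boundP.
Qed.

(** Since Gamma is continuous and positive, [f / Gamma] is again compactly supported, hence bounded
    by some [c]; summing [|f| <= c * Gamma] over the slots gives the height. *)
Lemma int1_growth f : Cc f -> exists2 c, 0 <= c &
  forall eta, finite_configurations eta -> `|int1 f eta| <= c * height eta.
Proof.
move=> Cf; have [cf [K cK fK]] := (CcP X_hausdorff _).1 Cf.
have Cg : Cc (fun y => f y / Gamma y).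
  apply/(CcP X_hausdorff); split; last by exists K => // y /fK ->; rewrite mul0r.
  by move=> y; apply: cvgM; [exact: cf|apply: cvgV; [rewrite gt_eqF|exact: Gamma_continuous]].
have [c c0 gc] := Cc_bounded X_hausdorff Cg.
exists c => // eta fe; have [x [ex lx]] := finite_locally_finite fe.
have [N xK] := lx K cK.
rewrite (slots_int1 X_hausdorff ex Cf cK xK fK); apply: (le_trans (ler_norm_sum _ _ _)).
apply: (@le_trans _ _ (c * \sum_(i < N) oapp Gamma 0 (x i))).
  rewrite mulr_sumr; apply: ler_sum => i _; case: (x i) => [y|]/=; last by rewrite normr0 mulr0.
  have := gc y; rewrite normrM normfV (gtr0_norm (Gamma_gt0 y)).
  by rewrite ler_pdivrMr.
by rewrite ler_wpM2l//; apply: slots_height.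
Qed.

Lemma int2_growth f : Cc f -> exists2 c, 0 <= c &
  forall eta, finite_configurations eta -> `|int2 f eta| <= c * height eta ^+ 2.
Proof.
move=> Cf; have hX := hausdorff_prod X_hausdorff; have [cf [K cK fK]] := (CcP hX _).1 Cf.
have Cg : Cc (fun z => f z / (Gamma z.1 * Gamma z.2)).
  apply/(CcP hX); split; last by exists K => // y /fK ->; rewrite mul0r.
  move=> z; apply: cvgM; first exact: cf.
  apply: cvgV; first by rewrite mulf_neq0// gt_eqF.
  apply: (@cvgM _ _ (nbhs z) _ (Gamma \o fst) (Gamma \o snd)).
    by apply: continuous_comp; [exact: cvg_fst|exact: Gamma_continuous].
  by apply: continuous_comp; [exact: cvg_snd|exact: Gamma_continuous].
have [c c0 gc] := Cc_bounded hX Cg.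
have [K' cK' fK'] := slots_int2 X_locally_compact X_hausdorff X_second_countable Cf.
exists c => // eta fe; have [x [ex lx]] := finite_locally_finite fe.
have [N xK] := lx K' cK'.
rewrite (fK' _ _ _ ex xK); apply: (le_trans (ler_norm_sum _ _ _)).
set S := \sum_(i < N) oapp Gamma 0 (x i).
have Sh : S <= height eta by exact: slots_height.
have S0 : 0 <= S by apply: sumr_ge0 => i _; case: (x i) => //= y; exact: ltW.
apply: (@le_trans _ _ (c * S ^+ 2)); last by rewrite ler_wpM2l// lerXn2r// nnegrE.
rewrite expr2 {1}/S mulr_suml mulr_sumr; apply: ler_sum => i _.
apply: (le_trans (ler_norm_sum _ _ _)).
rewrite /S mulr_sumr mulr_sumr; apply: ler_sum => j _.
case: (x i) => [y|]/=; last by rewrite normr0 mul0r mulr0.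
case: (x j) => [z|]/=; last by rewrite normr0 !mulr0.
have G0 : 0 < Gamma y * Gamma z by exact: mulr_gt0.
have := gc (y, z); rewrite normrM normfV (gtr0_norm G0).
by rewrite ler_pdivrMr.
Qed.

Lemma quadratic_growth f0 f1 f2 : Cc f1 -> Cc f2 -> exists2 c, 0 <= c &
  forall eta, finite_configurations eta ->
  `|quadratic f0 f1 f2 eta| <= c * (1 + height eta ^+ 2).
Proof.
move=> /int1_growth[c1 c10 h1] /int2_growth[c2 c20 h2].
exists (`|f0| + c1 + c2); first by rewrite !addr_ge0.
move=> eta fe; have := h1 _ fe; have := h2 _ fe; have := height_ge0 eta.
have := normr_ge0 f0; rewrite /quadratic.
have : `|f0 + int1 f1 eta + int2 f2 eta| <= `|f0| + `|int1 f1 eta| + `|int2 f2 eta|.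
  by apply: (le_trans (ler_normD _ _)); rewrite lerD2r ler_normD.
move: (`|_ + _ + _|) (`|int1 f1 eta|) (`|int2 f2 eta|) (height eta) (`|f0|) => a b d h e.
move=> abd e0 hh d2 b1.
have l1 : c1 * h <= c1 * (1 + h ^+ 2) by rewrite ler_wpM2l//; nra.
have l2 : 0 <= e * h ^+ 2 by rewrite mulr_ge0// sqr_ge0.
rewrite (_ : _ * _ = e + e * h ^+ 2 + c1 * (1 + h ^+ 2) + c2 + c2 * h ^+ 2); last by ring.
lra.
Qed.

End growth.

(** * Dominated extension to functionals of cubic growth *)

Section cubic_extension.
Context (R : realType) (X : ptopologicalType).
Hypothesis X_locally_compact : locally_compact [set: X].
Hypothesis X_hausdorff : hausdorff_space X.
Hypothesis X_second_countable : @second_countable X.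
Context (L : (signed_radon X R -> R) -> R).
Hypothesis L_linear : linear_on_P2 L.
Context (r : R) (Gamma : X -> R).
Hypothesis r_gt0 : 0 < r.
Hypothesis Gamma_C0 : C0 Gamma.
Hypothesis Gamma_gt0 : forall y, 0 < Gamma y.
Hypothesis L_cubic : forall (f0 f3 : R) (f1 : X -> R) (f2 : X * X -> R),
  Cc f1 -> Cc f2 ->
  (forall eta, point_configurations eta ->
     (0 <= restricted_cubic Gamma f0 f1 f2 f3 eta)%E) ->
  0 <= L (quadratic f0 f1 f2) + f3 * r.
Notation finite_configurations := (@finite_configurations R X Gamma).
Notation height := (@height R X Gamma).
Implicit Types (eta : signed_radon X R) (f g : signed_radon X R -> R).

Let height_ge0 eta : 0 <= height eta. Proof. exact: height_ge0. Qed.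

Let hX2 := hausdorff_prod X_hausdorff.

Lemma int3_total eta : int3 (tensor3 Gamma) eta =
  (total_weight Gamma eta * total_weight Gamma eta * total_weight Gamma eta)%E.
Proof.
apply: int3_tensor3 => //; last by move=> y; exact: ltW.
by apply: continuous_borel; case: Gamma_C0.
Qed.

(** For [c > 0] infinite heights satisfy the inequality for free, so it has to be checked on
    [finite_configurations] only. For [c = 0] the product with +oo would be 0; there [c] is replaced
    by [e / r], at the cost of an arbitrary [e]. *)
Lemma L_majorant (f0 : R) (f1 : X -> R) (f2 : X * X -> R) c : Cc f1 -> Cc f2 -> 0 <= c ->
  (forall eta, finite_configurations eta -> 0 <= quadratic f0 f1 f2 eta + c * height eta ^+ 3) ->
  0 <= L (quadratic f0 f1 f2) + c * r.
Proof.
move=> Cf1 Cf2; have pos d : 0 < d ->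
    (forall eta, finite_configurations eta -> 0 <= quadratic f0 f1 f2 eta + d * height eta ^+ 3) ->
    0 <= L (quadratic f0 f1 f2) + d * r.
  move=> d0 h; apply: L_cubic => // eta eN; rewrite /restricted_cubic int3_total.
  have [too|] := ltP (total_weight Gamma eta) +oo%E; last first.
    by rewrite leye_eq => /eqP ->; rewrite !mulyy gt0_muley// ?addey// lte_fin.
  have fe : finite_configurations eta by [].
  rewrite heightE// -!EFinM -EFinD lee_fin.
  by have := h _ fe; rewrite !exprS expr0 mulr1 !mulrA.
rewrite le_eqVlt => /predU1P[<- h|]; last exact: pos.
rewrite mul0r addr0; apply/ler_addgt0Pr => e e0.
rewrite -[e](@divfK _ r) ?gt_eqF//; apply: pos; first exact: divr_gt0.
move=> eta /h; rewrite mul0r addr0 => /le_trans; apply; rewrite lerDl.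
by rewrite mulr_ge0 ?exprn_ge0// ltW// divr_gt0.
Qed.

Definition majorants f : set R := [set v | exists (f0 : R) (f1 : X -> R) (f2 : X * X -> R) (c : R),
  [/\ Cc f1, Cc f2, 0 <= c, v = L (quadratic f0 f1 f2) + c * r &
   forall eta, finite_configurations eta ->
     f eta <= quadratic f0 f1 f2 eta + c * height eta ^+ 3]].

(** [R^o] turns the functions into a module over [R], as Hahn-Banach demands. *)
Definition cubic_growth : set (signed_radon X R -> R^o) :=
  [set f | exists c : R, forall eta, finite_configurations eta ->
     `|f eta : R| <= c * (1 + height eta ^+ 3)].

Lemma P2_quadratic (f0 : R) (f1 : X -> R) (f2 : X * X -> R) : Cc f1 -> Cc f2 -> P2 (@quadratic X R f0 f1 f2).
Proof. by move=> ? ?; exists f0, f1, f2. Qed.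

Lemma L_quadraticZD a (f0 g0 : R) (f1 g1 : X -> R) (f2 g2 : X * X -> R) : Cc f1 -> Cc g1 -> Cc f2 -> Cc g2 ->
  L (quadratic (a * f0 + g0) (fun x => a * f1 x + g1 x) (fun z => a * f2 z + g2 z)) =
  a * L (quadratic f0 f1 f2) + L (quadratic g0 g1 g2).
Proof.
by move=> *; rewrite -quadraticZD// L_linear//; exact: P2_quadratic.
Qed.

Lemma quadratic_const a eta : quadratic a (fun=> 0) (fun=> 0) eta = a.
Proof.
rewrite /quadratic; have C1 := @Cc0 R _ X_hausdorff; have C2 := @Cc0 R _ hX2.
have := int1ZD X_hausdorff (-1) eta C1 C1.
have := int2ZD X_locally_compact X_hausdorff X_second_countable (-1) eta C2 C2.
rewrite (_ : (fun=> _ * _ + _) = (fun=> 0)); last by apply/funext => z; ring.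
rewrite [X in int1 X](_ : _ = (fun=> 0)); last by apply/funext => z; ring.
by move=> -> ->; ring.
Qed.

Lemma L_quadratic0 : L (quadratic 0 (fun=> 0) (fun=> 0)) = 0.
Proof.
have Z1 := @Cc0 R _ X_hausdorff; have Z2 := @Cc0 R _ hX2.
have := L_quadraticZD (-1) 0 0 Z1 Z1 Z2 Z2.
rewrite (_ : quadratic _ _ _ = quadratic 0 (fun=> 0) (fun=> 0)); first by lra.
by congr quadratic; [ring|apply/funext => z; ring..].
Qed.

Lemma majorants0 f : cubic_growth f -> majorants f !=set0.
Proof.
move=> [c fc]; exists (L (quadratic `|c| (fun=> 0) (fun=> 0)) + `|c| * r).
exists `|c|, (fun=> 0), (fun=> 0), `|c|; split=> //; try exact: Cc0.
move=> eta fe; rewrite quadratic_const; apply: le_trans (ler_norm _) _.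
apply: (le_trans (fc _ fe)).
rewrite -[X in _ <= X + _]mulr1 -mulrDr ler_wpM2r ?ler_norm// addr_ge0// exprn_ge0//.
Qed.

(** Adding the majorant to [|c| * (1 + h^3)] gives something nonnegative on finite configurations,
    to which [L_majorant] applies. Thus the infimum is a genuine one. *)
Lemma majorants_ge f c v : (forall eta, finite_configurations eta ->
    `|f eta| <= c * (1 + height eta ^+ 3)) -> majorants f v ->
  - (L (quadratic `|c| (fun=> 0) (fun=> 0)) + `|c| * r) <= v.
Proof.
move=> fc [f0 [f1 [f2 [d [C1 C2 d0 -> h]]]]].
have Z1 := @Cc0 R _ X_hausdorff; have Z2 := @Cc0 R _ hX2.
have := @L_majorant (1 * `|c| + f0) (fun x => 1 * 0 + f1 x) (fun z => 1 * 0 + f2 z) (`|c| + d).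
rewrite L_quadraticZD// => H.
suff : 0 <= 1 * L (quadratic `|c| (fun=> 0) (fun=> 0)) + L (quadratic f0 f1 f2) + (`|c| + d) * r.
  by lra.
apply: H; rewrite ?addr_ge0//; try exact: CcZD.
move=> eta fe; rewrite -quadraticZD// quadratic_const.
have := h _ fe; have := fc _ fe; rewrite ler_norml => /andP[h1 _] h2.
have := le_trans h1 h2; have : c * (1 + height eta ^+ 3) <= `|c| * (1 + height eta ^+ 3).
  by rewrite ler_wpM2r ?ler_norm// addr_ge0// exprn_ge0.
by lra.
Qed.

Let p f := inf (majorants f).

Lemma majorants_inf f v : cubic_growth f -> majorants f v -> p f <= v.
Proof.
move=> [c fc] fv; apply: ge_inf => //.
by exists (- (L (quadratic `|c| (fun=> 0) (fun=> 0)) + `|c| * r)) => w; exact: majorants_ge.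
Qed.

Lemma cubic_growth0 : cubic_growth 0.
Proof. by exists 0 => eta _; rewrite normr0 mul0r. Qed.

Lemma cubic_growthZD a f g : cubic_growth f -> cubic_growth g ->
  cubic_growth (a *: (f : signed_radon X R -> R^o) + g).
Proof.
move=> [c fc] [d gd]; exists (`|a| * c + d) => eta fe; apply: (le_trans (ler_normD _ _)).
by rewrite mulrDl lerD// ?gd// normrM -mulrA ler_wpM2l// fc.
Qed.

Lemma majorantsD f g v w : majorants f v -> majorants g w ->
  majorants (fun eta => f eta + g eta) (v + w).
Proof.
move=> [f0 [f1 [f2 [c [C1 C2 c0 -> fc]]]]] [g0 [g1 [g2 [d [D1 D2 d0 -> gd]]]]].
exists (1 * f0 + g0), (fun x => 1 * f1 x + g1 x), (fun z => 1 * f2 z + g2 z), (c + d).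
split; try exact: CcZD.
- exact: addr_ge0.
- by rewrite L_quadraticZD//; ring.
- by move=> eta fe; rewrite -quadraticZD//; have := fc _ fe; have := gd _ fe; lra.
Qed.

Lemma majorantsZ a f v : 0 <= a -> majorants f v ->
  majorants (fun eta => a * f eta) (a * v).
Proof.
move=> a0 [f0 [f1 [f2 [c [C1 C2 c0 -> fc]]]]].
have Z1 := @Cc0 R _ X_hausdorff; have Z2 := @Cc0 R _ hX2.
have q0 := L_quadratic0.
exists (a * f0 + 0), (fun x => a * f1 x + 0), (fun z => a * f2 z + 0), (a * c).
split; try exact: CcZD.
- exact: mulr_ge0.
- by rewrite L_quadraticZD// q0; ring.
- move=> eta fe; rewrite -quadraticZD// quadratic_const addr0 -mulrA -mulrDr.
  by rewrite ler_wpM2l// fc.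
Qed.

(** Each property is read off a majorant: 0 for nonpositive functions, a quadratic polynomial and
    its opposite for agreement with [L], and [c = 1] with zero polynomial for the bound [r]. *)
Lemma cubic_extension : exists l : (signed_radon X R -> R) -> R,
  [/\ forall a f g, cubic_growth f -> cubic_growth g ->
        l (fun eta => a * f eta + g eta) = a * l f + l g,
      forall f g, cubic_growth f -> cubic_growth g ->
        (forall eta, finite_configurations eta -> f eta <= g eta) -> l f <= l g,
      forall b, P2 b -> l b = L b & l (fun eta => height eta ^+ 3) <= r].
Proof.
have Z1 := @Cc0 R _ X_hausdorff; have Z2 := @Cc0 R _ hX2.
have [|l [lZD lp]] := @hahn_banach_sublinear R (signed_radon X R -> R^o) cubic_growth p
    cubic_growth0 cubic_growthZD.
  have le1 a f : 0 < a -> cubic_growth f ->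
      p (a *: (f : signed_radon X R -> R^o)) <= a * p f.
    move=> a0 Ef; rewrite -ler_pdivrMl//; apply: lb_le_inf; first exact: majorants0.
    move=> v fv; rewrite ler_pdivrMl//; apply: majorants_inf; last exact: (majorantsZ (ltW a0)).
    have := cubic_growthZD a Ef cubic_growth0; by rewrite addr0.
  split=> [f g Ef Eg|a f a0 Ef].
    rewrite -lerBlDl; apply: lb_le_inf; first exact: majorants0.
    move=> w gw; rewrite lerBlDl -lerBlDr; apply: lb_le_inf; first exact: majorants0.
    move=> v fv; rewrite lerBlDr; apply: majorants_inf; last exact: majorantsD.
    have := cubic_growthZD 1 Ef Eg; by rewrite scale1r.
  apply/eqP; rewrite eq_le le1//= -ler_pdivlMl//.
  have := le1 a^-1 (a *: (f : signed_radon X R -> R^o)).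
  rewrite invr_gt0 scalerA mulVf ?gt_eqF// scale1r; apply=> //.
  have := cubic_growthZD a Ef cubic_growth0; by rewrite addr0.
have lneg f : cubic_growth f -> (forall eta, finite_configurations eta -> f eta <= 0) -> l f <= 0.
  move=> Ef f0; apply: (le_trans (lp _ Ef)); apply: majorants_inf => //.
  exists 0, (fun=> 0), (fun=> 0), 0; split=> //; first by rewrite L_quadratic0 mul0r addr0.
  by move=> eta fe; rewrite quadratic_const mul0r addr0 f0.
have qgrow (f0 : R) (f1 : X -> R) (f2 : X * X -> R) : Cc f1 -> Cc f2 ->
    cubic_growth (quadratic f0 f1 f2).
  move=> C1 C2; have [c c0 hc] := quadratic_growth X_locally_compact X_hausdorff
    X_second_countable Gamma_C0 Gamma_gt0 f0 C1 C2.
  exists (2 * c) => eta fe; apply: (le_trans (hc _ fe)).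
  rewrite mulrAC mulrC ler_wpM2r//; have := height_ge0 eta; move: (height eta) => h h0.
  have : 0 <= h * (h - 1) ^+ 2 by rewrite mulr_ge0// sqr_ge0.
  have : 0 <= (h - 1) ^+ 2 by rewrite sqr_ge0.
  by rewrite !exprS !expr0; nra.
have lq (f0 : R) (f1 : X -> R) (f2 : X * X -> R) : Cc f1 -> Cc f2 ->
    l (quadratic f0 f1 f2) <= L (quadratic f0 f1 f2).
  move=> C1 C2; apply: le_trans (lp _ _) _; first exact: qgrow.
  apply: majorants_inf; first exact: qgrow.
  exists f0, f1, f2, 0; split=> //; first by rewrite mul0r addr0.
  by move=> eta fe; rewrite mul0r addr0.
exists l; split=> //.
- move=> f g Ef Eg fg; have := lZD (-1) g f Eg Ef.
  have : l (-1 *: (g : signed_radon X R -> R^o) + f) <= 0.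
    apply: lneg; first exact: cubic_growthZD.
    move=> eta fe; rewrite (_ : (_ + _) eta = - 1 * g eta + f eta)// mulN1r.
    by rewrite addrC subr_le0 fg.
  by move=> h e; move: h; rewrite e; lra.
- move=> b [f0 [f1 [f2 [C1 C2 ->]]]]; apply/eqP; rewrite eq_le lq//=.
  have := lq (-1 * f0 + 0) _ _ (CcZD X_hausdorff (-1) C1 Z1) (CcZD hX2 (-1) C2 Z2).
  rewrite L_quadraticZD// L_quadratic0 -quadraticZD//.
  rewrite (_ : (fun eta => _) = -1 *: (quadratic f0 f1 f2 : signed_radon X R -> R^o) + 0).
    rewrite lZD//; [|exact: qgrow|exact: cubic_growth0].
    have := lZD (-1) 0 0 cubic_growth0 cubic_growth0; rewrite scaler0 addr0.
    by lra.
  by apply/funext => eta; rewrite quadratic_const.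
- have Eh : cubic_growth (fun eta => height eta ^+ 3).
    by exists 1 => eta fe; rewrite ger0_norm ?exprn_ge0// mul1r lerDr.
  apply: (le_trans (lp _ Eh)); apply: majorants_inf => //.
  exists 0, (fun=> 0), (fun=> 0), 1; split=> //; first by rewrite L_quadratic0 mul1r add0r.
  by move=> eta fe; rewrite quadratic_const mul1r add0r.
Qed.

End cubic_extension.

Lemma cvg_cube (R : realType) (T : Type) (F : set_system T) (u : T -> R) (a : R) :
  Filter F -> u x @[x --> F] --> a -> u x ^+ 3 @[x --> F] --> a ^+ 3.
Proof.
move=> FF ua; have e3 (z : R) : z ^+ 3 = z * (z * z) by rewrite !exprS expr0 mulr1.
by rewrite e3; under eq_fun do rewrite e3; apply: cvgM => //; apply: cvgM.
Qed.

(** * Third moments of a single configuration *)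

Section configurations.
Context (R : realType) (X : ptopologicalType).
Hypothesis X_locally_compact : locally_compact [set: X].
Hypothesis X_hausdorff : hausdorff_space X.
Hypothesis X_second_countable : @second_countable X.
Implicit Types eta : signed_radon X R.

Lemma configuration_int1 eta f : point_configurations eta -> Cc f ->
  (\int[pos eta]_y (f y)%:E = (int1 f eta)%:E)%E.
Proof.
move=> eN Cf; rewrite /int1 [X in _ = (_ - X)%:E](_ : _ = 0).
  rewrite subr0 /Rintegral fineK//.
  apply: integrable_fin_num => //.
  exact: (Cc_integrable X_hausdorff (pos_radon eta) Cf).
rewrite /Rintegral (@eq_measure_integral _ _ _ _ mzero); last by move=> A mA _; have [] := eN _ mA.
by rewrite integral_measure_zero.
Qed.

Lemma int3_ge0 eta (g : X -> R) : measurable_fun setT (g : borel X -> R) ->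
  (forall y, 0 <= g y) -> (0 <= int3 (tensor3 g) eta)%E.
Proof.
move=> mg g0; rewrite (int3_tensor3 X_locally_compact X_hausdorff X_second_countable)//.
have I0 : (0 <= \int[pos eta]_y (g y)%:E)%E by apply: integral_ge0 => y _; rewrite lee_fin.
by apply: mule_ge0 => //; apply: mule_ge0.
Qed.

Lemma indicator_moment eta (K : set X) f : point_configurations eta -> compact K -> Cc f ->
  (forall y, \1_K y <= f y) ->
  (int3 (tensor3 \1_K) eta <= (int1 f eta ^+ 3)%:E)%E.
Proof.
move=> eN cK Cf Kf; have mK := compact_borel X_hausdorff cK.
rewrite (int3_tensor3 X_locally_compact X_hausdorff X_second_countable eta)//.
have le : (\int[pos eta]_y (\1_K y)%:E <= (int1 f eta)%:E)%E.
  rewrite -configuration_int1//; apply: ge0_le_integral_all => y _; first by rewrite lee_fin.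
  by rewrite lee_fin.
have I0 : (0 <= \int[pos eta]_y (\1_K y)%:E :> \bar R)%E.
  by apply: integral_ge0 => y _; rewrite lee_fin.
rewrite !exprS expr0 mulr1 mulrA !EFinM.
by apply: lee_pmul => //; [exact: mule_ge0|exact: lee_pmul].
Qed.

Lemma moment_indicator eta (K : set X) f : point_configurations eta -> compact K -> Cc f ->
  (forall y, 0 <= f y <= \1_K y) ->
  ((int1 f eta ^+ 3)%:E <= int3 (tensor3 \1_K) eta)%E.
Proof.
move=> eN cK Cf fK; have mK := compact_borel X_hausdorff cK.
rewrite (int3_tensor3 X_locally_compact X_hausdorff X_second_countable eta)//.
have le : ((int1 f eta)%:E <= \int[pos eta]_y (\1_K y)%:E)%E.
  rewrite -configuration_int1//; apply: ge0_le_integral_all => y _.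
    by have /andP[] := fK y; rewrite lee_fin.
  by have /andP[] := fK y; rewrite lee_fin.
have I0 : (0 <= (int1 f eta)%:E)%E.
  rewrite -configuration_int1//; apply: integral_ge0 => y _.
  by have /andP[] := fK y; rewrite lee_fin.
rewrite !exprS expr0 mulr1 mulrA !EFinM.
by apply: lee_pmul => //; [exact: mule_ge0|exact: lee_pmul].
Qed.

Lemma configurations_borel :
  measurable (@point_configurations X R : set (borel (signed_radon X R))).
Proof.
apply: closed_borel; exact: point_configurations_closed.
Qed.

End configurations.

(** * The representing measure and its third moment *)

Section representation.
Context (R : realType) (X : ptopologicalType).
Hypothesis X_locally_compact : locally_compact [set: X].
Hypothesis X_hausdorff : hausdorff_space X.
Hypothesis X_second_countable : @second_countable X.
Context (L : (signed_radon X R -> R) -> R).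
Hypothesis L_linear : linear_on_P2 L.
Context (r : R) (Gamma : X -> R).
Hypothesis r_gt0 : 0 < r.
Hypothesis Gamma_C0 : C0 Gamma.
Hypothesis Gamma_gt0 : forall y, 0 < Gamma y.
Notation finite_configurations := (@finite_configurations R X Gamma).
Notation height := (@height R X Gamma).
Notation bounded_height := (@bounded_height R X Gamma).
Implicit Types (eta : signed_radon X R) (f g : signed_radon X R -> R).
Notation cubic_growth := (cubic_growth Gamma).

Let height_ge0 eta : 0 <= height eta. Proof. exact: height_ge0. Qed.

Section truncation.
Context (l : (signed_radon X R -> R) -> R).
Hypothesis l_linear : forall a f g, cubic_growth f -> cubic_growth g ->
  l (fun eta => a * f eta + g eta) = a * l f + l g.
Hypothesis l_mono : forall f g, cubic_growth f -> cubic_growth g ->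
  (forall eta, finite_configurations eta -> f eta <= g eta) -> l f <= l g.
Hypothesis l_cube : l (fun eta => height eta ^+ 3) <= r.

Lemma cubic_growth_cube : cubic_growth (fun eta => height eta ^+ 3).
Proof. by exists 1 => eta fe; rewrite ger0_norm ?exprn_ge0// mul1r lerDr. Qed.

Lemma cubic_growth_trunc f n : cubic_growth f ->
  cubic_growth (fun eta => f eta * \1_(bounded_height n) eta).
Proof.
move=> [c fc]; exists c => eta fe; apply: le_trans (fc _ fe).
by rewrite normrM ler_piMr// indicE ger0_norm// lern1 leq_b1.
Qed.

(** The spare power of the height pays for the tail: above height [n >= 1], [C * (1 + h^2) <= 2 C
    h^2 <= (2 C / n) h^3], and [l] of the cube is at most [r]. *)
Lemma l_cvg F C : (forall eta, 0 <= F eta) -> 0 <= C ->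
  (forall eta, finite_configurations eta -> F eta <= C * (1 + height eta ^+ 2)) ->
  cubic_growth F /\ l (fun eta => F eta * \1_(bounded_height n) eta) @[n --> \oo] --> l F.
Proof.
move=> F0 C0 FC.
have EF : cubic_growth F.
  exists (2 * C) => eta fe; rewrite ger0_norm//; apply: (le_trans (FC _ fe)).
  rewrite mulrAC mulrC ler_wpM2r//; have := height_ge0 eta; move: (height eta) => h h0.
  have : 0 <= h * (h - 1) ^+ 2 by rewrite mulr_ge0// sqr_ge0.
  have : 0 <= (h - 1) ^+ 2 by rewrite sqr_ge0.
  by rewrite !exprS !expr0; nra.
split=> //; apply/cvgrPdist_le => e e0.
near=> n.
have n0 : (0 < n)%N by near: n; exists 1%N.
have nR : 1 <= n%:R :> R by rewrite ler1n.
have nR0 : 0 < n%:R :> R by exact: lt_le_trans nR.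
pose g eta := -1 * (F eta * \1_(bounded_height n) eta) + F eta.
have Et := cubic_growth_trunc n EF.
have Eg : cubic_growth g by exact: (cubic_growthZD (-1) Et EF).
have lg : l g = l F - l (fun eta => F eta * \1_(bounded_height n) eta).
  by rewrite l_linear//; ring.
have g0 eta : 0 <= g eta.
  rewrite /g indicE; case: (eta \in _); rewrite ?mulr1 ?mulr0; first by rewrite mulN1r addNr.
  by rewrite add0r.
have E0 : cubic_growth (fun=> 0) by exact: cubic_growth0.
have l0 : l (fun=> 0) = 0.
  have := l_linear (-1) E0 E0; rewrite (_ : (fun=> _ * _ + _) = (fun=> 0)).
    by lra.
  by apply/funext => eta; ring.
have lg0 : 0 <= l g by rewrite -l0; apply: l_mono.
rewrite -lg ger0_norm//.
pose a := 2 * C / n%:R.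
have a0 : 0 <= a by rewrite /a divr_ge0// mulr_ge0.
have Ea : cubic_growth (fun eta => a * height eta ^+ 3 + 0).
  exact: (cubic_growthZD a cubic_growth_cube E0).
apply: (@le_trans _ _ (l (fun eta => a * height eta ^+ 3 + 0))).
  apply: l_mono => // eta fe; rewrite /g indicE addr0.
  case: (boolP (eta \in _)) => [_|]; first by rewrite mulr1 mulN1r addNr mulr_ge0// exprn_ge0.
  rewrite notin_setE => nb; rewrite mulr0 mulr0 add0r; apply: (le_trans (FC _ fe)).
  have hn : n%:R < height eta by rewrite ltNge; apply/negP => le; apply: nb.
  rewrite /a mulrAC ler_pdivlMr//.
  have h1 : 1 <= height eta by rewrite (le_trans nR)// ltW.
  rewrite (mulrC 2 C) -!mulrA ler_wpM2l//.
  move: (height eta) h1 hn => h h1 hn.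
  have h2 : 1 <= h ^+ 2 by rewrite expr_ge1// (le_trans _ h1).
  apply: (@le_trans _ _ (2 * h ^+ 2 * n%:R)).
    by rewrite ler_wpM2r//; lra.
  rewrite -mulrA ler_wpM2l// [leRHS](exprSr h 2).
  by apply: ler_wpM2l; [exact: sqr_ge0|exact: ltW].
rewrite l_linear//; last exact: cubic_growth_cube.
rewrite l0 addr0; apply: (@le_trans _ _ (a * r)); first by rewrite ler_wpM2l.
rewrite /a mulrAC ler_pdivrMr// -ler_pdivrMl// ltW//.
by near: n; exact: nbhs_infty_gtr.
Unshelve. all: by end_near. Qed.

End truncation.

Lemma quadratic_vague (f0 : R) (f1 : X -> R) (f2 : X * X -> R) : Cc f1 -> Cc f2 ->
  vaguely_continuous (quadratic f0 f1 f2 : signed_radon X R -> R).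
Proof.
move=> C1 C2 G eta PG h1 h2; apply: cvgD; last exact: h2.
by apply: cvgD; [exact: cvg_cst|exact: h1].
Qed.


Hypothesis L_cubic : forall (f0 f3 : R) (f1 : X -> R) (f2 : X * X -> R),
  Cc f1 -> Cc f2 ->
  (forall eta, point_configurations eta ->
     (0 <= restricted_cubic Gamma f0 f1 f2 f3 eta)%E) ->
  0 <= L (quadratic f0 f1 f2) + f3 * r.

Theorem cubic_representing : exists nu : {measure set (borel (signed_radon X R)) -> \bar R},
  representing L nu /\ finite_local_third_moment nu.
Proof.
have [l [l_linear l_mono lL l_cube]] := cubic_extension X_locally_compact X_hausdorff
  X_second_countable L_linear r_gt0 Gamma_C0 Gamma_gt0 L_cubic.
have Eb f : (exists B, forall eta, `|f eta| <= B) -> cubic_growth f.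
  move=> [B fB]; have B0 : 0 <= B by apply: le_trans (fB point).
  by exists B => eta _; apply: (le_trans (fB eta)); rewrite ler_peMr// lerDl exprn_ge0.
have [nu [nu_radon nuN nu_int]] := riesz_markov X_locally_compact X_hausdorff
  X_second_countable Gamma_C0 Gamma_gt0
  (fun a f g bf bg => l_linear a f g (Eb f bf) (Eb g bg))
  (fun f g bf bg => l_mono f g (Eb f bf) (Eb g bg)).
have mN := configurations_borel X_locally_compact X_hausdorff X_second_countable (R := R).
have bound (F : signed_radon X R -> R) (C : R) k : 0 <= C ->
    (forall eta, finite_configurations eta -> F eta <= C * (1 + height eta ^+ k)) ->
    forall n, exists B, forall eta, bounded_height n eta -> F eta <= B.
  move=> C0 FC n; exists (C * (1 + n%:R ^+ k)) => eta [fe hn]; apply: (le_trans (FC _ fe)).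
  by rewrite ler_wpM2l// lerD2l lerXn2r// nnegrE.
have int_test (F : signed_radon X R -> R) (C : R) : vaguely_continuous F ->
    measurable_fun setT (F : borel (signed_radon X R) -> R) -> (forall eta, 0 <= F eta) ->
    0 <= C -> (forall eta, finite_configurations eta -> F eta <= C * (1 + height eta ^+ 2)) ->
    cubic_growth F /\ (\int[nu]_eta (F eta)%:E = (l F)%:E)%E.
  move=> Fc mF F0 C0 FC; have [EF lF] := l_cvg l_linear l_mono l_cube F0 C0 FC.
  split=> //; have h1 := nu_int F Fc mF F0 (bound F C 2 C0 FC).
  apply/esym; apply: (cvg_unique _ _ h1); first exact: ereal_hausdorff.
  by apply: cvg_EFin lF; exact: nearW.
exists nu; split; first split=> //.
- move=> b Pb; rewrite -(lL b Pb); have [f0 [f1 [f2 [C1 C2 bE]]]] := Pb; rewrite bE.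
  set F := quadratic f0 f1 f2.
  have Fc : vaguely_continuous F by exact: quadratic_vague.
  have mF : measurable_fun setT (F : borel (signed_radon X R) -> R).
    exact: quadratic_measurable.
  have [c c0 hc] := quadratic_growth X_locally_compact X_hausdorff
    X_second_countable Gamma_C0 Gamma_gt0 f0 C1 C2.
  have mA : measurable_fun setT ((fun eta => `|F eta|) : borel (signed_radon X R) -> R).
    exact: measurableT_comp.
  have Ac : vaguely_continuous (fun eta => `|F eta|).
    by move=> G eta PG h1 h2; apply: cvg_norm; exact: Fc.
  have [EA iA] := int_test (fun eta => `|F eta|) c Ac mA (fun=> normr_ge0 _) c0 hc.
  (* [int_test] handles nonnegative functions only, so [F] is written as the difference of its
     absolute value and [B]. *)
  pose B eta := `|F eta| - F eta.
  have [EB iB] : cubic_growth B /\ (\int[nu]_eta (B eta)%:E = (l B)%:E)%E.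
    apply: (int_test _ (2 * c)).
    - by move=> G eta PG h1 h2; apply: cvgB; [exact: Ac|exact: Fc].
    - exact: measurable_funB.
    - by move=> eta; rewrite subr_ge0 ler_norm.
    - exact: mulr_ge0.
    - move=> eta fe; have := hc eta fe; rewrite -/F /B.
      by have := ler_norm (- F eta); rewrite normrN -mulrA; lra.
  have iF : nu.-integrable setT (EFin \o F).
    apply/integrableP; split; first exact/measurable_EFinP.
    by rewrite (_ : (\int[nu]_eta _ = (l (fun eta => `|F eta|))%:E)%E) ?ltry.
  have iF' : nu.-integrable setT (EFin \o B).
    apply/integrableP; split; first by apply/measurable_EFinP; exact: measurable_funB.
    rewrite (_ : (\int[nu]_eta _ = (l B)%:E)%E) ?ltry// -iB.
    by apply: eq_integral => eta _; rewrite /= ger0_norm// subr_ge0 ler_norm.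
  have iA' : nu.-integrable setT (fun eta => (`|F eta|)%:E) by exact: integrable_abse iF.
  split=> //.
  have -> : (\int[nu]_(eta in @point_configurations X R) (F eta)%:E = \int[nu]_eta (F eta)%:E)%E.
    rewrite [RHS](@negligible_integral _ _ _ nu setT (~` @point_configurations X R))//.
      by rewrite setDE setTI setCK.
    exact: measurableC.
  have EF : cubic_growth F.
    by case: EA => C hC; exists C => eta fe; have := hC eta fe; rewrite normr_id.
  have -> : l F = l (fun eta => `|F eta|) - l B.
    have := l_linear (-1) B (fun eta => `|F eta|) EB EA.
    rewrite (_ : (fun eta => _) = F); last by apply/funext => eta; rewrite /B; ring.
    by move=> ->; ring.
  rewrite EFinB -iA -iB -integralB//.
  by apply: eq_integral => eta _; rewrite -EFinB /B; congr EFin; ring.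
- move=> K cK.
  have [phi [Cphi phi01 phiK _]] := bump_compact R X_locally_compact X_hausdorff cK openT (@subsetT _ K).
  have Kphi y : \1_K y <= phi y.
    rewrite indicE; case: (boolP (y \in K)) => [/set_mem/phiK ->//|_].
    by have /andP[] := phi01 y.
  have [c c0 hc] := int1_growth X_hausdorff X_second_countable
    Gamma_C0 Gamma_gt0 Cphi.
  (* Of cubic growth, so [l_cvg] is out of reach, but every truncation has [l]-value at most
     [c ^+ 3 * r], and so has the limit. The absolute value keeps [F] nonnegative on signed
     measures. *)
  pose F eta := `|int1 phi eta| ^+ 3.
  have F0 eta : 0 <= F eta by rewrite exprn_ge0.
  have FC eta : finite_configurations eta -> F eta <= c ^+ 3 * height eta ^+ 3.
    by move=> fe; rewrite /F -exprMn lerXn2r ?nnegrE ?mulr_ge0//; exact: hc.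
  have cF : continuous F.
    move=> eta; apply: (@cvg_cube _ _ (nbhs eta) (fun eta' => `|int1 phi eta'|)).
    have h : int1 phi x @[x --> nbhs eta] --> int1 phi eta by exact: int1_continuous.
    exact: (cvg_norm h).
  have mF : measurable_fun setT (F : borel (signed_radon X R) -> R) by exact: continuous_borel.
  have Fc : vaguely_continuous F.
    move=> G eta PG h1 h2; apply: (@cvg_cube _ _ G (fun eta' => `|int1 phi eta'|)).
    exact: (cvg_norm (h1 _ Cphi)).
  have FCn : forall eta, finite_configurations eta -> F eta <= c ^+ 3 * (1 + height eta ^+ 3).
    move=> eta fe; apply: (le_trans (FC _ fe)); rewrite ler_wpM2l ?exprn_ge0//.
    by rewrite lerDr.
  have h := nu_int F Fc mF F0 (bound F _ 3 (exprn_ge0 3 c0) FCn).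
  have EF : cubic_growth F.
    by exists (c ^+ 3) => eta fe; rewrite ger0_norm//; exact: FCn.
  have le : (\int[nu]_eta (F eta)%:E <= (c ^+ 3 * r)%:E)%E.
    rewrite -(cvg_lim _ h)//; apply: lime_le; first by apply/cvg_ex; eexists; exact: h.
    apply: nearW => n; rewrite lee_fin.
    have E0 : cubic_growth (fun=> 0) by exact: cubic_growth0.
    have l0 : l (fun=> 0) = 0.
      have := l_linear (-1) _ _ E0 E0; rewrite (_ : (fun=> _ * _ + _) = (fun=> 0)); first by lra.
      by apply/funext => eta; ring.
    have Ec := cubic_growth_cube.
    apply: (@le_trans _ _ (l (fun eta => c ^+ 3 * height eta ^+ 3 + 0))).
      apply: l_mono; [exact: cubic_growth_trunc|exact: (cubic_growthZD (c ^+ 3) Ec E0)|].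
      move=> eta fe; rewrite addr0; apply: le_trans (FC _ fe).
      by rewrite ler_piMr// indicE lern1 leq_b1.
    by rewrite l_linear// l0 addr0 ler_wpM2l// exprn_ge0.
  apply: (@le_lt_trans _ _ (\int[nu]_(eta in @point_configurations X R) (F eta)%:E)%E).
    apply: ge0_le_integral_all => eta eN.
      apply: (int3_ge0 X_locally_compact X_hausdorff X_second_countable) => //.
      exact: (measurable_indic (compact_borel X_hausdorff cK)).
    apply: (le_trans (indicator_moment X_locally_compact X_hausdorff X_second_countable eN cK Cphi Kphi)).
    by rewrite lee_fin /F -normrX ler_norm.
  apply: (@le_lt_trans _ _ (\int[nu]_eta (F eta)%:E)%E).
    apply: ge0_subset_integral => //; first exact/measurable_EFinP.
    by move=> eta _; rewrite lee_fin.
  exact: le_lt_trans le (ltry _).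
Qed.

End representation.

(** * From a representing measure to the cubic condition *)

(** The tangent of the cube at [S]: [s^3 - 3 S^2 s + 2 S^3 = (s - S)^2 (s + 2 S)] is nonnegative.
    Weights of total below 1 only help, because [S^3 >= 0]. *)
Lemma cube_jensen (R : realType) n (w s : nat -> R) : (forall k, 0 <= w k) ->
  (forall k, 0 <= s k) -> \sum_(k < n) w k <= 1 ->
  (\sum_(k < n) w k * s k) ^+ 3 <= \sum_(k < n) w k * s k ^+ 3.
Proof.
move=> w0 s0 w1; set S := \sum_(k < n) w k * s k.
have S0 : 0 <= S by apply: sumr_ge0 => k _; exact: mulr_ge0.
apply: (@le_trans _ _ (3 * S ^+ 2 * S - 2 * S ^+ 3 * \sum_(k < n) w k)).
  have : S ^+ 3 * \sum_(k < n) w k <= S ^+ 3 * 1 by rewrite ler_wpM2l// exprn_ge0.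
  by move: (\sum_(k < n) w k) => W; rewrite !exprS expr0 => h; nra.
rewrite {2}/S !mulr_sumr -sumrB; apply: ler_sum => k _.
have : 0 <= (s k - S) ^+ 2 * (s k + 2 * S).
  by rewrite mulr_ge0 ?sqr_ge0// addr_ge0// mulr_ge0.
move=> /(mulr_ge0 (w0 k)); rewrite -subr_ge0; congr (0 <= _); ring.
Qed.

Lemma cubic_leading_ge0 (R : realType) (a b c d : R) :
  (forall k : nat, 0 <= a + k%:R * b + k%:R ^+ 2 * c + k%:R ^+ 3 * d) -> 0 <= d.
Proof.
move=> h; rewrite leNgt; apply/negP => d0.
(* For [K >= 1] the lower terms are below [M * K ^+ 2], which the cubic term beats as soon as [K]
   exceeds [M / - d]. *)
pose M := `|a| + `|b| + `|c| + 1.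
have M0 : 0 < M by rewrite /M ltr_wpDl// !addr_ge0.
pose k := (Num.bound (M / - d)).+1; pose K : R := k%:R.
have K1 : 1 <= K by rewrite /K ler1n.
have hk : M < K * - d.
  rewrite -ltr_pdivrMr ?oppr_gt0//.
  apply: (@lt_trans _ _ (Num.bound (M / - d))%:R); last by rewrite ltr_nat.
  by apply: archi_boundP; apply: divr_ge0; apply: ltW; rewrite ?oppr_gt0.
have K2 : 1 <= K ^+ 2 by rewrite expr_ge1// (le_trans _ K1).
have KK2 : K <= K ^+ 2 by rewrite expr2 ler_peMr// (le_trans _ K1).
have := h k; rewrite -/K; apply/negP; rewrite -ltNge.
have h1 : a <= `|a| * K ^+ 2 by rewrite (le_trans (ler_norm _))// ler_peMr.
have h2 : K * b <= `|b| * K ^+ 2.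
  apply: (@le_trans _ _ (K * `|b|)); first by rewrite ler_wpM2l ?ler_norm// (le_trans _ K1).
  by rewrite mulrC ler_wpM2l.
have h3 : K ^+ 2 * c <= `|c| * K ^+ 2 by rewrite mulrC ler_wpM2r ?ler_norm// sqr_ge0.
have h4 : K ^+ 2 * M < K ^+ 2 * (K * - d) by rewrite ltr_pM2l// (lt_le_trans _ K2).
have : K ^+ 3 * d = - (K ^+ 2 * (K * - d)) by ring.
move: h1 h2 h3 h4; rewrite /M !mulrDr mulr1 => h1 h2 h3 h4 ->.
by move: h1 h2 h3 h4 K2; rewrite !(mulrC (K ^+ 2) `|_|); lra.
Qed.

(** * A weight whose cubed integral has mean at most one *)

Section moment_weight.
Context (R : realType) (X : ptopologicalType).
Hypothesis X_locally_compact : locally_compact [set: X].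
Hypothesis X_hausdorff : hausdorff_space X.
Hypothesis X_second_countable : @second_countable X.
Context (nu : {measure set (borel (signed_radon X R)) -> \bar R}).
Hypothesis nu_moment : finite_local_third_moment nu.
Implicit Types eta : signed_radon X R.
Notation N := (@point_configurations X R).

Let mN : measurable (N : set (borel (signed_radon X R))).
Proof. exact: configurations_borel. Qed.

Lemma int1_0 eta : int1 (fun=> 0) eta = 0.
Proof.
have C := @Cc0 R _ X_hausdorff.
have := int1ZD X_hausdorff (-1) eta C C.
rewrite [X in int1 X](_ : _ = (fun=> 0)); last by apply/funext => z; ring.
by move=> ->; ring.
Qed.

Lemma int1Z a f eta : Cc f -> int1 (fun x => a * f x) eta = a * int1 f eta.
Proof.
move=> Cf; have := int1ZD X_hausdorff a eta Cf (@Cc0 R _ X_hausdorff).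
rewrite int1_0 addr0 => <-; congr int1; apply/funext => y; by rewrite addr0.
Qed.

Lemma int1_sum (f : nat -> X -> R) n eta : (forall k, Cc (f k)) ->
  Cc (fun x => \sum_(k < n) f k x) /\
  int1 (fun x => \sum_(k < n) f k x) eta = \sum_(k < n) int1 (f k) eta.
Proof.
move=> Cf; elim: n => [|n [IH1 IH2]].
  rewrite big_ord0 (_ : (fun x => _) = (fun=> 0)); last by apply/funext => x; rewrite big_ord0.
  by split; [exact: Cc0|exact: int1_0].
rewrite (_ : (fun x => _) = (fun x => 1 * (\sum_(k < n) f k x) + f n x)); last first.
  by apply/funext => x; rewrite big_ord_recr mul1r.
split; first exact: CcZD.
by rewrite int1ZD// big_ord_recr IH2 mul1r.
Qed.

Lemma int1_ge0 f eta : N eta -> Cc f -> (forall y, 0 <= f y) -> 0 <= int1 f eta.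
Proof.
move=> eN Cf f0; rewrite -lee_fin -configuration_int1//.
by apply: integral_ge0 => y _; rewrite lee_fin.
Qed.

Lemma int1_borel f : Cc f ->
  measurable_fun setT (int1 f : borel (signed_radon X R) -> R).
Proof. by move=> Cf; apply: continuous_borel; exact: int1_continuous. Qed.

Lemma unit_moment_cover : exists psi : nat -> X -> R,
  [/\ forall n, Cc (psi n), forall n y, 0 <= psi n y <= 1,
      forall y, exists n, 0 < psi n y &
      forall n, (\int[nu]_(eta in N) (int1 (psi n) eta ^+ 3)%:E <= 1)%E].
Proof.
have [U [oU cU bU]] := relatively_compact_base X_locally_compact X_second_countable.
suff /choice[psi psiP] (n : nat) : exists f : X -> R, [/\ Cc f, forall y, 0 <= f y <= 1,
    forall y, U n y -> 0 < f y & (\int[nu]_(eta in N) (int1 f eta ^+ 3)%:E <= 1)%E].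
  exists psi; split=> [n|n y|y|n]; try by have [] := psiP n.
  by have [n Un _] := bU y setT openT I; exists n; have [_ _ + _] := psiP n; exact.
have [K cK UK] := cU n.
have [phi [Cphi phi01 phiK _]] := bump_compact R X_locally_compact X_hausdorff cK openT (@subsetT _ K).
have [_ [K' cK' phi0]] := (CcP X_hausdorff _).1 Cphi.
have phiK' y : 0 <= phi y <= \1_K' y.
  have /andP[-> h] := phi01 y; rewrite indicE; case: (boolP (y \in K')) => [//|].
  by rewrite notin_setE => /phi0 ->; rewrite lexx.
have phi_ge0 y : 0 <= phi y by have /andP[] := phi01 y.
have mphi : measurable_fun setT ((fun eta => int1 phi eta ^+ 3) : borel (signed_radon X R) -> R).
  by apply: measurable_funX; exact: int1_borel.
pose I := (\int[nu]_(eta in N) (int1 phi eta ^+ 3)%:E)%E.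
have I0 : (0 <= I)%E.
  by apply: integral_ge0 => eta eN; rewrite lee_fin exprn_ge0// int1_ge0.
have Ioo : (I < +oo)%E.
  apply: le_lt_trans (nu_moment cK'); apply: ge0_le_integral_all => eta eN.
    by rewrite lee_fin exprn_ge0// int1_ge0.
  exact: moment_indicator.
have If : I = (fine I)%:E by rewrite fineK// ge0_fin_numE.
have f0 : 0 <= fine I by rewrite fine_ge0.
(* Scaling by [t <= 1] multiplies the moment by [t ^+ 3 <= t], and [t * (1 + fine I) = 1]. *)
pose t := (1 + fine I)^-1.
have M0 : 0 < 1 + fine I by rewrite ltr_pwDl.
have t0 : 0 < t by rewrite invr_gt0.
have t1 : t <= 1 by rewrite invf_le1// lerDl.
exists (fun y => t * phi y); split.
- exact: CcZ.
- move=> y; have /andP[h1 h2] := phi01 y; have t0' := ltW t0; rewrite mulr_ge0//=.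
  by rewrite -[leRHS]mulr1; apply: ler_pM.
- by move=> y Uy; rewrite phiK ?mulr1//; exact: UK.
- under eq_integral do rewrite int1Z// exprMn EFinM.
  rewrite ge0_integralZl//; last 3 first.
  + by apply: measurable_funTS; exact/measurable_EFinP.
  + by move=> eta eN; rewrite lee_fin exprn_ge0// int1_ge0.
  + by rewrite lee_fin exprn_ge0// ltW.
  rewrite -/I If -EFinM lee_fin.
  apply: (@le_trans _ _ (t * (1 + fine I))); last by rewrite mulVf// gt_eqF.
  apply: ler_pM => //; [by rewrite exprn_ge0// ltW| |by rewrite lerDr].
  have t0' := ltW t0; by rewrite exprS ler_piMr// exprn_ile1.
Qed.

(** The partial sums have compact support and a uniformly small remainder, so Gamma vanishes at
    infinity. Monotone convergence is used twice, on X for each configuration and then for [nu];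
    measurability of the limit comes along. *)
Lemma moment_weight : exists Gamma : X -> R, [/\ C0 Gamma, (forall y, 0 < Gamma y),
  measurable_fun (N : set (borel (signed_radon X R))) (int3 (tensor3 Gamma)) &
  (\int[nu]_(eta in N) int3 (tensor3 Gamma) eta <= 1)%E].
Proof.
have [psi [Cpsi psi01 psi_pos psi_moment]] := unit_moment_cover.
pose w k : R := 2^-1 ^+ k.+1.
have w0 k : 0 <= w k by rewrite exprn_ge0// invr_ge0.
have w_pos k : 0 < w k by rewrite exprn_gt0// invr_gt0.
pose u k y := w k * psi k y.
have u0 k y : 0 <= u k y by have /andP[h _] := psi01 k y; exact: mulr_ge0.
have u1 k y : u k y <= 2^-1 ^+ k.+1.
  by have /andP[_ h] := psi01 k y; rewrite /u ler_piMr.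
have Cu k : Cc (u k) by exact: CcZ.
pose P n y := \sum_(k < n) u k y.
have CP n : Cc (P n) by have [] := int1_sum n point Cu.
have P0 n y : 0 <= P n y by apply: sumr_ge0.
have PS n y : P n y <= P n.+1 y by rewrite /P big_ord_recr/= lerDl.
have Pnd n m y : (n <= m)%N -> P n y <= P m y.
  elim: m => [|m IH]; first by rewrite leqn0 => /eqP ->.
  by rewrite leq_eqVlt => /predU1P[->//|/IH h]; exact: le_trans h (PS m y).
pose Gamma := geosum u.
have cG : continuous Gamma by apply: geosum_continuous => // k; have [] := Cu k.
have G0 y : 0 < Gamma y.
  have [n pn] := psi_pos y; apply: (geosum_gt0 u0 u1 (n := n)); exact: mulr_gt0.
have mG : measurable_fun setT (Gamma : borel X -> R) by exact: continuous_borel.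
have P_cvg y : P n y @[n --> \oo] --> Gamma y by exact: geosum_cvg.
have sum_w n : \sum_(k < n) w k <= 1.
  have -> : \sum_(k < n) w k = 1 - 2^-1 ^+ n.
    elim: n => [|n IH]; first by rewrite big_ord0 expr0 subrr.
    by rewrite big_ord_recr/= IH /w exprS; lra.
  by rewrite gerBl exprn_ge0// invr_ge0.
have iP0 n eta : N eta -> 0 <= int1 (P n) eta by move=> eN; exact: int1_ge0.
have iPnd eta : N eta -> forall n m, (n <= m)%N -> int1 (P n) eta <= int1 (P m) eta.
  move=> eN n m nm; rewrite -lee_fin -!configuration_int1//.
  by apply: ge0_le_integral_all => y _; rewrite lee_fin//; exact: Pnd.
pose G n eta := (int1 (P n) eta ^+ 3)%:E.
have mGn n : measurable_fun (N : set (borel (signed_radon X R))) (G n).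
  apply: measurable_funTS; apply/measurable_EFinP; apply: measurable_funX; exact: int1_borel.
have G_cvg eta : N eta -> G n eta @[n --> \oo] --> int3 (tensor3 Gamma) eta.
  move=> eN; rewrite (int3_tensor3 X_locally_compact X_hausdorff X_second_countable)//; last first.
    by move=> y; exact: ltW.
  pose I := (\int[pos eta]_y (Gamma y)%:E)%E.
  have I0 : (0 <= I)%E by apply: integral_ge0 => y _; rewrite lee_fin ltW.
  have h : (int1 (P n) eta)%:E @[n --> \oo] --> I.
    have -> : I = (\int[pos eta]_y limn (fun n => (P n y)%:E))%E.
      apply: eq_integral => y _; apply/esym/cvg_lim => //.
      by apply: cvg_EFin; [exact: nearW|exact: P_cvg].
    rewrite (_ : (fun n => _) = (fun n => \int[pos eta]_y (P n y)%:E)%E); last first.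
      by apply/funext => n; rewrite configuration_int1.
    apply: cvg_monotone_convergence => //.
    - by move=> n; apply/measurable_EFinP; exact: Cc_borel.
    - by move=> n y _; rewrite lee_fin.
    - by move=> y _ n m nm; rewrite lee_fin; exact: Pnd.
  rewrite (_ : G^~ eta = fun n =>
    (int1 (P n) eta)%:E * (int1 (P n) eta)%:E * (int1 (P n) eta)%:E)%E; last first.
    by apply/funext => n; rewrite /G !exprS expr0 mulr1 mulrA !EFinM.
  (* [I] may be +oo, and products of limits in [\bar R] are safe only away from [0 * +oo]. *)
  have II : (I *? I)%E.
    have [->|In0] := eqVneq I 0%E; first exact: mule_def_fin.
    have [If|Ioo] := boolP (I \is a fin_num); first exact: mule_def_fin.
    exact: mule_def_neq0_infty.
  have III : (I * I *? I)%E.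
    have [->|In0] := eqVneq I 0%E; first by rewrite mul0e; exact: mule_def_fin.
    have [If|Ioo] := boolP (I \is a fin_num); first by apply: mule_def_fin => //; exact: fin_numM.
    by apply: mule_def_neq0_infty => //; rewrite mule_neq0.
  by apply: cvgeM => //; apply: cvgeM.
exists Gamma; split=> //.
- split=> // e e0; have [n hn] := half_pow_lt e0.
  have [_ [K cK PK]] := (CcP X_hausdorff _).1 (CP n).
  exists K => // y nK; rewrite gtr0_norm//.
  apply: (le_lt_trans (geosum_le u0 u1 y n)).
  by rewrite -/(P n y) PK// add0r.
- exact: (@emeasurable_fun_cvg _ (borel (signed_radon X R)) R N G _ mGn G_cvg).
- have -> : (\int[nu]_(eta in N) int3 (tensor3 Gamma) eta = \int[nu]_(eta in N) limn (G^~ eta))%E.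
    by apply: eq_integral => eta /set_mem eN; apply/esym/cvg_lim => //; exact: G_cvg.
  have hc : (\int[nu]_(eta in N) G n eta)%E @[n --> \oo] --> (\int[nu]_(eta in N) limn (G^~ eta))%E.
    apply: cvg_monotone_convergence => //.
    - by move=> n eta eN; rewrite lee_fin exprn_ge0// iP0.
    - move=> eta eN n m nm; rewrite lee_fin lerXn2r ?nnegrE ?iP0//; exact: iPnd.
  rewrite -(cvg_lim _ hc)//; apply: lime_le; first by apply/cvg_ex; eexists; exact: hc.
  apply: nearW => n.
  pose F k eta := w k * int1 (psi k) eta ^+ 3.
  have psi0 k y : 0 <= psi k y by have /andP[] := psi01 k y.
  have F0 k eta : N eta -> (0 <= (F k eta)%:E)%E.
    by move=> eN; rewrite lee_fin mulr_ge0// exprn_ge0// int1_ge0.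
  have mi k : measurable_fun (N : set (borel (signed_radon X R)))
      (fun eta => (int1 (psi k) eta ^+ 3)%:E).
    apply: measurable_funTS; apply/measurable_EFinP; apply: measurable_funX; exact: int1_borel.
  apply: (@le_trans _ _ (\int[nu]_(eta in N) \sum_(k < n) (F k eta)%:E)%E).
    apply: ge0_le_integral_all => eta eN; first by rewrite lee_fin exprn_ge0// iP0.
    rewrite sumEFin lee_fin.
    have -> : int1 (P n) eta = \sum_(k < n) w k * int1 (psi k) eta.
      by have [_ ->] := int1_sum n eta Cu; apply: eq_bigr => k _; rewrite int1Z.
    apply: (cube_jensen (s := fun k => int1 (psi k) eta)) => // k; exact: int1_ge0.
  have mF k : measurable_fun (N : set (borel (signed_radon X R))) (fun eta => (F k eta)%:E).
    apply: measurable_funTS; apply/measurable_EFinP; apply: measurable_funM => //.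
    by apply: measurable_funX; exact: int1_borel.
  rewrite (@ge0_integral_sum _ (borel (signed_radon X R)) R nu N mN _
    (fun (k : 'I_n) eta => (F k eta)%:E) (fun k => mF k) (fun k => F0 k) (index_enum _)).
  apply: (@le_trans _ _ (\sum_(k < n) (w k)%:E)%E); last by rewrite sumEFin lee_fin.
  apply: lee_sum => k _; under eq_integral do rewrite EFinM.
  rewrite ge0_integralZl//; last 2 first.
    by move=> eta eN; rewrite lee_fin exprn_ge0// int1_ge0.
    by rewrite lee_fin.
  by rewrite -[leRHS]mule1 lee_pmul2l// lte_fin.
Qed.

End moment_weight.

(** * Multiples of a Dirac mass and the cubic condition *)

Section multiple_points.
Context (R : realType) (X : ptopologicalType).
Hypothesis X_locally_compact : locally_compact [set: X].
Hypothesis X_hausdorff : hausdorff_space X.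
Hypothesis X_second_countable : @second_countable X.

Lemma multiple_point (Gamma f1 : X -> R) (f2 : X * X -> R) (y : X) (k : nat) :
  continuous Gamma -> (forall y, 0 <= Gamma y) -> Cc f1 -> Cc f2 ->
  exists eta : signed_radon X R, [/\ point_configurations eta,
    int1 f1 eta = k%:R * f1 y, int2 f2 eta = k%:R ^+ 2 * f2 (y, y) &
    int3 (tensor3 Gamma) eta = ((k%:R * Gamma y) ^+ 3)%:E].
Proof.
move=> cG G0 C1 C2; pose x i := if (i < k)%N then Some y else None.
have xk (K : set X) i z : (k <= i)%N -> x i = Some z -> ~ K z by rewrite /x ltnNge => ->.
have lx : locally_finite x by move=> K _; exists k => i z; exact: xk.
have ex := slot_configP R X_locally_compact X_hausdorff lx.
exists (slot_config R X_locally_compact X_hausdorff lx).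
have xi (i : 'I_k) : x i = Some y by rewrite /x ltn_ord.
split.
- exact: (slots_point_configuration X_locally_compact X_hausdorff lx ex).
- have [_ [K cK fK]] := (CcP X_hausdorff _).1 C1.
  rewrite (slots_int1 X_hausdorff ex C1 cK (xk K) fK).
  under eq_bigr do rewrite xi/=.
  by rewrite sumr_const card_ord mulr_natl.
- have [K cK fK] := slots_int2 X_locally_compact X_hausdorff X_second_countable C2.
  rewrite (fK _ _ _ ex (xk K)).
  under eq_bigr do under eq_bigr do rewrite !xi/=.
  under eq_bigr do rewrite sumr_const card_ord.
  by rewrite sumr_const card_ord -mulrnA -natrX mulr_natl.
- have mG : measurable_fun setT (Gamma : borel X -> R) by exact: continuous_borel.
  rewrite (int3_tensor3 X_locally_compact X_hausdorff X_second_countable)//.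
  rewrite (@slot_integral _ (borel X) R x _ setT k Gamma)//.
  + under eq_bigr do rewrite xi/=.
    rewrite sumr_const card_ord -!EFinM mulr_natl; congr EFin.
    by rewrite !exprS expr0 mulr1 mulrA.
  + by move=> i z; exact: (xk setT).
  + by move=> z /(_ I).
Qed.

Context (L : (signed_radon X R -> R) -> R).

Theorem representing_cubic (nu : {measure set (borel (signed_radon X R)) -> \bar R}) :
  representing L nu -> finite_local_third_moment nu ->
  exists (r : R) (Gamma : X -> R),
     [/\ 0 < r, C0 Gamma, (forall x, 0 < Gamma x) &
       forall (f0 f3 : R) (f1 : X -> R) (f2 : X * X -> R),
         Cc f1 -> Cc f2 ->
         (forall eta, point_configurations eta ->
            (0 <= restricted_cubic Gamma f0 f1 f2 f3 eta)%E) ->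
         0 <= L (quadratic f0 f1 f2) + f3 * r].
Proof.
move=> [_ _ repr] nu_moment.
have [Gamma [GC0 G0 mI I1]] := moment_weight X_locally_compact X_hausdorff
  X_second_countable nu_moment.
exists 1, Gamma; split=> // f0 f3 f1 f2 C1 C2 q0.
(* The moment of Gamma is merely at most 1, not equal to it; replacing it by 1 in the integrated
   inequality requires this sign. *)
have f30 : 0 <= f3.
  pose y : X := point.
  rewrite -(pmulr_lge0 _ (exprn_gt0 3 (G0 y))).
  apply: (@cubic_leading_ge0 _ f0 (f1 y) (f2 (y, y))) => k.
  have cG : continuous Gamma by case: GC0.
  have [eta [eN e1 e2 e3]] := multiple_point y k cG (fun y => ltW (G0 y)) C1 C2.
  have := q0 _ eN; rewrite /restricted_cubic /quadratic e1 e2 e3 -EFinM -EFinD lee_fin.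
  rewrite exprMn => h; apply: le_trans h _; rewrite le_eqVlt; apply/orP; left; apply/eqP; ring.
have mN := configurations_borel X_locally_compact X_hausdorff X_second_countable (R := R).
pose N := @point_configurations X R.
pose b := @quadratic X R f0 f1 f2.
have [bi Lb] : nu.-integrable setT (EFin \o b) /\
    ((L b)%:E = \int[nu]_(eta in N) (b eta)%:E)%E.
  by apply: repr; exists f0, f1, f2.
pose J := int3 (tensor3 Gamma).
have mG : measurable_fun setT (Gamma : borel X -> R) by apply: continuous_borel; case: GC0.
have J0 eta : (0 <= J eta :> \bar R)%E.
  by apply: (int3_ge0 X_locally_compact X_hausdorff X_second_countable) => // y; exact: ltW.
have iJ : nu.-integrable N J.
  apply/integrableP; split; first exact: mI.
  apply: (@le_lt_trans _ _ 1%E); last exact: ltry.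
  by under eq_integral do rewrite gee0_abs//.
have ib : nu.-integrable N (EFin \o b) by exact: integrableS bi.
have i3 : nu.-integrable N (fun eta => f3%:E * J eta)%E by exact: integrableZl.
have : (0 <= \int[nu]_(eta in N) ((b eta)%:E + f3%:E * J eta))%E.
  by apply: integral_ge0 => eta; exact: q0.
rewrite (integralD mN ib i3) /= -Lb integralZl//.
have IJ0 : (0 <= \int[nu]_(eta in N) J eta)%E by apply: integral_ge0 => eta _; exact: J0.
have IJf : (\int[nu]_(eta in N) J eta)%E = (fine (\int[nu]_(eta in N) J eta)%E)%:E.
  by rewrite fineK// ge0_fin_numE// (le_lt_trans I1)// ltry.
have T1 : fine (\int[nu]_(eta in N) J eta)%E <= 1 by rewrite -lee_fin -IJf.
rewrite IJf -EFinM -EFinD lee_fin => /le_trans; apply; rewrite lerD2l.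
by apply: ler_wpM2l f30 _ _ T1.
Qed.

End multiple_points.

Theorem theorem3p2 (R : realType) (X : ptopologicalType)
    (X_noncompact : ~ compact [set: X])
    (X_locally_compact : locally_compact [set: X])
    (X_hausdorff : hausdorff_space X)
    (X_second_countable : @second_countable X)
    (L : (signed_radon X R -> R) -> R)
    (L_linear : linear_on_P2 L)
    (L_positive : N_positive L) :
  (exists nu : {measure set (borel (signed_radon X R)) -> \bar R},
     representing L nu /\ finite_local_third_moment nu)
  <->
  (exists (r : R) (Gamma : X -> R),
     [/\ 0 < r, C0 Gamma, (forall x, 0 < Gamma x) &
       forall (f0 f3 : R) (f1 : X -> R) (f2 : X * X -> R),
         Cc f1 -> Cc f2 ->
         (forall eta, point_configurations eta ->
            (0 <= restricted_cubic Gamma f0 f1 f2 f3 eta)%E) ->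
         0 <= L (quadratic f0 f1 f2) + f3 * r]).
Proof.
split=> [[nu [repr moment]]|[r [Gamma [r0 C0 G0 cubic]]]].
  exact: (representing_cubic X_locally_compact X_hausdorff X_second_countable repr moment).
exact: (cubic_representing X_locally_compact X_hausdorff X_second_countable L_linear
  r0 C0 G0 cubic).
Qed.
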